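(* Let $p$ be a prime, let $\Phi$ be a root system and let $G$ be a uniform pro-$p$ group of type $\Phi$. If $p$ is a nice prime for $\Phi$, then the Frobenius pair $(\Omega_G, \Omega_{G^p})$ satisfies the derivation hypothesis.
   Context: **Groups of Chevalley type.** Let $\mathbb{Z}_p$ be the $p$-adic integers and $\mathbb{F}_p$ the field with $p$ elements. A root system $\Phi$ is one each of whose indecomposable components has type in $\{A_n\,(n\ge 1), B_n\,(n\ge 2), C_n\,(n\ge 3), D_n\,(n\ge 4), E_6,E_7,E_8,F_4,G_2\}$. $\Phi(\mathbb{Z}_p)$ denotes the $\mathbb{Z}_p$-Lie algebra constructed from a Chevalley basis associated to $\Phi$ (the $\mathbb{Z}_p$-span of the simple co-roots $h_i$ and the root vectors $e_\alpha$, $\alpha\in\Phi$). A $\mathbb{Z}_p$-Lie algebra $L$ is powerful if it is free of finite rank over $\mathbb{Z}_p$ and $[L,L]\subseteq p^{\epsilon}L$, where $\epsilon=2$ if $p=2$ and $\epsilon=1$ otherwise. There is an isomorphism $L\mapsto \exp(L)$ between the category of powerful $\mathbb{Z}_p$-Lie algebras and the category of uniform pro-$p$ groups (Dixon–du Sautoy–Mann–Segal, Theorem 9.10), with inverse $\log$. For any integer $t\ge 1$ ($t\ge 2$ if $p=2$), $p^t\Phi(\mathbb{Z}_p)$ is powerful; a uniform pro-$p$ group is of type $\Phi$ if it is $\exp(p^t\Phi(\mathbb{Z}_p))$ for some such $t$. $G^p$ denotes the subgroup $\{g^p: g\in G\}=\exp(p\log G)$. The prime $p$ is nice for $\Phi$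 if $p\ge 5$ and $p\nmid n+1$ whenever $\Phi$ has an indecomposable component of type $A_n$. **Iwasawa algebras.** For a field $K$ of characteristic $p$ and a compact $p$-adic analytic group $G$, $KG:=\varprojlim K[G/N]$, the limit being over open normal subgroups $N$ of $G$; $\Omega_G:=\mathbb{F}_pG$. For $G$ uniform, $KG$ is filtered by powers of its augmentation ideal $\mathfrak m$ (the kernel of $KG\to K$): $F_{-n}KG=\mathfrak m^n$ for $n\ge 0$ and $F_nKG=KG$ for $n\ge 0$. **Frobenius pairs.** A filtered $K$-algebra $A$ has an increasing exhaustive separated filtration $(F_nA)_{n\in\mathbb{Z}}$ by subspaces with $1\in F_0A$ and $F_nA\cdot F_mA\subseteq F_{n+m}A$; it is complete if it is complete for the induced topology; $\operatorname{gr}A=\bigoplus_n F_nA/F_{n-1}A$. Let $A$ be a complete filtered $K$-algebra and $A_1$ a subalgebra with the subspace filtration $F_nA_1=F_nA\cap A_1$. Then $(A,A_1)$ is a Frobenius pair if: (i) $A_1$ is closed in $A$; (ii) $B:=\operatorname{gr}A$ is a commutative noetherian domain; (iii) the image $B_1$ of $\operatorname{gr}A_1$ in $B$ contains $B^{[p]}:=\{b^p:b\in B\}$; (iv) there are homogeneous $y_1,\dots,y_t\in B$ with $B=\bigoplus_{\alpha\in\{0,\dots,p-1\}^t}B_1\,y_1^{\alpha_1}\cdots y_t^{\alpha_t}$. For $G$ uniform, $(KG,KG^p)$ is known to be a Frobenius pair. **Sources of derivations.** If $a\in A$ and $n\ge0$ satisfy $[a,F_kA]\subseteq F_{k-n}A$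 for all $k\in\mathbb{Z}$, then $\{a,-\}_n:B\to B$ is the graded derivation with $b+F_{k-1}A\mapsto [a,b]+F_{k-n-1}A$ for $b\in F_kA$. A source of derivations for $(A,A_1)$ is a subset $\mathbf a=\{a_0,a_1,a_2,\dots\}$ of $A$, together with functions $\theta,\theta_1:\mathbf a\to\mathbb{N}$, such that (i) $[a_r,F_kA]\subseteq F_{k-\theta(a_r)}A$ for all $r\ge0$, $k\in\mathbb{Z}$; (ii) $[a_r,F_kA_1]\subseteq F_{k-\theta_1(a_r)}A$ for all $r\ge0$, $k\in\mathbb{Z}$; (iii) $\theta_1(a_r)-\theta(a_r)\to\infty$ as $r\to\infty$. $\mathcal S(A,A_1)$ is the set of all sources of derivations. For a graded ideal $I$ of $B$, a homogeneous $Y\in B$ lies in the $\mathbf a$-closure of $I$ if $\{a_r,Y\}_{\theta(a_r)}\in I$ for all $r\gg0$. **Derivation hypothesis.** Let $\mathcal D=\operatorname{Der}_{B_1}(B)$ be the set of $B_1$-linear derivations of $B$. The Frobenius pair $(A,A_1)$ satisfies the derivation hypothesis if for all homogeneous $X,Y\in B$ such that $Y$ lies in the $\mathbf a$-closure of $XB$ for all $\mathbf a\in\mathcal S(A,A_1)$, one has $\mathcal D(Y)\subseteq XB$. *)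

(* Defs.v *)
From HB Require Import structures.
From mathcomp Require Import all_boot all_order all_algebra.
From mathcomp Require Import finmap.
From mathcomp Require Import boolp classical_sets functions cardinality.
From mathcomp Require Import topology.

Set Implicit Arguments.
Unset Strict Implicit.
Unset Printing Implicit Defensive.

Import Order.TTheory GRing.Theory Num.Theory.

Local Open Scope classical_set_scope.
Local Open Scope ring_scope.

(* Used both for the group algebras K[G/N] and, with M = Z, for the Laurent
   polynomials A[t, 1/t] that contain the Rees ring of a filtered algebra. *)
Definition malg (R : nzRingType) (M : monoidType) := {fsfun M -> R with 0}.

Section MonoidAlgebraDef.
Context (R : nzRingType) (M : monoidType).
Implicit Types f g h : malg R M.

HB.instance Definition _ := Choice.on (malg R M).

Definition msing (x : M) (c : R) : malg R M := [fsfun [fsfun] with x |-> c].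

Lemma msingE x c y : msing x c y = if y == x then c else 0.
Proof. by rewrite /msing fsfun_withE fsfun0E. Qed.

Definition mzero : malg R M := [fsfun].
Definition mopp f : malg R M := [fsfun x in finsupp f => - f x].
Definition madd f g : malg R M :=
  [fsfun x in (finsupp f `|` finsupp g)%fset => f x + g x].

Lemma malg_dflt f x : x \notin finsupp f -> f x = 0.
Proof. exact: fsfun_dflt. Qed.

Lemma mzeroE x : mzero x = 0. Proof. by rewrite fsfun0E. Qed.
Lemma moppE f x : mopp f x = - f x.
Proof. by rewrite fsfunE; case: ifPn => // /malg_dflt ->; rewrite oppr0. Qed.
Lemma maddE f g x : madd f g x = f x + g x.
Proof.
rewrite fsfunE; case: ifPn => //; rewrite in_fsetU negb_or.
by case/andP=> /malg_dflt -> /malg_dflt ->; rewrite addr0.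
Qed.

Lemma maddA : associative madd.
Proof. by move=> f g h; apply/fsfunP => x; rewrite !maddE addrA. Qed.
Lemma maddC : commutative madd.
Proof. by move=> f g; apply/fsfunP => x; rewrite !maddE addrC. Qed.
Lemma madd0 : left_id mzero madd.
Proof. by move=> f; apply/fsfunP => x; rewrite maddE mzeroE add0r. Qed.
Lemma maddN : left_inverse mzero mopp madd.
Proof. by move=> f; apply/fsfunP => x; rewrite maddE moppE mzeroE addNr. Qed.

HB.instance Definition _ := GRing.isZmodule.Build (malg R M) maddA maddC madd0 maddN.

End MonoidAlgebraDef.

Section MonoidAlgebraExt.
Context (R : nzRingType) (M : monoidType).
Implicit Types f g h : malg R M.

Lemma malg0E x : (0 : malg R M) x = 0. Proof. exact: mzeroE. Qed.
Lemma malgNE f x : (- f) x = - f x. Proof. exact: moppE. Qed.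
Lemma malgDE f g x : (f + g) x = f x + g x. Proof. exact: maddE. Qed.
Lemma malgBE f g x : (f - g) x = f x - g x.
Proof. by rewrite malgDE malgNE. Qed.
Lemma malg_sumE I (r : seq I) (P : pred I) (F : I -> malg R M) x :
  (\sum_(i <- r | P i) F i) x = \sum_(i <- r | P i) (F i) x.
Proof.
by elim/big_rec2: _ => [|i a b _ <-]; rewrite ?malg0E // malgDE.
Qed.

(* The additive extension of  c [x] |-> F x c  to the monoid algebra. *)
Definition mext (V : zmodType) (F : M -> R -> V) f : V :=
  \sum_(x <- finsupp f) F x (f x).

Section Ext.
Context (V : zmodType) (F : M -> R -> V).
Hypothesis F_add : forall x, {morph F x : c d / c + d}.

Lemma mext_F0 x : F x 0 = 0.
Proof. by apply: (addrI (F x 0)); rewrite -F_add !addr0. Qed.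

Lemma mext_sub f (A : {fset M}) : (finsupp f `<=` A)%fset ->
  mext F f = \sum_(x <- A) F x (f x).
Proof.
move=> sfA; rewrite /mext (big_fset_incl _ sfA) // => x _ /malg_dflt ->.
exact: mext_F0.
Qed.

Lemma mextD f g : mext F (f + g) = mext F f + mext F g.
Proof.
pose A := (finsupp f `|` finsupp g `|` finsupp (f + g)%R)%fset.
rewrite !(@mext_sub _ A); last 3 first.
- by rewrite /A; apply/fsubsetP => x xf; rewrite !in_fsetU xf ?orbT.
- by rewrite /A; apply/fsubsetP => x xf; rewrite !in_fsetU xf ?orbT.
- by rewrite /A; apply/fsubsetP => x xf; rewrite !in_fsetU xf ?orbT.
by rewrite -big_split; apply: eq_bigr => x _; rewrite malgDE F_add.
Qed.

Lemma mext0 : mext F 0 = 0.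
Proof. by apply: (addrI (mext F 0)); rewrite -mextD !addr0. Qed.

Lemma mext_sum I (r : seq I) (P : pred I) (G : I -> malg R M) :
  mext F (\sum_(i <- r | P i) G i) = \sum_(i <- r | P i) mext F (G i).
Proof.
by elim/big_rec2: _ => [|i a b _ <-]; rewrite ?mext0 // mextD.
Qed.

Lemma mext_sing x c : mext F (msing x c) = F x c.
Proof.
rewrite (@mext_sub _ [fset x]%fset); last first.
  apply/fsubsetP => y; rewrite mem_finsupp msingE in_fset1.
  by case: (y == x) => //; rewrite eqxx.
by rewrite big_seq_fset1 msingE eqxx.
Qed.

End Ext.

Lemma msingD x : {morph @msing R M x : c d / c + d}.
Proof.
move=> c d; apply/fsfunP => y; rewrite malgDE !msingE.
by case: ifP => //; rewrite addr0.
Qed.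

Lemma malg_expand f : f = \sum_(x <- finsupp f) msing x (f x).
Proof.
apply/fsfunP => y; rewrite malg_sumE.
have [yf|nyf] := boolP (y \in finsupp f).
  rewrite (big_fsetD1 y) //= msingE eqxx big1_fset ?addr0 // => x.
  by rewrite !inE => /andP[/negPf nxy _] _; rewrite msingE eq_sym nxy.
rewrite (malg_dflt nyf) big1_fset // => x xf _; rewrite msingE.
by case: eqP => // yx; move: nyf; rewrite yx xf.
Qed.

Lemma mext_id f : mext (@msing R M) f = f.
Proof. by rewrite /mext -malg_expand. Qed.

Lemma mext_eq (V : zmodType) (F G : M -> R -> V) f :
  (forall x c, F x c = G x c) -> mext F f = mext G f.
Proof. by move=> FG; rewrite /mext; apply: eq_bigr. Qed.

Lemma mext_comp (V W : zmodType) (F : M -> R -> V) (T : V -> W) f :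
  {morph T : u v / u + v} -> T (mext F f) = mext (fun x c => T (F x c)) f.
Proof.
move=> TD; have T0 : T 0 = 0 by apply: (addrI (T 0)); rewrite -TD !addr0.
by rewrite /mext (big_morph T TD T0).
Qed.

Lemma mext_addF (V : zmodType) (F G : M -> R -> V) f :
  mext (fun x c => F x c + G x c) f = mext F f + mext G f.
Proof. by rewrite /mext big_split. Qed.

(* Convolution: the bilinear extension of  (c [x]) (d [y]) = (c d) [x y]. *)
Definition mmul f g : malg R M :=
  mext (fun x c => mext (fun y d => msing (x * y)%g (c * d)) g) f.

Definition mone : malg R M := msing 1%g 1.

Lemma mmul_inner_add x c :
  forall y, {morph (fun d => msing (x * y)%g (c * d) : malg R M) : d e / d + e}.
Proof. by move=> y d e; rewrite mulrDr msingD. Qed.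

Lemma mmul_outer_add g :
  forall x, {morph (fun c => mext (fun y d => msing (x * y)%g (c * d)) g
    : malg R M) : c e / c + e}.
Proof.
move=> x c e; rewrite -mext_addF; apply: mext_eq => y d.
by rewrite mulrDl msingD.
Qed.

Lemma mmulDl : left_distributive mmul +%R.
Proof. by move=> f g h; rewrite /mmul mextD //; exact: mmul_outer_add. Qed.

Lemma mmulDr : right_distributive mmul +%R.
Proof.
move=> f g h; rewrite /mmul -mext_addF; apply: mext_eq => x c.
by rewrite mextD //; exact: mmul_inner_add.
Qed.

Lemma mmul_sing x y c d :
  mmul (msing x c) (msing y d) = msing (x * y)%g (c * d).
Proof.
rewrite /mmul mext_sing; last exact: mmul_outer_add.
by rewrite mext_sing //; exact: mmul_inner_add.
Qed.

Lemma malg_ind (P : malg R M -> Prop) :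
  P 0 -> (forall f g, P f -> P g -> P (f + g)) ->
  (forall x c, P (msing x c)) -> forall f, P f.
Proof.
by move=> P0 PD PS f; rewrite [f]malg_expand; elim/big_ind: _.
Qed.

Lemma mmul0l f : mmul 0 f = 0.
Proof. by apply: (addrI (mmul 0 f)); rewrite -mmulDl !addr0. Qed.
Lemma mmul0r f : mmul f 0 = 0.
Proof. by apply: (addrI (mmul f 0)); rewrite -mmulDr !addr0. Qed.

Lemma mmulA : associative mmul.
Proof.
move=> f g h; elim/malg_ind: f => [|f1 f2 e1 e2|x c].
- by rewrite !mmul0l.
- by rewrite !mmulDl e1 e2.
elim/malg_ind: g => [|g1 g2 e1 e2|y d].
- by rewrite !(mmul0l, mmul0r).
- by rewrite !(mmulDl, mmulDr) e1 e2.
elim/malg_ind: h => [|h1 h2 e1 e2|z e].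
- by rewrite !mmul0r.
- by rewrite !mmulDr e1 e2.
by rewrite !mmul_sing mulgA mulrA.
Qed.

Lemma mmul1l : left_id mone mmul.
Proof.
move=> f; elim/malg_ind: f => [|f1 f2 e1 e2|x c]; rewrite ?mmul0r //.
- by rewrite mmulDr e1 e2.
- by rewrite mmul_sing mul1g mul1r.
Qed.

Lemma mmul1r : right_id mone mmul.
Proof.
move=> f; elim/malg_ind: f => [|f1 f2 e1 e2|x c]; rewrite ?mmul0l //.
- by rewrite mmulDl e1 e2.
- by rewrite mmul_sing mulg1 mulr1.
Qed.

Lemma mone_neq0 : mone != 0 :> malg R M.
Proof.
apply/eqP => /fsfunP/(_ 1%g); rewrite msingE eqxx malg0E.
by apply/eqP; exact: oner_neq0.
Qed.

HB.instance Definition _ := GRing.Zmodule_isNzRing.Build (malg R M)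
  mmulA mmul1l mmul1r mmulDl mmulDr mone_neq0.

Definition mscale (c : R) f : malg R M := mmul (msing 1%g c) f.

Lemma mscaleE c f x : mscale c f x = c * f x.
Proof.
rewrite /mscale; elim/malg_ind: f => [|f1 f2 e1 e2|y d].
- by rewrite mmul0r malg0E mulr0.
- by rewrite mmulDr !malgDE e1 e2 mulrDr.
by rewrite mmul_sing mul1g !msingE; case: ifP; rewrite ?mulr0.
Qed.

Lemma mscaleA a b f : mscale a (mscale b f) = mscale (a * b) f.
Proof. by apply/fsfunP => x; rewrite !mscaleE mulrA. Qed.
Lemma mscale1 : left_id 1 mscale.
Proof. by move=> f; apply/fsfunP => x; rewrite !mscaleE mul1r. Qed.
Lemma mscaleDr : right_distributive mscale +%R.
Proof. by move=> c f g; exact: mmulDr. Qed.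
Lemma mscaleDl f : {morph mscale^~ f : a b / a + b}.
Proof. by move=> a b; rewrite /mscale msingD mmulDl. Qed.

HB.instance Definition _ := GRing.Zmodule_isLmodule.Build R (malg R M)
  mscaleA mscale1 mscaleDr mscaleDl.

Lemma malgZE (c : R) f x : (c *: f) x = c * f x.
Proof. exact: mscaleE. Qed.

Lemma mscaleAl (c : R) f g : c *: (f * g) = (c *: f) * g.
Proof. exact: mmulA. Qed.

HB.instance Definition _ := GRing.Lmodule_isLalgebra.Build R (malg R M) mscaleAl.

Lemma malgM_sing x y c d :
  (msing x c : malg R M) * msing y d = msing (x * y)%g (c * d).
Proof. exact: mmul_sing. Qed.

Lemma malgZ_sing a x c : a *: (msing x c : malg R M) = msing x (a * c).
Proof. by rewrite [LHS]mmul_sing mul1g. Qed.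

End MonoidAlgebraExt.

Section MonoidAlgebraCom.
Context (R : comNzRingType) (M : monoidType).

Lemma mscaleAr (c : R) (f g : malg R M) : c *: (f * g) = f * (c *: g).
Proof.
elim/malg_ind: f => [|f1 f2 e1 e2|x a].
- by rewrite !mul0r scaler0.
- by rewrite !mulrDl scalerDr e1 e2.
elim/malg_ind: g => [|g1 g2 e1 e2|y b].
- by rewrite scaler0 !mulr0 scaler0.
- by rewrite scalerDr !mulrDr scalerDr e1 e2.
by rewrite malgM_sing !malgZ_sing malgM_sing mulrCA.
Qed.

HB.instance Definition _ := GRing.Lalgebra_isAlgebra.Build R (malg R M) mscaleAr.

Definition maug (f : malg R M) : R := mext (fun _ c => c) f.

End MonoidAlgebraCom.

Definition mpush (R : nzRingType) (M M' : monoidType) (phi : M -> M')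
  (f : malg R M) : malg R M' := mext (fun x c => msing (phi x) c) f.

Section MonoidAlgebraPush.
Context (R : comNzRingType) (M M' : monoidType) (phi : M -> M').
Hypothesis phi1 : phi 1%g = 1%g.
Hypothesis phiM : {morph phi : x y / (x * y)%g}.
Implicit Types f g : malg R M.

Lemma mpush_add x : {morph (fun c => msing (phi x) c : malg R M') : c d / c + d}.
Proof. exact: msingD. Qed.

Lemma mpushD : {morph @mpush R M M' phi : f g / f + g}.
Proof. by move=> f g; rewrite /mpush mextD //; exact: mpush_add. Qed.

Lemma mpush0 : mpush phi (0 : malg R M) = 0.
Proof. by rewrite /mpush mext0 //; exact: mpush_add. Qed.

Lemma mpush_sing x c : mpush phi (msing x c : malg R M) = msing (phi x) c.
Proof. by rewrite /mpush mext_sing //; exact: mpush_add. Qed.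

Lemma mpushN f : mpush phi (- f) = - mpush phi f.
Proof. by apply: (addrI (mpush phi f)); rewrite -mpushD !subrr mpush0. Qed.

Lemma mpush1 : mpush phi (1 : malg R M) = 1.
Proof. by rewrite mpush_sing phi1. Qed.

Lemma mpushM : {morph @mpush R M M' phi : f g / f * g}.
Proof.
move=> f g; elim/malg_ind: f => [|f1 f2 e1 e2|x c].
- by rewrite !(mpush0, mul0r).
- by rewrite !(mulrDl, mpushD) e1 e2.
elim/malg_ind: g => [|g1 g2 e1 e2|y d].
- by rewrite !(mpush0, mulr0).
- by rewrite !(mulrDr, mpushD) e1 e2.
by rewrite malgM_sing !mpush_sing malgM_sing phiM.
Qed.

Lemma mpushZ (c : R) f : mpush phi (c *: f) = c *: mpush phi f.
Proof.
elim/malg_ind: f => [|f1 f2 e1 e2|x d].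
- by rewrite !(mpush0, scaler0).
- by rewrite !(scalerDr, mpushD) e1 e2.
by rewrite malgZ_sing !mpush_sing malgZ_sing.
Qed.

Lemma maugD : {morph @maug R M : f g / f + g}.
Proof. by move=> f g; rewrite /maug mextD. Qed.

Lemma maug0 : maug (0 : malg R M) = 0.
Proof. by rewrite /maug mext0. Qed.

Lemma maug_sing x c : maug (msing x c : malg R M) = c.
Proof. by rewrite /maug mext_sing. Qed.

Lemma maugM : {morph @maug R M : f g / f * g}.
Proof.
move=> f g; elim/malg_ind: f => [|f1 f2 e1 e2|x c].
- by rewrite !(maug0, mul0r).
- by rewrite !(mulrDl, maugD) e1 e2.
elim/malg_ind: g => [|g1 g2 e1 e2|y d].
- by rewrite !(maug0, mulr0).
- by rewrite !(mulrDr, maugD) e1 e2.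
by rewrite malgM_sing !maug_sing.
Qed.

Lemma maugZ (c : R) f : maug (c *: f) = c * maug f.
Proof.
elim/malg_ind: f => [|f1 f2 e1 e2|x d].
- by rewrite !(maug0, scaler0, mulr0).
- by rewrite !(scalerDr, maugD) e1 e2 mulrDr.
by rewrite malgZ_sing !maug_sing.
Qed.

End MonoidAlgebraPush.

HB.mixin Record isTopologicalGroup G of Topological G & Group G := {
  mulg_continuous : continuous (fun u : G * G => (u.1 * u.2)%g);
  invg_continuous : continuous (fun x : G => x^-1%g)
}.

#[short(type="topGroupType")]
HB.structure Definition TopologicalGroup :=
  {G of Topological G & Group G & isTopologicalGroup G}.

Section Subgroups.
Context (G : groupType).
Implicit Types H S : set G.

Definition is_subgroup H :=
  [/\ H 1%g, (forall x y, H x -> H y -> H (x * y)%g) & (forall x, H x -> H x^-1%g)].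

Definition is_normal H := forall x g, H x -> H (x ^ g)%g.

Definition gen S : set G :=
  \bigcap_(H in [set H | is_subgroup H /\ S `<=` H]) H.

Definition left_cosets (P H : set G) : set (set G) :=
  [set [set (x * h)%g | h in H] | x in P].

Definition powers (n : nat) : set G := range (fun g : G => (g ^+ n)%g).

End Subgroups.
Arguments powers : clear implicits.

Record open_normal (G : topGroupType) := OpenNormal {
  on_set :> set G;
  _ : open on_set;
  _ : is_subgroup on_set;
  _ : is_normal on_set
}.

Section Quotient.
Context (G : topGroupType) (N : open_normal G).

Lemma on_open : open N. Proof. by case: N. Qed.
Lemma on_subgroup : is_subgroup N. Proof. by case: N. Qed.
Lemma on_normal : is_normal N. Proof. by case: N. Qed.

Definition coset_rel (x y : G) : bool := `[< on_set N (x^-1 * y)%g >].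

Lemma coset_rel_refl : reflexive coset_rel.
Proof. by move=> x; apply/asboolP; rewrite mulVg; case: on_subgroup. Qed.

Lemma coset_rel_sym : symmetric coset_rel.
Proof.
have s x y : coset_rel x y -> coset_rel y x.
  move=> /asboolP Nxy; apply/asboolP; have [_ _ /(_ _ Nxy)] := on_subgroup.
  by rewrite invgM invgK.
by move=> x y; apply/idP/idP; exact: s.
Qed.

Lemma coset_rel_trans : transitive coset_rel.
Proof.
move=> y x z /asboolP Nxy /asboolP Nyz; apply/asboolP.
have [_ NM _] := on_subgroup.
by have := NM _ _ Nxy Nyz; rewrite -mulgA (mulgA y) mulgV mul1g.
Qed.

Canonical coset_equiv := EquivRel coset_rel coset_rel_refl coset_rel_sym coset_rel_trans.
Canonical coset_encModRel := defaultEncModRel coset_rel.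

(* The discrete group G/N; x and y have the same class iff x N = y N. *)
Definition quotg := {eq_quot coset_rel}%qT.

HB.instance Definition _ : EqQuotient G coset_rel quotg := EqQuotient.on quotg.
HB.instance Definition _ := Choice.on quotg.

Definition qclass (x : G) : quotg := (\pi_quotg x)%qT.

Lemma qclassP x y : qclass x = qclass y <-> on_set N (x^-1 * y)%g.
Proof.
split=> [/eqP|Nxy]; last by apply/eqP; rewrite eqmodE; apply/asboolP.
by rewrite eqmodE => /asboolP.
Qed.

Lemma qclass_repr a : qclass (repr a) = a. Proof. exact: reprK. Qed.

Definition quotg_mul (a b : quotg) : quotg := qclass (repr a * repr b)%g.
Definition quotg_one : quotg := qclass 1%g.
Definition quotg_inv (a : quotg) : quotg := qclass (repr a)^-1%g.

Lemma quotg_mulE x y : quotg_mul (qclass x) (qclass y) = qclass (x * y)%g.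
Proof.
have [N1 NM NV] := on_subgroup; have NJ := on_normal.
rewrite /quotg_mul.
have /qclassP := qclass_repr (qclass x); have /qclassP := qclass_repr (qclass y).
set x' := repr (qclass x); set y' := repr (qclass y) => Ny Nx.
apply/qclassP; have := NM _ _ (NJ _ y' Nx) Ny.
by rewrite conjgE invgM !mulgA mulgK.
Qed.

Lemma quotg_invE x : quotg_inv (qclass x) = qclass x^-1%g.
Proof.
have [N1 NM NV] := on_subgroup; have NJ := on_normal.
have /qclassP := qclass_repr (qclass x); set x' := repr (qclass x) => Nx.
apply/qclassP; have := NJ _ x'^-1%g (NV _ Nx).
by rewrite conjgE invgM !invgK !mulgA mulgK.
Qed.

Lemma quotg_mulA : associative quotg_mul.
Proof.
move=> a b c; rewrite -(qclass_repr a) -(qclass_repr b) -(qclass_repr c).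
by rewrite !quotg_mulE mulgA.
Qed.
Lemma quotg_mul1 : left_id quotg_one quotg_mul.
Proof. by move=> a; rewrite -(qclass_repr a) quotg_mulE mul1g. Qed.
Lemma quotg_mulr1 : right_id quotg_one quotg_mul.
Proof. by move=> a; rewrite -(qclass_repr a) quotg_mulE mulg1. Qed.
Lemma quotg_mulV : left_inverse quotg_one quotg_inv quotg_mul.
Proof. by move=> a; rewrite -(qclass_repr a) quotg_invE quotg_mulE mulVg. Qed.
Lemma quotg_mulrV : right_inverse quotg_one quotg_inv quotg_mul.
Proof. by move=> a; rewrite -(qclass_repr a) quotg_invE quotg_mulE mulgV. Qed.

HB.instance Definition _ := isGroup.Build quotg
  quotg_mulA quotg_mul1 quotg_mulr1 quotg_mulV quotg_mulrV.

Lemma qclassM x y : qclass (x * y)%g = (qclass x * qclass y)%g.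
Proof. by rewrite -quotg_mulE. Qed.

End Quotient.

Definition quot_map (G : topGroupType) (M N : open_normal G) (a : quotg M) : quotg N :=
  qclass N (repr a).

Section QuotMap.
Context (G : topGroupType) (M N : open_normal G) (sMN : M `<=` N).

Lemma quot_mapE x : quot_map N (qclass M x) = qclass N x.
Proof. by apply/qclassP/sMN/qclassP; exact: qclass_repr. Qed.

Lemma quot_map1 : quot_map N (1%g : quotg M) = 1%g.
Proof. exact: quot_mapE. Qed.

Lemma quot_mapM : {morph @quot_map G M N : a b / (a * b)%g}.
Proof.
move=> a b; rewrite -(qclass_repr a) -(qclass_repr b).
by rewrite -qclassM !quot_mapE qclassM.
Qed.

End QuotMap.

Section Iwasawa.
Context (K : fieldType) (G : topGroupType).

(* K G, the inverse limit of the K[G/N]: its elements are the compatible families. *)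
Record iwasawa := Iwasawa {
  iw_fam :> forall N : open_normal G, malg K (quotg N);
  iw_compat : forall M N : open_normal G, M `<=` N ->
    mpush (@quot_map G M N) (iw_fam M) = iw_fam N
}.

Implicit Types f g h : iwasawa.

Lemma iwP f g : (forall N, f N = g N) -> f = g.
Proof.
case: f g => [f fc] [g gc] /= fg.
have {}fg : f = g by apply: functional_extensionality_dep.
by subst g; congr Iwasawa.
Qed.

HB.instance Definition _ := gen_eqMixin iwasawa.
HB.instance Definition _ := gen_choiceMixin iwasawa.

Definition iw_zero : iwasawa := @Iwasawa (fun=> 0) (fun M N _ => mpush0 _ _).

Lemma iw_add_compat f g (M N : open_normal G) : M `<=` N ->
  mpush (@quot_map G M N) (f M + g M) = f N + g N.
Proof. by move=> sMN; rewrite mpushD !iw_compat. Qed.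
Definition iw_add f g := Iwasawa (@iw_add_compat f g).

Lemma iw_opp_compat f (M N : open_normal G) : M `<=` N ->
  mpush (@quot_map G M N) (- f M) = - f N.
Proof. by move=> sMN; rewrite mpushN !iw_compat. Qed.
Definition iw_opp f := Iwasawa (@iw_opp_compat f).

Lemma iw_mul_compat f g (M N : open_normal G) : M `<=` N ->
  mpush (@quot_map G M N) (f M * g M) = f N * g N.
Proof. by move=> sMN; rewrite mpushM ?iw_compat //; exact: quot_mapM. Qed.
Definition iw_mul f g := Iwasawa (@iw_mul_compat f g).

Lemma iw_one_compat (M N : open_normal G) : M `<=` N ->
  mpush (@quot_map G M N) (1 : malg K _) = 1.
Proof. by move=> sMN; rewrite mpush1 //; exact: quot_map1. Qed.
Definition iw_one := Iwasawa iw_one_compat.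

Lemma iw_scale_compat (c : K) f (M N : open_normal G) : M `<=` N ->
  mpush (@quot_map G M N) (c *: f M) = c *: f N.
Proof. by move=> sMN; rewrite mpushZ !iw_compat. Qed.
Definition iw_scale c f := Iwasawa (@iw_scale_compat c f).

Lemma setT_open_normal : [/\ open [set: G], is_subgroup [set: G] & is_normal [set: G]].
Proof. by split=> //; exact: openT. Qed.
Definition whole_group : open_normal G :=
  let: And3 a b c := setT_open_normal in OpenNormal a b c.

Lemma iw_addA : associative iw_add.
Proof. by move=> f g h; apply: iwP => N /=; rewrite addrA. Qed.
Lemma iw_addC : commutative iw_add.
Proof. by move=> f g; apply: iwP => N /=; rewrite addrC. Qed.
Lemma iw_add0 : left_id iw_zero iw_add.
Proof. by move=> f; apply: iwP => N /=; rewrite add0r. Qed.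
Lemma iw_addN : left_inverse iw_zero iw_opp iw_add.
Proof. by move=> f; apply: iwP => N /=; rewrite addNr. Qed.
HB.instance Definition _ :=
  GRing.isZmodule.Build iwasawa iw_addA iw_addC iw_add0 iw_addN.

Lemma iw_mulA : associative iw_mul.
Proof. by move=> f g h; apply: iwP => N /=; rewrite mulrA. Qed.
Lemma iw_mul1 : left_id iw_one iw_mul.
Proof. by move=> f; apply: iwP => N /=; rewrite mul1r. Qed.
Lemma iw_mulr1 : right_id iw_one iw_mul.
Proof. by move=> f; apply: iwP => N /=; rewrite mulr1. Qed.
Lemma iw_mulDl : left_distributive iw_mul +%R.
Proof. by move=> f g h; apply: iwP => N /=; rewrite mulrDl. Qed.
Lemma iw_mulDr : right_distributive iw_mul +%R.
Proof. by move=> f g h; apply: iwP => N /=; rewrite mulrDr. Qed.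
Lemma iw_one_neq0 : iw_one != 0.
Proof.
apply/eqP => /(congr1 (fun f : iwasawa => f whole_group)) /= /eqP.
by apply/negP; exact: oner_neq0.
Qed.
HB.instance Definition _ := GRing.Zmodule_isNzRing.Build iwasawa
  iw_mulA iw_mul1 iw_mulr1 iw_mulDl iw_mulDr iw_one_neq0.

Lemma iw_scaleA a b f : iw_scale a (iw_scale b f) = iw_scale (a * b) f.
Proof. by apply: iwP => N /=; rewrite scalerA. Qed.
Lemma iw_scale1 : left_id 1 iw_scale.
Proof. by move=> f; apply: iwP => N /=; rewrite scale1r. Qed.
Lemma iw_scaleDr : right_distributive iw_scale +%R.
Proof. by move=> c f g; apply: iwP => N /=; rewrite scalerDr. Qed.
Lemma iw_scaleDl f : {morph iw_scale^~ f : a b / a + b}.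
Proof. by move=> a b; apply: iwP => N /=; rewrite scalerDl. Qed.
HB.instance Definition _ := GRing.Zmodule_isLmodule.Build K iwasawa
  iw_scaleA iw_scale1 iw_scaleDr iw_scaleDl.

Lemma iw_scaleAl (c : K) f g : c *: (f * g) = (c *: f) * g.
Proof. by apply: iwP => N /=; rewrite scalerAl. Qed.
HB.instance Definition _ := GRing.Lmodule_isLalgebra.Build K iwasawa iw_scaleAl.
Lemma iw_scaleAr (c : K) f g : c *: (f * g) = f * (c *: g).
Proof. by apply: iwP => N /=; rewrite scalerAr. Qed.
HB.instance Definition _ := GRing.Lalgebra_isAlgebra.Build K iwasawa iw_scaleAr.

(* The augmentation K G -> K[G/G] = K. *)
Definition iw_aug f : K := maug (f whole_group).

Definition aug_ideal : set iwasawa := [set f : iwasawa | iw_aug f = 0].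

(* For a closed subgroup H the groups H/(H & N) = HN/N, N open normal in G, are
   cofinal among the finite quotients of H, so that K H is the inverse limit of
   the K[HN/N], seen inside K G. *)
Definition iw_sub (H : set G) : set iwasawa :=
  [set f : iwasawa | forall (N : open_normal G) (a : quotg N),
     f N a != 0 -> exists2 x, H x & a = qclass N x].

End Iwasawa.

(* The additive group of the integers as a multiplicative monoid. *)
Definition zmon : Type := int.
HB.instance Definition _ := Choice.on zmon.
HB.instance Definition _ := isMonoid.Build zmon
  (@addrA int) (@add0r int) (@addr0 int).

(* An increasing multiplicative filtration by subspaces. That it is exhaustive and
   separated is not needed to form gr A; see [filtered_algebra]. *)
Record filtration (K : fieldType) (A : algType K) := Filtration {
  fil :> int -> set A;
  fil0 : forall n, fil n 0;
  filD : forall n x y, fil n x -> fil n y -> fil n (x + y);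
  filZ : forall n (c : K) x, fil n x -> fil n (c *: x);
  fil_incr : forall n m : int, n <= m -> fil n `<=` fil m;
  fil1 : fil 0 1;
  filM : forall n m x y, fil n x -> fil m y -> fil (n + m) (x * y)
}.

Section AssociatedGraded.
Context (K : fieldType) (A : algType K) (F : filtration A).

Local Notation Fil := (fil F).

Lemma filN n x : Fil n x -> Fil n (- x).
Proof. by move=> Fx; rewrite -scaleN1r; exact: filZ. Qed.
Lemma filB n x y : Fil n x -> Fil n y -> Fil n (x - y).
Proof. by move=> Fx Fy; apply: filD => //; exact: filN. Qed.
Lemma fil_sum n I (r : seq I) (P : pred I) (E : I -> A) :
  (forall i, P i -> Fil n (E i)) -> Fil n (\sum_(i <- r | P i) E i).
Proof. by move=> FE; elim/big_ind: _ => //; [exact: fil0|exact: filD]. Qed.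

(* The Rees ring, i.e. the sum of the (F_n A) t^n in A[t, 1/t]. *)
Definition rees_pred : {pred malg A zmon} :=
  fun u => `[< forall n : int, Fil n (u n) >].

(* The ideal of the Rees ring which is the sum of the (F_(n-1) A) t^n. *)
Definition rees_low (u : malg A zmon) : bool :=
  `[< forall n : int, Fil (n - 1) (u n) >].

Lemma reesP (u : malg A zmon) : reflect (forall n : int, Fil n (u n)) (u \in rees_pred).
Proof. exact: asboolP. Qed.

Lemma zmon_mulE (x y : zmon) : (x * y)%g = (x : int) + (y : int) :> int.
Proof. by []. Qed.

Lemma malg_mul_fil (d : int) (u v : malg A zmon) :
  (forall n m : int, Fil (n + m - d) (u n * v m)) ->
  forall n : int, Fil (n - d) ((u * v) n).
Proof.
move=> uv n; rewrite [u * v]/(mmul u v) /mmul /mext malg_sumE.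
apply: fil_sum => i _; rewrite malg_sumE; apply: fil_sum => j _.
rewrite msingE; case: eqP => [->|_]; last exact: fil0.
by rewrite zmon_mulE.
Qed.

Lemma rees_subring : subring_closed rees_pred.
Proof.
split.
- apply/reesP => n; rewrite [1]/(msing 1%g 1) msingE.
  by case: eqP => [->|_]; [exact: fil1|exact: fil0].
- by move=> u v /reesP Fu /reesP Fv; apply/reesP => n; rewrite malgBE; exact: filB.
- move=> u v /reesP Fu /reesP Fv; apply/reesP => n; rewrite -[n in Fil n]subr0.
  by apply: malg_mul_fil => a b; rewrite subr0; exact: filM.
Qed.
HB.instance Definition _ := GRing.isSubringClosed.Build _ rees_pred rees_subring.

Record rees := Rees { rees_val : malg A zmon; rees_valP : rees_val \in rees_pred }.
HB.instance Definition _ := [isSub for rees_val].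
HB.instance Definition _ := [Choice of rees by <:].
HB.instance Definition _ := [SubChoice_isSubNzRing of rees by <:].

Lemma rees_fil (u : rees) (n : int) : Fil n (rees_val u n).
Proof. by case: u => u /= /reesP. Qed.

Definition rees_ideal : {pred rees} := fun u => rees_low (val u).

Lemma rees_idealP (u : rees) :
  reflect (forall n : int, Fil (n - 1) (rees_val u n)) (u \in rees_ideal).
Proof. exact: asboolP. Qed.

Lemma rees_ideal_zmod : zmod_closed rees_ideal.
Proof.
split; first by apply/rees_idealP => n; rewrite /= malg0E; exact: fil0.
move=> u v /rees_idealP Iu /rees_idealP Iv; apply/rees_idealP => n.
by rewrite /= malgBE; exact: filB.
Qed.
HB.instance Definition _ := GRing.isZmodClosed.Build rees rees_ideal rees_ideal_zmod.

Lemma rees_idealMl (u v : rees) : v \in rees_ideal -> u * v \in rees_ideal.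
Proof.
move=> /rees_idealP Iv; apply/rees_idealP; apply: malg_mul_fil => n m.
by rewrite -addrA; apply: filM => //; exact: rees_fil.
Qed.

Lemma rees_idealMr (u v : rees) : u \in rees_ideal -> u * v \in rees_ideal.
Proof.
move=> /rees_idealP Iu; apply/rees_idealP; apply: malg_mul_fil => n m.
by rewrite addrAC; apply: filM => //; exact: rees_fil.
Qed.

(* gr A, the direct sum of the F_n A / F_(n-1) A, as a quotient of the Rees ring. *)
Definition gr := (Quotient.quot rees_ideal).
HB.instance Definition _ := GRing.Zmodule.on gr.

Definition grpi (u : rees) : gr := (\pi_gr u)%qT.

Lemma grpiP u v : grpi u = grpi v <-> u - v \in rees_ideal.
Proof.
split=> [/eqP|Iuv]; first by rewrite -Quotient.idealrBE.
by apply/eqP; rewrite -Quotient.idealrBE.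
Qed.

Lemma grpi_repr b : grpi (repr b) = b. Proof. exact: reprK. Qed.

Lemma grpiD : {morph grpi : u v / u + v}.
Proof. by move=> u v; rewrite /grpi !piE. Qed.

Definition gr_one : gr := grpi 1.
Definition gr_mul (a b : gr) : gr := grpi (repr a * repr b).

Lemma gr_mulE u v : gr_mul (grpi u) (grpi v) = grpi (u * v).
Proof.
have /grpiP := grpi_repr (grpi u); have /grpiP := grpi_repr (grpi v).
set u' := repr (grpi u); set v' := repr (grpi v) => Iv Iu; apply/grpiP.
have -> : u' * v' - u * v = u' * (v' - v) + (u' - u) * v.
  by rewrite mulrBr mulrBl addrA subrK.
by apply: rpredD; [exact: rees_idealMl|exact: rees_idealMr].
Qed.

Lemma gr_mulA : associative gr_mul.
Proof.
move=> a b c; rewrite -(grpi_repr a) -(grpi_repr b) -(grpi_repr c).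
by rewrite !gr_mulE mulrA.
Qed.
Lemma gr_mul1 : left_id gr_one gr_mul.
Proof. by move=> a; rewrite -(grpi_repr a) gr_mulE mul1r. Qed.
Lemma gr_mulr1 : right_id gr_one gr_mul.
Proof. by move=> a; rewrite -(grpi_repr a) gr_mulE mulr1. Qed.
Lemma gr_mulDl : left_distributive gr_mul +%R.
Proof.
move=> a b c; rewrite -(grpi_repr a) -(grpi_repr b) -(grpi_repr c).
by rewrite -grpiD !gr_mulE mulrDl grpiD.
Qed.
Lemma gr_mulDr : right_distributive gr_mul +%R.
Proof.
move=> a b c; rewrite -(grpi_repr a) -(grpi_repr b) -(grpi_repr c).
by rewrite -grpiD !gr_mulE mulrDr grpiD.
Qed.
(* Only a possibly zero ring: gr A = 0 when 1 lies in F_(-1) A. *)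
HB.instance Definition _ := GRing.Zmodule_isPzRing.Build gr
  gr_mulA gr_mul1 gr_mulr1 gr_mulDl gr_mulDr.

(* The class x + F_(n-1) A in degree n, for x in F_n A; zero for other x. *)
Definition symb (n : int) (x : A) : gr := grpi (insubd 0 (msing (n : zmon) x)).

Definition homogeneous (b : gr) := exists n x, Fil n x /\ b = symb n x.

(* The image of gr A_1 in gr A, for the subspace filtration on A_1. *)
Definition gr_sub (A1 : set A) : set gr :=
  [set b | exists2 u : rees, (forall n : int, A1 (rees_val u n)) & b = grpi u].

(* {a, -}_n : gr A -> gr A, i.e. b + F_(k-1) A |-> [a, b] + F_(k-n-1) A in degree k;
   meaningful when [a, F_k A] lies in F_(k-n) A for all k. *)
Definition gr_bracket (a : A) (n : nat) (b : gr) : gr :=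
  let u := rees_val (repr b) in
  \sum_(k <- finsupp u) symb ((k : int) - n%:Z) (a * u k - u k * a).

Lemma symbE n x : Fil n x -> exists2 w : rees, symb n x = grpi w &
  rees_val w = msing (n : zmon) x.
Proof.
move=> Fx; exists (insubd (0 : rees) (msing (n : zmon) x)) => //.
rewrite -[LHS]/(val _) val_insubd; case: ifP => // /negP[]; apply/reesP => m.
by rewrite msingE; case: eqP => [->|_] //; exact: fil0.
Qed.

Lemma symb_eq n x y : Fil n x -> Fil n y -> Fil (n - 1) (x - y) -> symb n x = symb n y.
Proof.
move=> Fx Fy Fxy; have [w -> wE] := symbE Fx; have [v -> vE] := symbE Fy.
apply/grpiP/rees_idealP => m; rewrite /= malgBE wE vE !msingE.
by case: eqP => [->|_] //; rewrite subrr; exact: fil0.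
Qed.

Lemma symb0 n : symb n 0 = 0.
Proof.
have [w -> wE] := symbE (fil0 F n); have -> : w = 0 :> rees.
  apply/val_inj/fsfunP => m; rewrite -[val w]/(rees_val w) wE msingE malg0E.
  by case: ifP.
by rewrite /grpi !piE.
Qed.

Lemma symb_low n x : Fil (n - 1) x -> symb n x = 0.
Proof.
move=> Fx; rewrite -(symb0 n); apply: symb_eq; rewrite ?subr0 //; last exact: fil0.
by apply: fil_incr Fx; rewrite gerBl.
Qed.

Lemma gr_bracket_symb a n (k : int) x :
  (forall (j : int) y, Fil j y -> Fil (j - n%:Z) (a * y - y * a)) -> Fil k x ->
  gr_bracket a n (symb k x) = symb (k - n%:Z) (a * x - x * a).
Proof.
move=> Fa Fx; rewrite /gr_bracket; have [w -> wE] := symbE Fx.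
have /grpiP/rees_idealP Iu := grpi_repr (grpi w).
have := rees_fil (repr (grpi w)); set u := rees_val (repr (grpi w)) => Fu.
have {}Iu (j : int) : Fil (j - 1) (u j - (if j == k then x else 0)).
  by have := Iu j; rewrite /= malgBE wE msingE.
have low (j : int) y : Fil (j - 1) y -> Fil (j - n%:Z - 1) (a * y - y * a).
  by move=> Fy; rewrite addrAC; exact: Fa.
have off (j : int) : j != k -> symb (j - n%:Z) (a * u j - u j * a) = 0.
  move=> /negPf jk; apply: symb_low; apply: low.
  by have := Iu j; rewrite jk subr0.
have at_k : symb (k - n%:Z) (a * u k - u k * a) = symb (k - n%:Z) (a * x - x * a).
  apply: symb_eq; try exact: Fa.
  have -> : a * u k - u k * a - (a * x - x * a) = a * (u k - x) - (u k - x) * a.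
    by rewrite mulrBr mulrBl !opprB addrACA [RHS]addrACA [- (u k * a) + _]addrC.
  by apply: low; have := Iu k; rewrite eqxx.
have [ku|ku] := boolP ((k : zmon) \in finsupp u).
  rewrite (big_fsetD1 (k : zmon)) //= at_k big1_fset ?addr0 // => j.
  by rewrite !inE => /andP[jk _] _; exact: off.
rewrite -at_k (malg_dflt ku) mulr0 mul0r subrr symb0 big1_fset // => j ju _.
by apply: off; apply: contraNneq ku => <-.
Qed.

Definition filtered_algebra :=
  (forall x : A, exists n, Fil n x) /\ (forall x : A, (forall n, Fil n x) -> x = 0).

(* Z-indexed filtrations define metrizable topologies: sequences suffice. *)
Definition complete_filtration :=
  forall u : nat -> A,
    (forall n, exists M, forall i j, (M <= i)%N -> (M <= j)%N -> Fil n (u i - u j)) ->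
    exists l, forall n, exists M, forall i, (M <= i)%N -> Fil n (u i - l).

Definition filtration_closed (A1 : set A) :=
  forall x : A, (forall n, exists2 y, A1 y & Fil n (x - y)) -> A1 x.

Definition subalgebra (A1 : set A) :=
  [/\ A1 1, (forall x y, A1 x -> A1 y -> A1 (x + y)),
      (forall (c : K) x, A1 x -> A1 (c *: x)) &
      (forall x y, A1 x -> A1 y -> A1 (x * y))].

End AssociatedGraded.
Arguments gr_sub [K A] F A1 _.

Section RingPredicates.
Context (B : pzRingType).

Definition ideal (I : set B) :=
  [/\ I 0, (forall x y, I x -> I y -> I (x + y)) &
      (forall b x, I x -> I (b * x) /\ I (x * b))].

Definition commutative_noetherian_domain :=
  [/\ commutative ( *%R : B -> B -> B),
      (1 : B) <> 0, (forall x y : B, x * y = 0 -> x = 0 \/ y = 0) &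
      forall I, ideal I -> exists (n : nat) (g : 'I_n -> B),
        I = [set x | exists c : 'I_n -> B, x = \sum_(i < n) c i * g i]].

Definition principal (x : B) : set B := range (fun b => x * b).

Definition derivation_over (B1 : set B) (D : B -> B) :=
  [/\ {morph D : x y / x + y},
      (forall x y, D (x * y) = D x * y + x * D y) &
      (forall b x, B1 b -> D (b * x) = b * D x)].

End RingPredicates.

Section FrobeniusPairs.
Context (p : nat) (K : fieldType) (A : algType K) (F : filtration A) (A1 : set A).

Record frobenius_pair : Prop := FrobeniusPair {
  fp_filtered : filtered_algebra F;
  fp_complete : complete_filtration F;
  fp_subalgebra : subalgebra A1;
  fp_closed : filtration_closed F A1;
  fp_gr : commutative_noetherian_domain (gr F);
  fp_pth_powers : forall b : gr F, gr_sub F A1 (b ^+ p);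
  fp_basis : exists (t : nat) (y : 'I_t -> gr F), (forall i, homogeneous (y i)) /\
    forall b : gr F, exists! c : {ffun {ffun 'I_t -> 'I_p} -> gr F},
      (forall e, gr_sub F A1 (c e)) /\ b = \sum_e c e * \prod_(i < t) y i ^+ e i
}.

(* a_0, a_1, ...  with theta and theta_1 defined on the elements of A. *)
Record source_of_derivations (a : nat -> A) (theta theta1 : A -> nat) : Prop := Source {
  src_theta : forall r (k : int) x, F k x ->
    F (k - (theta (a r))%:Z) (a r * x - x * a r);
  src_theta1 : forall r (k : int) x, F k x -> A1 x ->
    F (k - (theta1 (a r))%:Z) (a r * x - x * a r);
  src_infty : forall M : nat, exists R : nat, forall r, (R <= r)%N ->
    (theta (a r) + M <= theta1 (a r))%N
}.

Definition in_closure (a : nat -> A) (theta : A -> nat) (I : set (gr F)) (Y : gr F) :=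
  exists R : nat, forall r, (R <= r)%N -> I (gr_bracket (a r) (theta (a r)) Y).

Definition derivation_hypothesis :=
  forall X Y : gr F, homogeneous X -> homogeneous Y ->
    (forall a theta theta1, source_of_derivations a theta theta1 ->
       in_closure a theta (principal X) Y) ->
    forall D, derivation_over (gr_sub F A1) D -> principal X (D Y).

End FrobeniusPairs.

Section IdealPowers.
Context (K : fieldType) (A : algType K).
Implicit Types I J : set A.

Definition ideal_mul I J : set A :=
  [set x | exists2 s : seq (A * A), (forall u, u \in s -> I u.1 /\ J u.2) &
     x = \sum_(u <- s) u.1 * u.2].

Fixpoint ideal_pow I (n : nat) : set A :=
  if n is n'.+1 then ideal_mul (ideal_pow I n') I else setT.

Lemma ideal_mulP I J x y : I x -> J y -> ideal_mul I J (x * y).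
Proof.
move=> Ix Jy; exists [:: (x, y)]; last by rewrite big_seq1.
by move=> u; rewrite inE => /eqP ->.
Qed.

Lemma ideal_mul_ind I J (P : A -> Prop) :
  P 0 -> (forall x y, P x -> P y -> P (x + y)) ->
  (forall x y, I x -> J y -> P (x * y)) -> ideal_mul I J `<=` P.
Proof.
move=> P0 PD PM _ [s sIJ ->]; rewrite big_seq.
by elim/big_ind: _ => // u /sIJ[]; exact: PM.
Qed.

Lemma ideal_mul_ideal I J : ideal I -> ideal J -> ideal (ideal_mul I J).
Proof.
have D x y : ideal_mul I J x -> ideal_mul I J y -> ideal_mul I J (x + y).
  move=> [s sP ->] [r rP ->]; exists (s ++ r); last by rewrite big_cat.
  by move=> u; rewrite mem_cat => /orP[/sP|/rP].
have Z : ideal_mul I J 0 by exists [::]; rewrite ?big_nil.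
move=> [I0 ID IM] [J0 JD JM]; split=> // b x IJx; split.
- move: x IJx; apply: ideal_mul_ind; first by rewrite mulr0.
  + by move=> x y; rewrite mulrDr; exact: D.
  + by move=> x y Ix Jy; rewrite mulrA; apply: ideal_mulP => //; case: (IM b x).
- move: x IJx; apply: ideal_mul_ind; first by rewrite mul0r.
  + by move=> x y; rewrite mulrDl; exact: D.
  + by move=> x y Ix Jy; rewrite -mulrA; apply: ideal_mulP => //; case: (JM b y).
Qed.

Lemma ideal_pow_ideal I n : ideal I -> ideal (ideal_pow I n).
Proof. by move=> idI; elim: n => //= n IHn; exact: ideal_mul_ideal. Qed.

Lemma ideal_powS I n : ideal I -> ideal_pow I n.+1 `<=` ideal_pow I n.
Proof.
move=> idI; have [P0 PD PM] := ideal_pow_ideal n idI.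
by apply: ideal_mul_ind => // x y Px _; case: (PM y x).
Qed.

Lemma ideal_pow_le I m n : ideal I -> (m <= n)%N -> ideal_pow I n `<=` ideal_pow I m.
Proof.
move=> idI /subnK <-; elim: (n - m)%N => // k IHk x.
by rewrite addSn => /(ideal_powS idI)/IHk.
Qed.

Lemma ideal_powM I m n x y : ideal I ->
  ideal_pow I m x -> ideal_pow I n y -> ideal_pow I (m + n) (x * y).
Proof.
move=> idI Ix; elim: n y => [|n IHn] y.
  by move=> _; rewrite addn0; have [_ _ /(_ y _ Ix)[]] := ideal_pow_ideal m idI.
rewrite addnS; have [P0 PD PM] := ideal_pow_ideal (m + n).+1 idI.
move: y; apply: ideal_mul_ind; first by rewrite mulr0.
- by move=> y z; rewrite mulrDr; exact: PD.
- by move=> y z Iy Iz; rewrite mulrA; apply: ideal_mulP => //; exact: IHn.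
Qed.

End IdealPowers.

Definition negpart (n : int) : nat := if n is Negz k then k.+1 else 0%N.

Section AdicFiltration.
Context (K : fieldType) (A : algType K) (I : set A) (idI : ideal I).

Definition adic (n : int) : set A := ideal_pow I (negpart n).

Lemma negpartE (n : int) (k : nat) : (negpart n <= k)%N = (- k%:Z <= n).
Proof.
case: n => [n|n] /=; last by rewrite NegzE lerN2 lez_nat.
by rewrite (@le_trans _ _ 0) ?oppr_le0.
Qed.

Lemma adic0 n : adic n 0.
Proof. by have [] := ideal_pow_ideal (negpart n) idI. Qed.

Lemma adicD n x y : adic n x -> adic n y -> adic n (x + y).
Proof. by have [_ + _] := ideal_pow_ideal (negpart n) idI; apply. Qed.

Lemma adicZ n (c : K) x : adic n x -> adic n (c *: x).
Proof.
move=> Ix; have [_ _ M] := ideal_pow_ideal (negpart n) idI.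
by rewrite -[x]mul1r scalerAl; case: (M (c *: 1) x).
Qed.

Lemma adic_incr (n m : int) : n <= m -> adic n `<=` adic m.
Proof.
move=> nm; apply: ideal_pow_le => //; rewrite negpartE.
by apply: le_trans nm; rewrite -negpartE.
Qed.

Lemma adicM n m x y : adic n x -> adic m y -> adic (n + m) (x * y).
Proof.
move=> Ix Iy; have := ideal_powM idI Ix Iy; apply: ideal_pow_le => //.
by rewrite negpartE PoszD opprD lerD // -negpartE.
Qed.

Definition adic_filtration : filtration A :=
  @Filtration K A adic adic0 adicD adicZ adic_incr (Logic.I : adic 0 1) adicM.

End AdicFiltration.

Section IwasawaFiltration.
Context (K : fieldType) (G : topGroupType).

Lemma aug_ideal_ideal : ideal (@aug_ideal K G).
Proof.
have augE f : @aug_ideal K G f <-> maug (f (whole_group G)) = 0 by [].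
split; first by apply/augE; exact: maug0.
- by move=> f g /augE f0 /augE g0; apply/augE; rewrite maugD f0 g0 addr0.
- move=> b f /augE f0; split; apply/augE; rewrite maugM f0 ?mulr0 ?mul0r //.
Qed.

(* F_(-n) = m ^ n and F_n = K G for n >= 0. *)
Definition iw_filtration : filtration (iwasawa K G) := adic_filtration aug_ideal_ideal.

End IwasawaFiltration.

(* The inverse limit of the Z/p^n, with residues represented in [0, p^n). *)
Record padic (p : nat) := Padic {
  pcoef :> nat -> int;
  pcoef_compat : forall n, pcoef n = (pcoef n.+1 %% (p ^ n)%N%:Z)%Z
}.

Section Padic.
Context (p : nat).
Implicit Types x y z : padic p.

Local Notation md n := ((p ^ n)%N%:Z).

Lemma padicP x y : (forall n, x n = y n) -> x = y.
Proof.
case: x y => [x xc] [y yc] /= /funext xy.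
by subst y; congr Padic.
Qed.

HB.instance Definition _ := gen_eqMixin (padic p).
HB.instance Definition _ := gen_choiceMixin (padic p).

Lemma pcoef_mod x n : (x n %% md n)%Z = x n.
Proof. by rewrite [in RHS]pcoef_compat [in LHS]pcoef_compat modz_mod. Qed.

Lemma md_dvd n (a : int) : ((a %% md n.+1)%Z %% md n)%Z = (a %% md n)%Z.
Proof.
rewrite [in RHS](divz_eq a (md n.+1)).
by rewrite expnS PoszM mulrA modzMDl.
Qed.

Lemma padic_mk_compat (a : nat -> int) :
  (forall n, (a n.+1 %% md n)%Z = (a n %% md n)%Z) ->
  forall n, (a n %% md n)%Z = ((a n.+1 %% md n.+1)%Z %% md n)%Z.
Proof. by move=> ac n; rewrite md_dvd ac. Qed.

Definition padic_mk a ac := @Padic p _ (@padic_mk_compat a ac).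

Lemma padic_const_compat (c : int) n : (c %% md n)%Z = (c %% md n)%Z.
Proof. by []. Qed.
Definition padic_zero : padic p := padic_mk (padic_const_compat 0).
Definition padic_one : padic p := padic_mk (padic_const_compat 1).

Lemma padic_add_compat x y n :
  ((x n.+1 + y n.+1) %% md n)%Z = ((x n + y n) %% md n)%Z.
Proof. by rewrite (pcoef_compat x n) (pcoef_compat y n) modzDm. Qed.
Definition padic_add x y : padic p := padic_mk (padic_add_compat x y).

Lemma padic_opp_compat x n : ((- x n.+1) %% md n)%Z = ((- x n) %% md n)%Z.
Proof. by rewrite (pcoef_compat x n) modzNm. Qed.
Definition padic_opp x : padic p := padic_mk (padic_opp_compat x).

Lemma padic_mul_compat x y n :
  ((x n.+1 * y n.+1) %% md n)%Z = ((x n * y n) %% md n)%Z.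
Proof. by rewrite (pcoef_compat x n) (pcoef_compat y n) modzMm. Qed.
Definition padic_mul x y : padic p := padic_mk (padic_mul_compat x y).

Lemma padic_addA : associative padic_add.
Proof. by move=> x y z; apply: padicP => n /=; rewrite modzDmr modzDml addrA. Qed.
Lemma padic_addC : commutative padic_add.
Proof. by move=> x y; apply: padicP => n /=; rewrite addrC. Qed.
Lemma padic_add0 : left_id padic_zero padic_add.
Proof. by move=> x; apply: padicP => n /=; rewrite modzDml add0r pcoef_mod. Qed.
Lemma padic_addN : left_inverse padic_zero padic_opp padic_add.
Proof. by move=> x; apply: padicP => n /=; rewrite modzDml addNr. Qed.
HB.instance Definition _ := GRing.isZmodule.Build (padic p)
  padic_addA padic_addC padic_add0 padic_addN.

Lemma padic_mulA : associative padic_mul.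
Proof. by move=> x y z; apply: padicP => n /=; rewrite modzMmr modzMml mulrA. Qed.
Lemma padic_mulC : commutative padic_mul.
Proof. by move=> x y; apply: padicP => n /=; rewrite mulrC. Qed.
Lemma padic_mul1 : left_id padic_one padic_mul.
Proof. by move=> x; apply: padicP => n /=; rewrite modzMml mul1r pcoef_mod. Qed.
Lemma padic_mulDl : left_distributive padic_mul padic_add.
Proof.
by move=> x y z; apply: padicP => n /=; rewrite modzMml modzDml modzDmr mulrDl.
Qed.
HB.instance Definition _ := GRing.Zmodule_isComPzRing.Build (padic p)
  padic_mulA padic_mulC padic_mul1 padic_mulDl.

End Padic.

Inductive dynkin :=
  DynA of nat | DynB of nat | DynC of nat | DynD of nat | DynE of nat | DynF4 | DynG2.

HB.instance Definition _ := gen_eqMixin dynkin.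

Definition dyn_rank (T : dynkin) : nat :=
  match T with
  | DynA n | DynB n | DynC n | DynD n | DynE n => n
  | DynF4 => 4%N
  | DynG2 => 2%N
  end.

Definition dyn_valid (T : dynkin) : bool :=
  match T with
  | DynA n => (1 <= n)%N
  | DynB n => (2 <= n)%N
  | DynC n => (3 <= n)%N
  | DynD n => (4 <= n)%N
  | DynE n => (6 <= n <= 8)%N
  | _ => true
  end.

(* The edges i - j, i < j, of the diagram; Bourbaki's labelling, shifted to start at 0. *)
Definition dyn_edge (T : dynkin) (i j : nat) : bool :=
  match T with
  | DynD n => (j < n.-1)%N && (j == i.+1) || (i == n - 3)%N && (j == n.-1)
  | DynE _ => [|| (i == 0%N) && (j == 2%N), (i == 1%N) && (j == 3%N) | (2 <= i)%N && (j == i.+1)]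
  | _ => j == i.+1
  end.

(* Minus the off-diagonal entry (i, j) of the Cartan matrix, on edges. *)
Definition dyn_mult (T : dynkin) (i j : nat) : int :=
  match T with
  | DynB n => if (i == n - 2)%N && (j == n.-1) then 2 else 1
  | DynC n => if (i == n.-1) && (j == n - 2)%N then 2 else 1
  | DynF4 => if (i == 1%N) && (j == 2%N) then 2 else 1
  | DynG2 => if (i == 1%N) && (j == 0%N) then 3 else 1
  | _ => 1
  end.

(* <alpha_i, alpha_j^vee> *)
Definition dyn_cartan (T : dynkin) (i j : nat) : int :=
  if i == j then 2
  else if dyn_edge T i j || dyn_edge T j i then - dyn_mult T i j else 0.

(* The nodes (k, i), i a node of the k-th diagram, of a disjoint union of diagrams,
   and the corresponding block diagonal Cartan matrix. *)
Definition dyn_nodes (Ts : seq dynkin) : seq (nat * nat) :=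
  [seq (k, i) | k <- iota 0 (size Ts), i <- iota 0 (dyn_rank (nth DynG2 Ts k))].

Definition dyn_block (Ts : seq dynkin) (u v : nat * nat) : int :=
  if u.1 == v.1 then dyn_cartan (nth DynG2 Ts u.1) u.2 v.2 else 0.

Section RootSystems.
Context (l : nat).
Local Notation V := 'rV[rat]_l.
Context (roots : {fset V}) (coroot : V -> 'cV[rat]_l).

(* <v, alpha^vee> *)
Definition pairing (v alpha : V) : rat := (v *m coroot alpha) 0 0.

(* A reduced crystallographic root system spanning V. *)
Definition root_system_axiom : Prop :=
  [/\ forall v : V, exists c : V -> rat, v = \sum_(a <- roots) c a *: a,
      0 \notin roots,
      forall a, a \in roots -> pairing a a = 2 &
      forall a b, a \in roots -> b \in roots ->
        [/\ pairing b a \is a Num.int,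
            b - pairing b a *: a \in roots &
            forall c : rat, b = c *: a -> c = 1 \/ c = -1]].

Definition is_base (D : 'I_l -> V) : Prop :=
  [/\ forall i, D i \in roots,
      forall c : 'I_l -> rat, \sum_i c i *: D i = 0 -> forall i, c i = 0 &
      forall a, a \in roots -> exists c : 'I_l -> nat,
        a = \sum_i (c i)%:R *: D i \/ a = - \sum_i (c i)%:R *: D i].

(* The list of the types of the indecomposable components is Ts. *)
Definition has_components (Ts : seq dynkin) : Prop :=
  [/\ all dyn_valid Ts, size (dyn_nodes Ts) = l &
      exists2 D, is_base D & forall i j : 'I_l,
        pairing (D i) (D j) =
        (dyn_block Ts (nth (0, 0)%N (dyn_nodes Ts) i) (nth (0, 0)%N (dyn_nodes Ts) j))%:~R].

End RootSystems.

(* The ambient space is the rational span of the roots. *)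
Record rootSystem := RootSystem {
  rs_rank : nat;
  rs_roots : {fset 'rV[rat]_rs_rank};
  rs_coroot : 'rV[rat]_rs_rank -> 'cV[rat]_rs_rank;
  rs_axiom : root_system_axiom rs_roots rs_coroot;
  rs_types : exists Ts, has_components rs_roots rs_coroot Ts
}.

Definition nice_prime (p : nat) (Phi : rootSystem) : Prop :=
  (5 <= p)%N /\
  forall Ts n, has_components (rs_roots Phi) (@rs_coroot Phi) Ts -> DynA n \in Ts ->
    ~~ (p %| n.+1)%N.

Record lie_bracket (R : pzRingType) (L : lmodType R) := LieBracket {
  lie :> L -> L -> L;
  lieDl : forall x y z, lie (x + y) z = lie x z + lie y z;
  lieDr : forall x y z, lie x (y + z) = lie x y + lie x z;
  lieZl : forall c x y, lie (c *: x) y = c *: lie x y;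
  lieZr : forall c x y, lie x (c *: y) = c *: lie x y;
  liexx : forall x, lie x x = 0;
  lie_jacobi : forall x y z, lie x (lie y z) + lie y (lie z x) + lie z (lie x y) = 0
}.

Section Chevalley.
Context (R : pzRingType) (L : lmodType R) (br : lie_bracket L) (Phi : rootSystem).
Local Notation l := (rs_rank Phi).
Local Notation V := 'rV[rat]_l.
Local Notation roots := (rs_roots Phi).
Local Notation coroot := (@rs_coroot Phi).

(* h_i (simple co-roots) and e_alpha (alpha a root; other values of e are irrelevant)
   form a basis of L which multiplies like a Chevalley basis for the base D. *)
Record chevalley_basis (D : 'I_l -> V) (h : 'I_l -> L) (e : V -> L) : Prop := Chevalley {
  chev_basis : forall x : L, exists! c : {ffun 'I_l -> R} * {ffun roots -> R},
    x = \sum_i c.1 i *: h i + \sum_(a : roots) c.2 a *: e (val a);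
  chev_hh : forall i j, br (h i) (h j) = 0;
  chev_he : forall i a, a \in roots ->
    br (h i) (e a) = (numq (pairing coroot a (D i)))%:~R *: e a;
  chev_opp : forall a, a \in roots -> exists2 m : 'I_l -> int,
    coroot a = \sum_i (m i)%:~R *: coroot (D i) &
    br (e a) (e (- a)) = \sum_i (m i)%:~R *: h i;
  chev_ee0 : forall a b, a \in roots -> b \in roots ->
    a + b != 0 -> a + b \notin roots -> br (e a) (e b) = 0;
  chev_ee : forall a b, a \in roots -> b \in roots -> a + b \in roots ->
    exists2 r : nat,
      b - r%:R *: a \in roots /\ (forall s : nat, (r < s)%N -> b - s%:R *: a \notin roots) &
      br (e a) (e b) = (r.+1)%:R *: e (a + b) \/ br (e a) (e b) = - ((r.+1)%:R *: e (a + b))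
}.

End Chevalley.

Definition peps (p : nat) : nat := if p == 2%N then 2%N else 1%N.

Section ProP.
Context (p : nat) (G : topGroupType).

Definition pro_p : Prop :=
  [/\ compact [set: G], hausdorff_space G,
      (forall U : set G, nbhs 1%g U -> exists N : open_normal G, on_set N `<=` U) &
      (forall N : open_normal G, exists n : nat,
         (left_cosets [set: G] N #= `I_(p ^ n))%card)].

Definition top_fin_gen : Prop :=
  exists s : seq G, closure (gen [set` s]) = [set: G].

(* G/cl(G^p) is abelian if p is odd, G/cl(G^4) is abelian if p = 2. *)
Definition powerful : Prop :=
  forall x y : G, closure (gen (powers G (p ^ peps p))) [~ x, y]%g.

(* P_1 = G and P_(i+1) is the closure of P_i^p [P_i, G]; indices shifted by one. *)
Fixpoint lower_p_series (n : nat) : set G :=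
  if n is n'.+1 then
    closure (gen ([set (x ^+ p)%g | x in lower_p_series n'] `|`
                  [set z | exists x g, lower_p_series n' x /\ z = [~ x, g]%g]))
  else [set: G].

Definition uniform_pro_p : Prop :=
  [/\ pro_p, top_fin_gen, powerful &
      forall n, (left_cosets (lower_p_series n) (lower_p_series n.+1) #=
                left_cosets (lower_p_series 0) (lower_p_series 1))%card].

(* lg is an isomorphism from log G, the Z_p-Lie algebra of the uniform group G,
   onto the Lie subalgebra M of L. In log G,
     x + y = lim (x^(p^n) y^(p^n))^(p^-n),  [x, y] = lim [x^(p^n), y^(p^n)]^(p^-2n)
   and c x = lim x^(c_n) for integers c_n -> c. *)
Record is_log (L : lmodType (padic p)) (br : lie_bracket L) (M : set L) (lg : G -> L)
  : Prop := IsLog {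
  log_inj : injective lg;
  log_range : range lg = M;
  log_add : forall x y z, lg z = lg x + lg y ->
    exists2 u : nat -> G, (forall n, u n ^+ (p ^ n) = x ^+ (p ^ n) * y ^+ (p ^ n))%g &
      u @ \oo --> z;
  log_lie : forall x y z, lg z = br (lg x) (lg y) ->
    exists2 u : nat -> G,
      (forall n, u n ^+ (p ^ n.*2) = [~ x ^+ (p ^ n), y ^+ (p ^ n)])%g &
      u @ \oo --> z;
  log_scale : forall (c : padic p) x z, lg z = c *: lg x ->
    (fun n => x ^+ `|c n|%N)%g @ \oo --> z
}.

(* G = exp(p^t Phi(Z_p)) for some t >= 1 (t >= 2 if p = 2) *)
Definition of_type (Phi : rootSystem) : Prop :=
  exists (L : lmodType (padic p)) (br : lie_bracket L)
         (D : 'I_(rs_rank Phi) -> 'rV[rat]_(rs_rank Phi))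
         (h : 'I_(rs_rank Phi) -> L) (e : 'rV[rat]_(rs_rank Phi) -> L)
         (t : nat) (lg : G -> L),
    [/\ is_base (rs_roots Phi) D,
        chevalley_basis br D h e,
        (peps p <= t)%N &
        is_log br [set (p ^ t)%:R *: x | x in [set: L]] lg].

End ProP.

(* Main.v *)
Require Import Defs.
From HB Require Import structures.
From mathcomp Require Import all_boot all_order all_algebra all_fingroup all_solvable.
From mathcomp Require Import finmap finfield.
From mathcomp Require Import boolp classical_sets functions cardinality.
From mathcomp Require Import topology.
From mathcomp Require Import ring zify.
From mathcomp Require Import -(notations) mpoly.

Set Implicit Arguments.
Unset Strict Implicit.
Unset Printing Implicit Defensive.

Import Order.TTheory GRing.Theory Num.Theory.

(** Let [log G = p^t L], where [L] is the Chevalley algebra over the [p]-adic integers with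
Chevalley basis [e_1, ..., e_d], let [g_i] be the element of [G] with logarithm [p^t e_i], and
let [m] be the augmentation ideal of [K[[G]]], [K] the field with [p] elements.

The graded ring. As [p] is odd and commutators are [p]-th powers, [[m, m]] lies in [m^3], so
monomials in the [b_i = g_i - 1] can be sorted modulo terms of higher order. At the level
[G / G^(p^n)] the sorted monomials with exponents less than [p^n] span, and there are as many
of them as the index of [G^(p^n)] requires: they form a basis ([bnd_indep]). The [m]-adic
filtration of [K[[G]]] is the limit of those of the levels ([powE]). So [gr K[[G]]] is the
polynomial ring in the symbols [X_i] of the [b_i] ([gr_poly]). In it [K[[G^p]]] gives the
polynomials in the [X_i^p] ([gr_sub_pth]), which yields the Frobenius pair ([iw_frobenius]).

The sources. By the limit formula for the Lie bracket, [[g_i^(p^n), g_j] = c^(p^(n+t))] for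
large [n], where [log c] is [p^t [e_i, e_j]] modulo [p^(t+1)] ([comm_limit]). Therefore
the elements [a_r = g_i^(p^r) - 1], [r] large, form a source of derivations: with [s = r + t], the
commutator with [a_r] raises degrees by [p^s - 1] on [K[[G]]], by [p^(s+1) - p] on [K[[G^p]]],
and it acts on the graded ring as the derivation which maps [X_j] to the [p^s]-th power of [[e_i, e_j]], read as a linear form
modulo [p] ([gr_bracket_gr_poly]).

The algebra. If [Y] is in the closure of [(X)] for these sources, then [X] divides
[\sum_j [e_i, e_j]^(p^s) dY/dX_j] for all [i] and all large [s]. An elimination in the manner of
Moore determinants removes the Frobenius twists at the cost of a product of linear forms, and
the linear forms are cancelled one by one ([twist_closed_dvd]). This gives [X | dY/dX_j] for
all [j], hence [D Y] in [(X)] for every derivation [D] that kills the [p]-th powers. The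
cancellation uses only that no nonzero [z] in [L / p L] has all its brackets [[e_i, z]] on a line
([chevalley_nondegenerate]). This is where [p] must be nice: [2] has to be invertible, and so
does the Cartan matrix modulo [p], whose determinant is [n+1] in type [A_n] and a divisor of
[4] or [3] in the other types. *)

(** * Powers and commutators in finite p-groups *)

Section FinitePowerful.
Local Open Scope group_scope.
Context (gT : finGroupType) (p : nat).
Hypotheses (p_pr : prime p) (p_odd : odd p).
Hypothesis pT : p.-group [set: gT].
Local Notation T := [set: gT].

Definition fpow (k : nat) : {set gT} := [set x ^+ (p ^ k) | x in T].

Hypothesis fpow_group : forall k, group_set (fpow k).
Hypothesis comm_fpow1 : forall x y : gT, [~ x, y] \in fpow 1.

Local Notation P k := (group (fpow_group k)).

Lemma mem_fpow k x : x ^+ (p ^ k) \in P k.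
Proof. by apply/imsetP; exists x; rewrite ?inE. Qed.

Lemma fpow_normal k : P k <| T.
Proof.
apply/andP; split; first by apply/fintype.subsetP.
apply/fintype.subsetP => y _; rewrite inE; apply/fintype.subsetP => _ /imsetP[z /imsetP[x _ ->] ->].
by rewrite conjXg mem_fpow.
Qed.

Lemma fpowS k x : x \in P k -> x ^+ p \in P k.+1.
Proof. by case/imsetP=> y _ ->; rewrite -expgM -expnSr mem_fpow. Qed.

Lemma fpow_root k x : x \in P k.+1 -> exists2 y, y \in P k & x = y ^+ p.
Proof.
by case/imsetP=> y _ ->; exists (y ^+ (p ^ k)); rewrite ?mem_fpow // -expgM -expnSr.
Qed.

Lemma dvd_p_bin2 : p %| 'C(p, 2).
Proof.
apply: prime_dvd_bin => //=; rewrite ltn_neqAle prime_gt1 // andbT.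
by apply: contraTneq p_odd => <-.
Qed.

(** The correction term between [(x c)^p] and [x^p c^p] is [[c, x]^C(p, 2)],
and [p] divides [C(p, 2)] because [p] is odd. *)
Lemma expg_mul_p (rT : finGroupType) (x c : rT) :
  commute x [~ c, x] -> commute c [~ c, x] -> [~ c, x] ^+ p = 1 ->
  (x * c) ^+ p = x ^+ p * c ^+ p.
Proof.
move=> cx cc zp; rewrite expMg_Rmul //; case/dvdnP: dvd_p_bin2 => m ->.
by rewrite mulnC expgM zp expg1n mulg1.
Qed.

Lemma cosetR (N : {group gT}) (x y : gT) : N <| T ->
  coset N [~ x, y] = [~ coset N x, coset N y].
Proof. by move=> /andP[_ /fintype.subsetP nN]; rewrite morphR ?nN ?inE. Qed.

Lemma coset_commute (N : {group gT}) (x y : gT) : N <| T ->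
  [~ x, y] \in N -> commute (coset N x) (coset N y).
Proof.
by move=> nN /coset_id cN; apply/commgP; rewrite -cosetR // cN.
Qed.

(** Put [A = P (j+1)], [B = P (j+2)] and [K = [A, T]]. Modulo [B [K, T]] an
element [u] of [P j] and its commutator [c = [u, z]] satisfy the hypotheses of
[expg_mul_p] and [c^p = 1]; hence [(u^z)^p = (u c)^p = u^p], so that [u^p]
commutes with [z]. This gives [K] inside [B [K, T]], and then [K] inside [B]
since the [p]-group [T / B] is nilpotent. *)
Lemma comm_fpow j x y : x \in P j -> [~ x, y] \in P j.+1.
Proof.
elim: j x y => [|j IHj] x y; first by move=> _; exact: comm_fpow1.
set A := P j.+1; set B := P j.+2.
have nA : A <| T := fpow_normal _; have nB : B <| T := fpow_normal _.
pose K := [~: A, T]%G.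
have nK : K <| T by rewrite /normal finset.subsetT commg_normr.
have nKT : [~: K, T]%G <| T by rewrite /normal finset.subsetT commg_normr.
pose N := (B <*> [~: K, T])%G.
have nN : N <| T by rewrite normalY.
have nNx z : z \in 'N(N) by apply: (fintype.subsetP (normal_norm nN)); rewrite inE.
have sKN : K \subset N.
  rewrite gen_subG; apply/fintype.subsetP => _ /imset2P[x' z /fpow_root[u Pu ->] _ ->].
  have Ac : [~ u, z] \in A := IHj _ _ Pu; set c := [~ u, z] in Ac.
  have Kcu v : [~ c, v] \in K by rewrite mem_commg ?inE.
  have cent v w : commute (coset N w) (coset N [~ c, v]).
    apply: commute_sym; apply: coset_commute => //.
    by rewrite /N /= (fintype.subsetP (joing_subr _ _)) // mem_commg ?inE.
  have cp : coset N c ^+ p = 1.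
    by rewrite -morphX //= coset_id // (fintype.subsetP (joing_subl _ _)) // fpowS.
  have zp v : coset N [~ c, v] ^+ p = 1.
    rewrite cosetR // -commXg; last by rewrite -cosetR //; exact: cent.
    by rewrite cp comm1g.
  have e : (coset N u * coset N c) ^+ p = coset N u ^+ p.
    by rewrite expg_mul_p -?cosetR // cp mulg1.
  apply: coset_idr => //; rewrite cosetR //; apply/eqP/conjg_fixP.
  rewrite morphX //= conjXg -e; congr (_ ^+ _).
  by rewrite -morphM //= -morphJ //= conjg_mulR.
have sKB : K \subset B.
  have nilB : nilpotent (T / B) by apply: pgroup_nil (quotient_pgroup _ pT).
  rewrite -quotient_sub1; last by rewrite (fintype.subset_trans (finset.subsetT _)) ?normal_norm.
  rewrite subG1; have /forallP/(_ (K / B)%G) := nilB.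
  move/implyP; apply; rewrite finset.subsetI quotientS ?finset.subsetT //=.
  have nBs (C : {set gT}) : C \subset 'N(B).
    by rewrite (fintype.subset_trans (finset.subsetT _)) ?normal_norm.
  have -> : [~: K / B, T / B] = [~: K, T] / B by rewrite quotientR ?nBs.
  have <- : (B <*> [~: K, T]) / B = [~: K, T] / B by rewrite quotientYidl ?nBs.
  exact: (quotientS B sKN).
by move=> Ax; apply: (fintype.subsetP sKB); rewrite mem_commg ?inE.
Qed.

(** Put [x = a^(p^k)] and [y = b^(p^k)]. By induction [(a b)^(p^k)] is [x y] up
to an element of [P (k+1)], which is central of order [p] modulo [P (k+2)], and so
is [[y, x]]: the [p]-th power of [x y] is computed by [expg_mul_p]. *)
Lemma expg_morph k a b :
  ((a * b) ^+ (p ^ k))^-1 * (a ^+ (p ^ k) * b ^+ (p ^ k)) \in P k.+1.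
Proof.
elim: k => [|k IHk]; first by rewrite !expg1 mulVg group1.
have nN := fpow_normal k.+2; set N := P k.+2 in nN *.
have nNx z : z \in 'N(N) by apply: (fintype.subsetP (normal_norm nN)); rewrite inE.
pose f := coset_morphism N.
have cent c v : c \in P k.+1 -> commute (f v) (f c).
  move=> Pc; apply: commute_sym; apply: coset_commute => //; exact: comm_fpow.
have fp c : c \in P k.+1 -> f c ^+ p = 1.
  by move=> Pc; rewrite -morphX ?nNx //=; apply: coset_id; exact: fpowS.
have fM x y : f (x * y) = f x * f y by rewrite morphM ?nNx.
have fV x : f x^-1 = (f x)^-1 by rewrite morphV ?nNx.
have fX x n : f (x ^+ n) = f x ^+ n by rewrite morphX ?nNx.
apply: coset_idr => //; rewrite -[coset N]/(mfun f).
set h := _^-1 * _ in IHk; rewrite fM fV expnSr !expgM.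
set x := a ^+ _ in h IHk *; set y := b ^+ _ in h IHk *.
have -> : (a * b) ^+ (p ^ k) = x * y * h^-1 by rewrite invMg invgK mulKVg.
have Ph : h^-1 \in P k.+1 by rewrite groupV.
have Pyx : [~ y, x] \in P k.+1 by apply: comm_fpow; exact: mem_fpow.
clearbody x y h.
rewrite fX [f (x * y * h^-1)]fM (expgMn _ (cent _ _ Ph)) (fp _ Ph) mulg1 !fM !fX.
have fyx : f [~ y, x] = [~ f y, f x] by rewrite morphR ?nNx.
rewrite (@expg_mul_p _ (f x) (f y)) ?mulVg // -fyx.
- exact: cent.
- exact: cent.
- exact: fp.
Qed.

(** Let [c = [a, y]]. Modulo [P (s+2)] the commutator [z = [c, y]] is central
of order [p], so the conjugate of [a] by [y^i] is [a c^i z^C(i, 2)]; for [i = p]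
the last factor disappears. *)
Lemma comm_expg_p s a y : [~ a, y] \in P s ->
  ([~ a, y] ^+ p)^-1 * [~ a, y ^+ p] \in P s.+2.
Proof.
set c := [~ a, y] => Pc; have nN := fpow_normal s.+2; set N := P s.+2 in nN *.
have nNx z : z \in 'N(N) by apply: (fintype.subsetP (normal_norm nN)); rewrite inE.
pose f := coset_morphism N.
have fM u v : f (u * v) = f u * f v by rewrite morphM ?nNx.
have fV x : f x^-1 = (f x)^-1 by rewrite morphV ?nNx.
have fX x n : f (x ^+ n) = f x ^+ n by rewrite morphX ?nNx.
have fJ x n : f (x ^ n) = f x ^ f n by rewrite !conjgE !fM fV.
pose z := [~ c, y]; have Pz : z \in P s.+1 by exact: comm_fpow.
have cent v : commute (f z) (f v).
  by apply: coset_commute => //; exact: comm_fpow.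
have zp : f z ^+ p = 1 by rewrite -fX; apply: coset_id; exact: fpowS.
apply: coset_idr => //; rewrite -[coset N]/(mfun f) [[~ a, y ^+ p]]commgEl fM fV fM fV (fJ a) (fX c) (fX y).
have zy : f z ^ f y = f z by apply/conjg_fixP/commgP; exact: cent.
have -> i : f a ^ (f y ^+ i) = f a * f c ^+ i * f z ^+ 'C(i, 2).
  elim: i => [|i IHi]; first by rewrite !mulg1 conjg1.
  have ay : f a ^ f y = f a * f c by rewrite -fJ -fM conjg_mulR.
  have cy : f c ^ f y = f c * f z by rewrite -fJ -fM conjg_mulR.
  rewrite expgSr conjgM IHi !conjMg !conjXg ay cy zy expgMn; last exact: commute_sym.
  rewrite binS bin1 expgD expgS -!mulgA; congr (_ * (_ * (_ * _))).
  exact: commuteX2.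
case/dvdnP: dvd_p_bin2 => m ->.
by rewrite mulnC expgM zp expg1n mulg1 mulKg mulVg.
Qed.

End FinitePowerful.

Local Open Scope classical_set_scope.
Local Notation qrepr := generic_quotient.repr.

(** * Closed subgroups and finite quotients *)

Section Topo.
Context (G : topGroupType).
Hypotheses (hG : hausdorff_space G).
Local Open Scope group_scope.

Lemma cvg_cstg (a : G) : (fun _ : nat => a) @ \oo --> a.
Proof. exact: cvg_cst. Qed.

Lemma expg_continuous n : continuous (fun x : G => x ^+ n).
Proof.
elim: n => [|n IHn] x; first exact: cvg_cst.
apply: (@cvg_trans _ ((fun x : G => x * x ^+ n) @ x)).
  by apply: near_eq_cvg; apply: nearW => y; rewrite expgS.
rewrite expgS; apply: (@continuous2_cvg _ _ _ _ _ _ _ _ (fun x y => x * y) x (x ^+ n)) => //.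
  exact: (mulg_continuous (x, x ^+ n)).
exact: IHn.
Qed.

Lemma cvg_uniq (u : nat -> G) (a b : G) : u @ \oo --> a -> u @ \oo --> b -> a = b.
Proof. move=> ua ub; exact: (@cvg_unique _ hG (u @ \oo) _ a b ua ub). Qed.

Lemma cvg_closed (A : set G) (u : nat -> G) (a : G) R : closed A ->
  (forall n, (R <= n)%N -> A (u n)) -> u @ \oo --> a -> A a.
Proof.
move=> cA uA; apply: (@closed_cvg _ _ _ _ u A cA).
by exists R => // n /= /uA.
Qed.

Lemma cvg_near_eq (u v : nat -> G) (a : G) R : (forall n, (R <= n)%N -> u n = v n) ->
  u @ \oo --> a -> v @ \oo --> a.
Proof.
move=> uv; apply: cvg_trans; apply: near_eq_cvg.
by exists R => // n /= /uv.
Qed.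

Lemma closed_lcoset (A : set G) a : closed A -> closed [set x | A (a * x)].
Proof.
move=> cA; apply: (@closed_comp _ _ (fun x => a * x)) => // x _.
apply: (@continuous2_cvg _ _ _ _ _ _ _ _ (fun x y => x * y) a x) => //.
    exact: (mulg_continuous (a, x)).
exact: cvg_cst.
Qed.

(** The complement of [A] is a finite union of closed cosets of [A]. *)
Lemma open_of_finite_index (A : set G) (T : finType) (tau : G -> T) :
  is_subgroup A -> closed A ->
  (forall x y, tau x = tau y -> A (x^-1 * y)) -> open A.
Proof.
move=> [A1 AM AV] cA Atau; rewrite -(setCK A); apply: closed_openC.
have fib (c : T) : exists g : G, forall x, tau x = c -> ~ A x -> A (g^-1 * x) /\ ~ A g.
  have [[g [gc nAg]]|ng] := pselect (exists g, tau g = c /\ ~ A g).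
    by exists g => x xc nAx; split=> //; apply: Atau; rewrite xc.
  by exists 1 => x xc nAx; case: ng; exists x.
have [g gP] := choice fib.
have -> : ~` A = \bigcup_(c in [set c | ~ A (g c)]) [set x | A ((g c)^-1 * x)].
  apply/seteqP; split=> [x nAx|x [c ngc Ax] Axx].
    by exists (tau x) => /=; have [] := gP _ _ erefl nAx.
  apply: ngc; have := AM _ _ Axx (AV _ Ax).
  by rewrite invMg invgK mulKVg.
apply: closed_bigcup => [|c _]; first exact: finite_finset.
exact: closed_lcoset.
Qed.

Lemma closure_gen_sub (A S : set G) : is_subgroup A -> closed A -> S `<=` A ->
  closure (gen S) `<=` A.
Proof.
move=> gA cA SA; rewrite [X in _ `<=` X](_ : A = closure A); last first.
  exact/closure_id.
by apply: closure_subset => x; apply.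
Qed.

Hypothesis cG : compact [set: G].

(** A continuous image of the compact group [G]. *)
Lemma closed_powers n : closed (powers G n).
Proof.
apply: compact_closed => //; apply: continuous_compact => //.
by apply: continuous_subspaceT; exact: expg_continuous.
Qed.

End Topo.

Section FiniteQuotients.
Context (p : nat) (G : topGroupType).
Hypotheses (p_pr : prime p) (proG : pro_p p G).
Local Open Scope group_scope.

(** The bijection of [G / N] with [{0, ..., p^n - 1}] serves to turn this quotient
into a finite type, for which the results on finite groups are available. *)
Lemma finite_quotient (N : open_normal G) :
  exists (gT : finGroupType) (f : G -> gT),
    [/\ {morph f : x y / x * y}, forall y, exists x, f x = y,
        forall x, f x = 1 <-> on_set N x & p.-group [set: gT]%SET].
Proof.
have [_ _ _ /(_ N)[n /card_set_bijP[c [cI cinj csurj]]]] := proG.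
have [N1 NM NV] := on_subgroup N.
pose cl (a : quotg N) : set G := [set qrepr a * h | h in N].
have clE a : left_cosets [set: G] N (cl a) by exists (qrepr a).
have clI a b : cl a = cl b -> a = b.
  move=> ab; rewrite -(qclass_repr a) -(qclass_repr b); apply/qclassP.
  have : cl b (qrepr b) by exists 1; rewrite ?mulg1.
  by rewrite -ab => -[h Nh <-]; rewrite mulKg.
pose g (a : quotg N) : 'I_(p ^ n) := Ordinal (cI _ (clE a)).
have gI : injective g.
  by move=> a b /(congr1 val) /= /cinj; rewrite !inE => /(_ (clE a) (clE b))/clI.
have gS (i : 'I_(p ^ n)) : exists a, g a = i.
  have /csurj[_ [x _ <-] xi] := ltn_ord i; exists (qclass N x).
  apply: val_inj; rewrite /= -xi; congr (c _).
  have /qclassP := qclass_repr (qclass N x) => rx.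
  have /NV := rx; rewrite invMg invgK => rx'.
  by apply/seteqP; split=> _ [h Nh <-]; [exists (x^-1 * qrepr (qclass N x) * h)
    | exists ((qrepr (qclass N x))^-1 * x * h)]; rewrite ?mulgA ?mulgV ?mul1g //; exact: NM.
have [g' gK] : exists g', cancel g g'.
  have [g' g'P] := choice gS; exists g' => a; apply: gI; exact: g'P.
have g'K : cancel g' g.
  by move=> i; have [a <-] := gS i; rewrite gK.
pose cT : countType := HB.pack_for countType (quotg N) (CanIsCountable gK).
pose fT : finType := HB.pack_for finType cT (CanIsFinite (gK : @cancel _ cT g g')).
pose gT : finGroupType := HB.pack_for finGroupType (quotg N) (Group.on (quotg N)) (Finite.class fT).
exists gT, (qclass N); split.
- exact: qclassM.
- by move=> y; exists (qrepr y); exact: qclass_repr.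
- move=> x; split=> [x1|Nx].
    have /qclassP : qclass N 1 = qclass N x by rewrite x1.
    by rewrite invg1 mul1g.
  by apply/esym/qclassP; rewrite invg1 mul1g.
rewrite /pgroup cardsT.
have -> : #|gT| = (p ^ n)%N.
  rewrite -[RHS]card_ord; apply: (@bij_eq_card gT _ g); exact: (Bijective gK g'K).
by rewrite pnatX pnat_id.
Qed.

End FiniteQuotients.

(** * Power subgroups of a powerful pro-p group *)

Section PowerSubgroups.
Context (p : nat) (G : topGroupType).
Hypotheses (p_pr : prime p) (p_odd : odd p) (proG : pro_p p G).
Local Open Scope group_scope.

Local Notation H n := (powers G (p ^ n)).

Lemma proG_hausdorff : hausdorff_space G. Proof. by case: proG. Qed.

Lemma powers1 n : H n 1.
Proof. by exists 1 => //; rewrite expg1n. Qed.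

Lemma powersV n x : H n x -> H n x^-1.
Proof. by move=> [y _ <-]; exists y^-1 => //; rewrite expgVn. Qed.

Lemma powersJ n x g : H n x -> H n (x ^ g).
Proof. by move=> [y _ <-]; exists (y ^ g) => //; rewrite conjXg. Qed.

Lemma powersX n x : H n x -> H n.+1 (x ^+ p).
Proof. by move=> [y _ <-]; exists y => //; rewrite -expgM -expnSr. Qed.

Lemma powersS n : H n.+1 `<=` H n.
Proof. by move=> _ [y _ <-]; exists (y ^+ p) => //; rewrite -expgM -expnS. Qed.

Lemma powers_le m n : (m <= n)%N -> H n `<=` H m.
Proof. by move=> /subnK <-; elim: (n - m)%N => // k IHk x /powersS/IHk. Qed.

Lemma closed_H n : closed (H n).
Proof. by apply: closed_powers; case: proG. Qed.

(** A closed subset of [G] is determined by its images in the finite quotients.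
This transfers to [G] the congruences between powers and commutators of the finite
case. *)
Lemma powers_by_quotients k x :
  (forall (gT : finGroupType) (f : G -> gT),
     {morph f : x y / x * y} -> (forall y, exists x, f x = y) -> p.-group [set: gT]%SET ->
     f x \in fpow gT p k) -> H k x.
Proof.
move=> Pk; apply: contrapT => nHx.
have [_ _ nb _] := proG.
have : nbhs 1 [set u | ~ H k (x * u)].
  rewrite -[1](mulVg x); apply: open_nbhs_nbhs; split; last by rewrite /= mulVg mulg1.
  rewrite (_ : [set u | _] = ~` [set u | H k (x * u)]) //; apply: closed_openC.
  by apply: closed_lcoset; exact: closed_H.
move=> /nb[N sN]; have [gT [f [fM fS fK pT]]] := finite_quotient p_pr proG N.
have f1 : f 1 = 1 by apply: (mulgI (f 1)); rewrite -fM !mulg1.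
have fV y : f y^-1 = (f y)^-1 by apply: (mulgI (f y)); rewrite -fM !mulgV f1.
have fX y n : f (y ^+ n) = f y ^+ n by elim: n => [|n IHn]; rewrite ?f1 // !expgS fM IHn.
have /imsetP[z _] := Pk _ _ fM fS pT; have [y <-] := fS z; rewrite -fX => fxy.
have /fK : f (x^-1 * y ^+ (p ^ k)) = 1 by rewrite fM fV fxy mulVg.
by move=> /sN /=; rewrite mulKVg; apply; exists y.
Qed.

Hypothesis H_mul : forall n x y, H n x -> H n y -> H n (x * y).
Hypothesis powG : powerful p G.

Lemma H_subgroup n : is_subgroup (H n).
Proof. by split; [exact: powers1|exact: H_mul|exact: powersV]. Qed.

Lemma comm_H1 x y : H 1 [~ x, y].
Proof.
have : closure (gen (H 1)) [~ x, y].
  by have := @powG x y; rewrite /peps; case: eqP p_odd => [->|].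
by apply: closure_gen_sub => //; [exact: H_subgroup|exact: closed_H].
Qed.

Section Transfer.
Context (gT : finGroupType) (f : G -> gT).
Hypotheses (fM : {morph f : x y / x * y}) (fS : forall y, exists x, f x = y).

Lemma quot1 : f 1 = 1. Proof. by apply: (mulgI (f 1)); rewrite -fM !mulg1. Qed.
Lemma quotV y : f y^-1 = (f y)^-1.
Proof. by apply: (mulgI (f y)); rewrite -fM !mulgV quot1. Qed.
Lemma quotX y n : f (y ^+ n) = f y ^+ n.
Proof. by elim: n => [|n IHn]; rewrite ?quot1 // !expgS fM IHn. Qed.
Lemma quotR x y : f [~ x, y] = [~ f x, f y].
Proof. by rewrite !commgEl !conjgE !fM !quotV. Qed.

Lemma quot_powers k x : H k x -> f x \in fpow gT p k.
Proof. by move=> [y _ <-]; rewrite quotX; apply/imsetP; exists (f y); rewrite ?inE. Qed.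

Lemma quot_fpow_group k : group_set (fpow gT p k).
Proof.
apply/group_setP; split; first by rewrite -quot1; apply: quot_powers; exact: powers1.
move=> _ _ /imsetP[a _ ->] /imsetP[b _ ->]; have [x <-] := fS a; have [y <-] := fS b.
by rewrite -!quotX -fM; apply: quot_powers; apply: H_mul; [exists x|exists y].
Qed.

Lemma quot_comm (a b : gT) : [~ a, b] \in fpow gT p 1.
Proof.
have [x <-] := fS a; have [y <-] := fS b.
by rewrite -quotR; apply: quot_powers; exact: comm_H1.
Qed.

End Transfer.

Lemma comm_H j x y : H j x -> H j.+1 [~ x, y].
Proof.
move=> Hx; apply: powers_by_quotients => gT f fM fS pT; rewrite (quotR fM).
apply: (comm_fpow p_pr p_odd pT (fpow_group := @quot_fpow_group _ _ fM fS) (@quot_comm _ _ fM fS)).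
exact: quot_powers.
Qed.

Lemma expg_morph_H k a b :
  H k.+1 (((a * b) ^+ (p ^ k))^-1 * (a ^+ (p ^ k) * b ^+ (p ^ k))).
Proof.
apply: powers_by_quotients => gT f fM fS pT.
rewrite !(fM, quotV fM, quotX fM).
exact: (expg_morph p_pr p_odd pT (@quot_fpow_group _ _ fM fS) (@quot_comm _ _ fM fS)).
Qed.

Lemma comm_expg_H s a y : H s [~ a, y] -> H s.+2 (([~ a, y] ^+ p)^-1 * [~ a, y ^+ p]).
Proof.
move=> Hs; apply: powers_by_quotients => gT f fM fS pT.
rewrite !(fM, quotV fM, quotR fM, quotX fM).
apply: (comm_expg_p p_pr p_odd pT (fpow_group := @quot_fpow_group _ _ fM fS) (@quot_comm _ _ fM fS)).
by rewrite -(quotR fM); exact: quot_powers.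
Qed.

End PowerSubgroups.

(** * The logarithm of a uniform group *)

Section Logarithm.
Context (p : nat) (G : topGroupType).
Hypotheses (p_pr : prime p) (p_odd : odd p) (proG : pro_p p G) (powG : powerful p G).
Context (L : lmodType (padic p)) (br : lie_bracket L) (t : nat) (lg : G -> L).
Hypothesis LG : is_log br [set (p ^ t)%:R *: x | x in [set: L]]%R lg.
Hypothesis tfree : forall x : L, (p%:R *: x = 0)%R -> x = 0%R.
Context (d : nat) (co : L -> 'I_d -> 'F_p).
Hypotheses (coD : forall x y i, co (x + y)%R i = (co x i + co y i)%R)
  (coS : forall v : 'I_d -> 'F_p, exists x, forall i, co x i = v i)
  (cop : forall x i, co (p%:R *: x)%R i = 0%R)
  (co0 : forall x, (forall i, co x i = 0%R) -> exists y, x = (p%:R *: y)%R).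
Local Open Scope group_scope.

Local Notation H n := (powers G (p ^ n)).
Local Notation hG := (proG_hausdorff proG).

Lemma tfree_exp n (x : L) : ((p ^ n)%:R *: x = 0)%R -> x = 0%R.
Proof.
elim: n => [|n IHn]; first by rewrite expn0 scale1r.
by rewrite expnS natrM -scalerA => /tfree/IHn.
Qed.

Lemma tfree_inj n : injective (fun x : L => (p ^ n)%:R *: x)%R.
Proof.
move=> x y /= /eqP; rewrite -subr_eq0 -scalerBr => /eqP/tfree_exp/eqP.
by rewrite subr_eq0 => /eqP.
Qed.

Lemma lam_ex x : exists y, lg x = ((p ^ t)%:R *: y)%R.
Proof.
have : range lg (lg x) by exists x.
by rewrite (log_range LG) => -[y _ <-]; exists y.
Qed.

(** As [log] takes its values in [p^t L], dividing by [p^t] gives a bijection of [G]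
with [L]. *)
Definition lam x : L := projT1 (cid (lam_ex x)).

Lemma lamE x : lg x = ((p ^ t)%:R *: lam x)%R.
Proof. by rewrite /lam; case: cid. Qed.

Lemma lam_inj : injective lam.
Proof. by move=> x y xy; apply: (log_inj LG); rewrite !lamE xy. Qed.

Lemma lam_surj y : exists x, lam x = y.
Proof.
have : [set (p ^ t)%:R *: x | x in [set: L]]%R ((p ^ t)%:R *: y)%R by exists y.
rewrite -(log_range LG) => -[x _]; rewrite lamE => /(@tfree_inj t) <-.
by exists x.
Qed.

Lemma lamX x k : lam (x ^+ k) = (k%:R *: lam x)%R.
Proof.
have [z zE] := lam_surj (k%:R *: lam x)%R; rewrite -zE; congr lam.
have lz : lg z = (k%:R *: lg x)%R.
  by rewrite !lamE zE !scalerA -!natrM mulnC.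
have kE n : (pcoef (k%:R : padic p) n)%R = ((k%:Z %% (p ^ n)%N%:Z)%Z)%R.
  elim: k {zE lz} => [|k IHk]; first by [].
  by rewrite mulrSr /= IHk modzDm -addn1 PoszD.
apply: (cvg_uniq hG) (log_scale LG lz).
apply: (@cvg_near_eq _ (fun=> x ^+ k) _ _ k.+1); last exact: cvg_cstg.
move=> n kn; rewrite kE modz_small // le0z_nat ltz_nat.
by apply: leq_trans (ltn_expl n (prime_gt1 p_pr)); exact: leq_trans kn _.
Qed.

Lemma expg_inj n : injective (fun x : G => x ^+ (p ^ n)).
Proof. by move=> x y /= /(congr1 lam); rewrite !lamX => /tfree_inj/lam_inj. Qed.

(** The sum in [log G] is a limit of [p^n]-th roots of [x^(p^n) y^(p^n)]; in
particular these roots exist. *)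
Lemma H_mul n x y : H n x -> H n y -> H n (x * y).
Proof.
move=> [a _ <-] [b _ <-]; have [z] := lam_surj (lam a + lam b)%R.
move=> /(congr1 (fun u => (p ^ t)%:R *: u)%R); rewrite scalerDr -!lamE => ze.
by have [u uE _] := log_add LG ze; rewrite -uE; exists (u n).
Qed.

Lemma H_sub n : is_subgroup (H n).
Proof. exact: (H_subgroup H_mul). Qed.

Lemma H_lam n x : H n x <-> exists y, lam x = ((p ^ n)%:R *: y)%R.
Proof.
split=> [[y _ <-]|[y xE]]; first by exists (lam y); rewrite lamX.
have [z zE] := lam_surj y; exists z => //.
by apply: lam_inj; rewrite lamX zE xE.
Qed.

Lemma H_root k j x : H (k + j) (x ^+ (p ^ k)) -> H j x.
Proof.
move=> [y _ yx]; exists y => //; apply: (@expg_inj k).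
by rewrite -expgM -expnD addnC.
Qed.

(** By [expg_morph_H] and the uniqueness of roots, raising to the power [p^m]
identifies [G / H 1] with [H m / H (m+1)]. *)
Lemma powc m e f : H m.+1 ((e ^+ (p ^ m))^-1 * f ^+ (p ^ m)) <-> H 1 (e^-1 * f).
Proof.
have [_ HM HV] := H_sub m.+1.
have hm := expg_morph_H p_pr p_odd proG H_mul powG m e^-1 f.
rewrite expgVn in hm; set A := (_ * f) ^+ _ in hm; set B := _ * _.
apply: (@iff_trans _ (H m.+1 A)).
  split=> h; first by have := HM _ _ h (HV _ hm); rewrite invMg invgK mulKVg.
  by have := HM _ _ h hm; rewrite mulKVg.
split=> [|[c _ cE]]; first by rewrite -addn1; exact: H_root.
by rewrite /A -cE expn1 -expgM -expnS; exists c.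
Qed.

(** The coordinates of [x] in [G / G^p = L / p L]. *)
Definition kap (x : G) (i : 'I_d) : 'F_p := co (lam x) i.

Lemma kap_H1 x : (forall i, kap x i = 0%R) <-> H 1 x.
Proof.
split=> [/co0[y xE]|/H_lam[y xE] i]; first by apply/H_lam; exists y; rewrite expn1.
by rewrite /kap xE expn1 cop.
Qed.

(** The [p^n]-th root of [a^(p^n) b^(p^n)] agrees with [a b] modulo the closed
subgroup [H 1] for every [n], hence so does the limit of these roots. *)
Lemma lam_add_mod a b z : lam z = (lam a + lam b)%R -> H 1 ((a * b)^-1 * z).
Proof.
move=> /(congr1 (fun u => (p ^ t)%:R *: u)%R); rewrite scalerDr -!lamE => ze.
have [u uE uz] := log_add LG ze.
apply: (@cvg_closed _ _ u z 0 (closed_lcoset (A := H 1) (closed_H proG (n:=1)))) => //= n _.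
apply/(powc n); rewrite uE; exact: (expg_morph_H p_pr p_odd proG H_mul powG).
Qed.

Lemma lam1 : lam 1 = 0%R.
Proof. by rewrite -(expg0 1) lamX scale0r. Qed.

Lemma lamV x : lam (x^-1)%g = (- lam x)%R.
Proof.
have [z zE] := lam_surj (lam x + lam (x^-1)%g)%R.
have ze := congr1 (fun u => (p ^ t)%:R *: u)%R zE.
rewrite scalerDr -!lamE in ze; have [u uE uz] := log_add LG ze.
have z1 : z = 1.
  apply: (cvg_uniq hG) uz _; apply: (@cvg_near_eq _ (fun=> 1) _ _ 0); last exact: cvg_cstg.
  by move=> n _; apply: (@expg_inj n); rewrite /= uE expgVn mulgV expg1n.
by apply/eqP; rewrite -addr_eq0 addrC -zE z1 lam1.
Qed.

Lemma co0r : forall i, co 0 i = 0%R.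
Proof. by move=> i; rewrite -(scaler0 L (p%:R)%R) cop. Qed.

Lemma coN x i : (co (- x) i = - co x i)%R.
Proof. by apply/eqP; rewrite -addr_eq0 -coD addNr co0r. Qed.

Lemma kap_coset x y : H 1 (x^-1 * y) -> kap x =1 kap y.
Proof.
move=> Hxy; have [w wE] := lam_surj (lam y - lam x)%R.
have [_ HM HV] := H_sub 1.
have : H 1 w.
  have h : H 1 ((y * x^-1)^-1 * w) by apply: lam_add_mod; rewrite lamV.
  have h' : H 1 (y * x^-1) by have := powersJ x^-1 Hxy; rewrite conjgE invgK mulgA mulKVg.
  by have := HM _ _ h' h; rewrite mulKVg.
move=> /kap_H1 w0 i; apply/eqP; rewrite eq_sym -subr_eq0.
by have := w0 i; rewrite /kap wE coD coN => ->.
Qed.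

Lemma kapM x y i : kap (x * y) i = (kap x i + kap y i)%R.
Proof.
have [z zE] := lam_surj (lam x + lam y)%R.
by rewrite (kap_coset (lam_add_mod zE)) /kap zE coD.
Qed.

Lemma kapV x i : (kap (x^-1)%g i = - kap x i)%R.
Proof. by rewrite /kap lamV coN. Qed.

Lemma kap_eq x y : kap x =1 kap y <-> H 1 (x^-1 * y).
Proof.
split=> [xy|]; last exact: kap_coset.
by apply/kap_H1 => i; rewrite kapM kapV xy addNr.
Qed.

Lemma kap_surj (v : 'I_d -> 'F_p) : exists x, forall i, kap x i = v i.
Proof. by have [y yv] := coS v; have [x xy] := lam_surj y; exists x => i; rewrite /kap xy. Qed.

(** A coset of [H (n+1)] in a coset of [H n] is recognized by the coordinates
modulo [p] of a [p^n]-th root. *)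
Lemma H_finite_index n : exists (T : finType) (tau : G -> T),
  forall x y, tau x = tau y -> H n (x^-1 * y).
Proof.
elim: n => [|n [T [tau tauP]]]; first by exists unit, (fun=> tt) => x y _; exists (x^-1 * y).
have rep_ex c : exists z, forall x, tau x = c -> H n (z^-1 * x).
  have [[z zc]|nz] := pselect (exists z, tau z = c).
    by exists z => x xc; apply: tauP; rewrite zc.
  by exists 1 => x xc; case: nz; exists x.
have [rep repP] := choice rep_ex.
have root_ex x : exists y, y ^+ (p ^ n) = (rep (tau x))^-1 * x.
  by have [y _ <-] := repP _ x erefl; exists y.
have [r rP] := choice root_ex.
exists (T * {ffun 'I_d -> 'F_p})%type, (fun x => (tau x, [ffun i => kap (r x) i])).
move=> x y [txy /ffunP rxy]; have /kap_eq/(powc n) : kap (r x) =1 kap (r y).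
  by move=> i; have := rxy i; rewrite !ffunE.
by rewrite !rP txy invMg invgK mulgA mulgK.
Qed.

Lemma open_H n : open (H n).
Proof.
have [T [tau tauP]] := H_finite_index n.
by apply: open_of_finite_index tauP; [exact: H_sub|exact: closed_H].
Qed.

(** This is a lower bound for the index of [H n] in [G]; it yields the linear
independence of the sorted monomials in the group algebra. *)
Lemma H_many_cosets n : exists (T : finType) (e : T -> G), #|T| = (p ^ (d * n))%N /\
  forall v w, H n ((e v)^-1 * e w) -> v = w.
Proof.
elim: n => [|n [T [e [cT eI]]]].
  by exists unit, (fun=> 1); split=> [|[] []//]; rewrite card_unit muln0.
have [s sP] := choice (fun v : {ffun 'I_d -> 'F_p} => kap_surj v).
exists (T * {ffun 'I_d -> 'F_p})%type, (fun u => e u.1 * s u.2 ^+ (p ^ n)); split.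
  by rewrite card_prod cT card_ffun card_Fp // card_ord mulnS addnC expnD.
have [_ HM HV] := H_sub n.
move=> [v a] [w b] /= h; have {eI} vw : v = w.
  apply: eI; have := powersS h; set A := _ * _ => hA.
  have -> : (e v)^-1 * e w = s a ^+ (p ^ n) * A * (s b ^+ (p ^ n))^-1.
    by rewrite /A invMg !mulgA mulgV mul1g mulgK.
  by apply: (HM); [apply: (HM); [exists (s a)|]|apply: HV; exists (s b)].
congr (_, _) => //; apply/ffunP => i; rewrite -!sP; move: i; apply/kap_eq/(powc n).
by move: h; rewrite vw invMg -!mulgA mulKg.
Qed.

Lemma comm_expg_pow s a y j : H s [~ a, y] ->
  H (j + s) [~ a, y ^+ (p ^ j)] /\
  H (j + s).+1 (([~ a, y] ^+ (p ^ j))^-1 * [~ a, y ^+ (p ^ j)]).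
Proof.
move=> Hc; have [e _ ec] := Hc.
elim: j => [|j [IH1 IH2]]; first by rewrite expg1 mulVg add0n; split=> //; exact: powers1.
have [_ HM HV] := H_sub (j + s).+2.
have := comm_expg_H p_pr p_odd proG H_mul powG IH1.
rewrite -!expgM -!expnSr => h.
have [f _ fc] := IH1.
have h2 : H (j + s).+2 (([~ a, y] ^+ (p ^ j.+1))^-1 * [~ a, y ^+ (p ^ j)] ^+ p).
  move: IH2; rewrite -ec -fc -!expgM -!expnSr -!expnD.
  by rewrite ![(s + _)%N]addnC -addSn => /powc ef; apply/powc.
split; last by rewrite addSn; have := HM _ _ h2 h; rewrite mulgA mulgK.
have [_ HM' HV'] := H_sub (j.+1 + s).
have := HM' _ _ (powersX IH1) (powersS h); by rewrite mulKVg.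
Qed.

(** As long as [[a, y]] lies in [H s], the commutator [[a, y^(p^n)]] is
[[a, y]^(p^n)] modulo [H (n+s+1)]. So [[a, y]] can be pushed down the series until
[s = S]. *)
Lemma comm_descent n S a y : H (n + S) [~ a, y ^+ (p ^ n)] ->
  H S [~ a, y] /\ H (n + S).+1 (([~ a, y] ^+ (p ^ n))^-1 * [~ a, y ^+ (p ^ n)]).
Proof.
move=> h; suff HS : H S [~ a, y] by split=> //; have [] := comm_expg_pow n HS.
suff : forall s, (s <= S)%N -> H s [~ a, y] by apply.
elim=> [|s IHs] sS; first by exists [~ a, y].
have Hs := IHs (ltnW sS); have [_ hd] := comm_expg_pow n Hs.
have [_ HM HV] := H_sub (n + s).+1.
have h' : H (n + s).+1 [~ a, y ^+ (p ^ n)].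
  by apply: powers_le h; rewrite -addnS leq_add2l.
have := HM _ _ h' (HV _ hd); rewrite invMg invgK mulKVg -addnS.
exact: H_root.
Qed.

(** Let [log w = p^t [lam x, lam y]]. The limit formula for the bracket says that
[[x^(p^n), y^(p^n)]] has a [p^(2n)]-th root close to [w^(p^t)]; so it is a
[p^(2n+t)]-th power of an element congruent to [w] modulo [H 1]. The exponent of
[y] is then removed by [comm_descent]. *)
Lemma comm_limit x y : exists n0, forall n, (n0 <= n)%N ->
  exists2 c, [~ x ^+ (p ^ n), y] = c ^+ (p ^ (n + t)) & kap c =1 co (br (lam x) (lam y)).
Proof.
have [w wE] := lam_surj (br (lam x) (lam y)).
have ze : lg (w ^+ (p ^ t)) = br (lg x) (lg y).
  by rewrite !lamE lieZl lieZr lamX wE.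
have [u uE uz] := log_lie LG ze.
have nbz : nbhs (w ^+ (p ^ t)) [set v | H t.+1 ((w ^+ (p ^ t))^-1 * v)].
  apply: open_nbhs_nbhs; split; last by rewrite /= mulVg; exact: powers1.
  apply: (@open_comp _ _ (fun v => (w ^+ (p ^ t))^-1 * v)); last exact: open_H.
  move=> v _; apply: (@continuous2_cvg _ _ _ _ _ _ _ _ (fun x y => x * y) _ v) => //.
    exact: (mulg_continuous (_, v)).
  exact: cvg_cst.
have [n0 _ n0P] := uz _ nbz; exists n0 => n nn0.
have {n0P} hu := n0P n nn0; rewrite /= in hu.
have [_ HM HV] := H_sub t.
have [f _ fu] : H t (u n).
  have := powersS hu; have hw : H t (w ^+ (p ^ t)) by exists w.
  by move=> h; have := HM _ _ hw h; rewrite mulKVg.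
(* [n0] is such that [u n] lies in the coset [w^(p^t) H (t+1)] *)
have wf : H 1 (w^-1 * f) by apply/(powc t); rewrite fu.
have ce : [~ x ^+ (p ^ n), y ^+ (p ^ n)] = f ^+ (p ^ (n + (n + t))).
  by rewrite -uE -fu -expgM -expnD addnA addnn addnC.
have [|[g _ gc]] := @comm_descent n (n + t) (x ^+ (p ^ n)) y.
  by rewrite ce; exists f.
rewrite ce -gc -expgM -expnD [(n + t + n)%N]addnC => /powc gf.
exists g => // i; rewrite (kap_coset gf) -(kap_coset wf) /kap wE //.
Qed.

Context (g : 'I_d -> G).
Hypothesis gP : forall i j, kap (g i) j = (i == j)%:R%R.

(** Up to an element of [H 1], each [x] is a product of powers of the [g i]. *)
Lemma gen_ind (K : set G) : (forall i, K (g i)) ->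
  (forall x y, K x -> K y -> K (x * y)) -> H 1 `<=` K -> forall x, K x.
Proof.
move=> Kg KM KH x; have K1 : K 1 by apply: KH; exact: powers1.
have KX y n : K y -> K (y ^+ n) by move=> Ky; elim: n => // n IHn; rewrite expgS; apply: KM.
pose y := (\prod_(i < d) g i ^+ (kap x i : nat)).
have Ky : K y by rewrite /y; elim/big_ind: _ => // i _; exact: KX.
have kap1 j : kap 1 j = 0%R by move: j; apply/kap_H1; exact: powers1.
have kX z n j : kap (z ^+ n) j = (kap z j *+ n)%R.
  elim: n => [|n IHn]; last by rewrite expgS kapM IHn mulrS.
  by rewrite mulr0n.
have ky j : kap y j = kap x j.
  rewrite /y (@big_morph _ _ (fun z => kap z j) 0%R +%R 1 *%g) //; last by move=> a b; rewrite kapM.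
  rewrite (bigD1 j) //= big1 ?addr0 => [|i ij]; rewrite kX gP; last by rewrite (negPf ij) mul0rn.
  by rewrite eqxx natr_Zp.
by rewrite -(mulKVg y x); apply: KM => //; apply: KH; apply/kap_eq.
Qed.

Lemma comm_all (a : G) s : (forall i, H s [~ a, g i]) -> forall y, H s [~ a, y].
Proof.
move=> ag; suff : forall r, (r <= s)%N -> forall y, H r [~ a, y] by apply.
elim=> [|r IHr] rs y; first by exists [~ a, y].
have [_ HM HV] := H_sub r.+1.
move: y; apply: gen_ind => [i|x y hx hy|_ [v _ <-]].
- by apply: powers_le (ag i).
- have -> : [~ a, x * y] = [~ a, y] * [~ a, x] ^ y.
    by rewrite !commgEl !conjgE !invMg !mulgA; rewrite -?mulgA mulKVg !mulgA mulgK.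
  by apply: HM => //; exact: powersJ.
- have h := IHr (ltnW rs) v; have := comm_expg_H p_pr p_odd proG H_mul powG h.
  rewrite expn1 => /(powersS (n := r.+1)) h2.
  by have := HM _ _ (powersX h) h2; rewrite mulKVg.
Qed.

(** The exponent of the [p]-group [G / N] is a power of [p]. *)
Lemma H_cofinal (N : open_normal G) : exists n, H n `<=` N.
Proof.
have [gT [f [fM fS fK pT]]] := finite_quotient p_pr proG N.
have [n cn] : exists n, #|[set: gT]%SET| = (p ^ n)%N.
  by have [n ->] := p_natP pT; exists n.
exists n => _ [y _ <-]; apply/fK; rewrite (quotX fM).
have fy : f y \in [set: gT]%SET by rewrite inE.
by apply/eqP; rewrite -order_dvdn -cn order_dvdG.
Qed.

End Logarithm.

Local Open Scope ring_scope.

(** * Forms as symbols in an adic filtration *)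

Section SymbolCalculus.
Context (K : fieldType) (A : algType K) (m : set A) (idm : ideal m).
Context (d : nat) (b : 'I_d -> A).
Local Notation pow k := (ideal_pow m k).
Local Notation MP := (mpoly d K).

Hypotheses (bm : forall i, m (b i))
  (aug : forall x : A, exists c : K, m (x - c *: 1))
  (gen : forall x, m x -> exists c : 'I_d -> K, pow 2 (x - \sum_i c i *: b i))
  (comm : forall x y, m x -> m y -> pow 3 (x * y - y * x)).

Lemma pow0 k : pow k 0. Proof. by have [] := ideal_pow_ideal k idm. Qed.
Lemma powD k x y : pow k x -> pow k y -> pow k (x + y).
Proof. by have [_ + _] := ideal_pow_ideal k idm; apply. Qed.
Lemma powMl k x y : pow k y -> pow k (x * y).
Proof. by have [_ _ /(_ x y)h] := ideal_pow_ideal k idm => /h[]. Qed.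
Lemma powZ k (c : K) x : pow k x -> pow k (c *: x).
Proof. by rewrite -mulr_algl; exact: powMl. Qed.
Lemma powN k x : pow k x -> pow k (- x).
Proof. by rewrite -mulN1r; exact: powMl. Qed.
Lemma powB k x y : pow k x -> pow k y -> pow k (x - y).
Proof. by move=> kx ky; apply: powD => //; exact: powN. Qed.
Lemma pow_sum k I (r : seq I) (P : pred I) (F : I -> A) :
  (forall i, P i -> pow k (F i)) -> pow k (\sum_(i <- r | P i) F i).
Proof. by move=> FE; elim/big_ind: _ => //; [exact: pow0|exact: powD]. Qed.
Lemma powM k l x y : pow k x -> pow l y -> pow (k + l) (x * y).
Proof. exact: ideal_powM. Qed.
Lemma pow_le k l : (k <= l)%N -> pow l `<=` pow k.
Proof. exact: ideal_pow_le. Qed.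
Lemma pow1 x : m x <-> pow 1 x.
Proof.
split=> [mx|]; first by rewrite -[x]mul1r; apply: ideal_mulP.
have [m0 mD mM] := idm.
by apply: ideal_mul_ind => // y z _ mz; have [] := mM y z mz.
Qed.
Lemma pow_eq k l x : k = l -> pow k x -> pow l x. Proof. by move=> ->. Qed.
Lemma powX k x n : pow k x -> pow (k * n) (x ^+ n).
Proof.
move=> kx; elim: n => [|n IHn]; first by rewrite muln0.
by rewrite exprS mulnS; exact: powM.
Qed.
Lemma powX1 x n : m x -> pow n (x ^+ n).
Proof. by move=> mx; apply: (@pow_eq (1 * n)); [rewrite mul1n|apply: powX; apply/pow1]. Qed.
Lemma pow_trans k x y z : pow k (x - y) -> pow k (y - z) -> pow k (x - z).
Proof. by move=> h1 h2; have := powD h1 h2; rewrite addrA subrK. Qed.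


(** Leibniz rule, starting from [[m, m]] in [m^3]. So the associated graded ring of
the [m]-adic filtration is commutative, and products can be sorted. *)
Lemma comm_pow k l x y : pow k x -> pow l y -> pow (k + l).+1 (x * y - y * x).
Proof.
have lieMr (u v w : A) : u * (v * w) - v * w * u = (u * v - v * u) * w + v * (u * w - w * u).
  by rewrite mulrBl mulrBr !mulrA addrA subrK.
have lieMl (u v w : A) : u * v * w - w * (u * v) = u * (v * w - w * v) + (u * w - w * u) * v.
  by rewrite mulrBl mulrBr !mulrA addrA subrK.
have q1 n u v : m u -> pow n.+1 v -> pow n.+3 (u * v - v * u).
  move=> mu; elim: n v => [|n IHn] v; first by move/pow1; exact: comm.
  rewrite [pow n.+2]/=; move: v; apply: ideal_mul_ind.
  - by rewrite mulr0 mul0r subrr; exact: pow0.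
  - move=> v w hv hw; rewrite mulrDr mulrDl opprD addrACA; exact: powD.
  - move=> v w hv mw; rewrite lieMr; apply: powD.
      by apply: (@pow_eq (n.+3 + 1)); [lia|apply: powM; [exact: IHn|apply/pow1]].
    by apply: (@pow_eq (n.+1 + 3)); [lia|apply: powM => //; exact: comm].
have q2 k' n u v : pow k'.+1 u -> pow n.+1 v -> pow (k' + n).+3 (u * v - v * u).
  move=> + hv; elim: k' u => [|k' IHk] u; first by move/pow1 => mu; exact: q1.
  rewrite [pow k'.+2]/=; move: u; apply: ideal_mul_ind.
  - by rewrite mulr0 mul0r subrr; exact: pow0.
  - move=> u w hu hw; rewrite mulrDr mulrDl opprD addrACA; exact: powD.
  - move=> u w hu mw; rewrite lieMl; apply: powD.
      by apply: (@pow_eq (k'.+1 + n.+3)); [lia|apply: powM => //; exact: q1].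
    by apply: (@pow_eq ((k' + n).+3 + 1)); [lia|apply: powM; [exact: IHk|apply/pow1]].
have shift (u v : A) (c : K) : u * v - v * u = (u - c *: 1) * v - v * (u - c *: 1).
  by rewrite mulrBl mulrBr -scalerAl -scalerAr mul1r mulr1 opprB addrA subrK.
have shift2 (u v : A) (c : K) : u * v - v * u = u * (v - c *: 1) - (v - c *: 1) * u.
  by rewrite mulrBl mulrBr -scalerAl -scalerAr mul1r mulr1 opprB addrA subrK.
have [c0 hc0] := aug x; have [c1 hc1] := aug y.
case: k => [|k]; case: l => [|l] hx hy.
- rewrite (shift _ _ c0) (shift2 _ _ c1).
  by apply: (@pow_le 1 3) => //; exact: comm.
- by rewrite (shift _ _ c0); apply: (@pow_le _ (l.+3)) => //; exact: q1.
- rewrite (shift2 _ _ c1) addn0; apply: (@pow_le _ (k + 0).+3); first by rewrite addn0.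
  by apply: q2 => //; apply/pow1.
- by rewrite addSn addnS; exact: q2.
Qed.

Local Notation mon := (mmap1 b).
(** The [b i] do not commute: each monomial is evaluated with its factors in the order
of the variables. *)
Definition ev : MP -> A := mmap (in_alg A) b.

Lemma evD P Q : ev (P + Q) = ev P + ev Q. Proof. exact: mmapD. Qed.
Lemma evB P Q : ev (P - Q) = ev P - ev Q. Proof. exact: mmapB. Qed.
Lemma ev0 : ev 0 = 0. Proof. exact: mmap0. Qed.
Lemma evZ c P : ev (c *: P) = c *: ev P.
Proof. by rewrite /ev mmapZ /= mulr_algl. Qed.
Lemma evX e : ev (mpolyX K e) = mon e. Proof. exact: mmapX. Qed.
Lemma ev_sum I (r : seq I) (P : pred I) (F : I -> MP) :
  ev (\sum_(i <- r | P i) F i) = \sum_(i <- r | P i) ev (F i).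
Proof. exact: raddf_sum. Qed.

Lemma ev_lin I (r : seq I) (C : pred I) (c : I -> K) (e : I -> multinom d) :
  ev (\sum_(i <- r | C i) c i *: mpolyX K (e i)) = \sum_(i <- r | C i) c i *: mon (e i).
Proof. by rewrite ev_sum; apply: eq_bigr => i _; rewrite evZ evX. Qed.

Lemma evE P : ev P = \sum_(e <- msupp P) mcoeff e P *: mon e.
Proof. by rewrite {1}(mpolyE P) ev_lin. Qed.

Lemma pow_mon e : pow (mdeg e) (mon e).
Proof.
rewrite mdegE /mmap1; elim/big_rec2: _ => // i k x _ hx; apply: powM => //.
exact: powX1.
Qed.

(** Sorting the factors changes the product by terms of higher order. *)
Lemma mon_mul e f : pow (mdeg e + mdeg f).+1 (mon e * mon f - mon (mnm_add e f)).
Proof.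
rewrite !mdegE /mmap1; pose s := index_enum 'I_d; rewrite -/s.
elim: s => [|i s IHs]; first by rewrite !big_nil mulr1 subrr; exact: pow0.
rewrite !big_cons mnmDE exprD.
set x := b i ^+ e i; set y := b i ^+ f i.
set P := \prod_(_ <- _) _ in IHs *; set Q := \prod_(_ <- _) _ in IHs *.
set PQ := \prod_(_ <- _) _ in IHs *; set ne := (\sum_(_ <- _) _)%N in IHs *.
set nf := (\sum_(_ <- _) _)%N in IHs *.
have px : pow (e i) x by exact: powX1.
have py : pow (f i) y by exact: powX1.
have hs (g : multinom d) : pow (\sum_(j <- s) g j)%N (\prod_(j <- s) b j ^+ g j).
  elim/big_rec2: _ => // j k z _ hz; apply: powM => //.
  exact: powX1.
have hP : pow ne P by exact: hs.
have hQ : pow nf Q by exact: hs.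
have -> : x * P * (y * Q) - x * y * PQ = x * (P * y - y * P) * Q + x * y * (P * Q - PQ).
  by rewrite !mulrBr !mulrBl !mulrA addrA subrK.
apply: powD.
  apply: (@pow_eq (e i + (ne + f i).+1 + nf)); first by lia.
  by apply: powM => //; apply: powM => //; exact: comm_pow.
apply: (@pow_eq (e i + f i + (ne + nf).+1)); first by lia.
by apply: powM => //; exact: powM.
Qed.

Local Notation homog k := (ishomog1 k mdeg).

Lemma pow_ev k P : P \is homog k -> pow k (ev P).
Proof.
move=> /dhomogP hP; rewrite /ev /mmap big_seq; apply: pow_sum => e eP.
by rewrite mulr_algl; apply: powZ; rewrite -(hP _ eP); exact: pow_mon.
Qed.

Lemma ev_mul k l P Q : P \is homog k -> Q \is homog l ->
  pow (k + l).+1 (ev P * ev Q - ev (P * Q)).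
Proof.
move=> /dhomogP hP /dhomogP hQ.
have -> : P * Q = \sum_(e <- msupp P) \sum_(f <- msupp Q)
    (mcoeff e P * mcoeff f Q) *: mpolyX K (mnm_add e f).
  rewrite {1}(mpolyE P) {1}(mpolyE Q) mulr_suml; apply: eq_bigr => e _.
  rewrite mulr_sumr; apply: eq_bigr => f _.
  by rewrite mpolyXD -scalerAl -scalerAr scalerA.
rewrite ev_sum !evE mulr_suml -sumrB big_seq; apply: pow_sum => e eP.
rewrite mulr_sumr ev_sum -sumrB big_seq; apply: pow_sum => f fQ.
rewrite evZ evX -scalerAl -scalerAr scalerA -scalerBr.
by apply: powZ; rewrite -(hP _ eP) -(hQ _ fQ); exact: mon_mul.
Qed.

(** The form [P] of degree [k] represents the class of [x] in [m^k / m^(k+1)]. *)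
Definition sym k (x : A) (P : MP) := P \is homog k /\ pow k.+1 (x - ev P).

Lemma sym_pow k x P : sym k x P -> pow k x.
Proof.
move=> [hP hx]; rewrite -(subrK (ev P) x); apply: powD; last exact: pow_ev.
exact: pow_le hx.
Qed.

Lemma symD k x y P Q : sym k x P -> sym k y Q -> sym k (x + y) (P + Q).
Proof.
move=> [hP hx] [hQ hy]; split; first exact: dhomogD.
by rewrite evD opprD addrACA; exact: powD.
Qed.

Lemma sym0 k : sym k 0 0.
Proof. by split; [exact: dhomog0|rewrite ev0 subrr; exact: pow0]. Qed.

Lemma symZ k c x P : sym k x P -> sym k (c *: x) (c *: P).
Proof. by move=> [hP hx]; split; [exact: dhomogZ|rewrite evZ -scalerBr; exact: powZ]. Qed.

Lemma sym_sum k I (r : seq I) (C : pred I) (F : I -> A) (P : I -> MP) :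
  (forall i, C i -> sym k (F i) (P i)) ->
  sym k (\sum_(i <- r | C i) F i) (\sum_(i <- r | C i) P i).
Proof. by move=> FP; elim/big_rec2: _ => [|i x y Ci]; [exact: sym0|apply: symD; exact: FP]. Qed.

Lemma sym_low k x : pow k.+1 x -> sym k x 0.
Proof. by move=> kx; split; [exact: dhomog0|rewrite ev0 subr0]. Qed.

Lemma symM k l x y P Q : sym k x P -> sym l y Q -> sym (k + l) (x * y) (P * Q).
Proof.
move=> sx sy; have px := sym_pow sx; have py := sym_pow sy.
move: sx sy => [hP hx] [hQ hy]; split; first exact: dhomogM.
apply: pow_trans (ev_mul hP hQ).
have -> : x * y - ev P * ev Q = (x - ev P) * y + ev P * (y - ev Q).
  by rewrite mulrBl mulrBr addrA subrK.
apply: powD; first by rewrite -addSn; exact: powM.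
by rewrite -addnS; apply: powM => //; exact: pow_ev.
Qed.

Lemma sym1 : sym 0 1 1.
Proof.
split; first exact: dhomog1.
have -> : ev 1 = 1 by rewrite -(mpolyX0 d K) evX mmap11.
by rewrite subrr; exact: pow0.
Qed.

Lemma symX k x P n : sym k x P -> sym (k * n) (x ^+ n) (P ^+ n).
Proof.
move=> sx; elim: n => [|n IHn]; first by rewrite muln0 !expr0; exact: sym1.
by rewrite !exprS mulnS; exact: symM.
Qed.

Lemma sym_b i : sym 1 (b i) (mpolyX K (mnm1 i)).
Proof.
split; first by rewrite dhomogX /= mdeg1.
by rewrite evX mmap1U subrr; exact: pow0.
Qed.

(** The [b i] span [m] modulo [m^2], so the forms of degree [k] in the [b i] span
[m^k] modulo [m^(k+1)]. *)
Lemma sym_ex k x : pow k x -> exists P, sym k x P.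
Proof.
elim: k x => [|k IHk] x.
  move=> _; have [c hc] := aug x; exists (c *: 1).
  rewrite -(subrK (c *: 1) x) -[c *: 1 in X in sym _ _ X]add0r.
  by apply: symD; [apply: sym_low; apply/pow1|apply: symZ; exact: sym1].
rewrite [pow k.+1]/=; move: x; apply: ideal_mul_ind.
- by exists 0; exact: sym0.
- by move=> x y [P hP] [Q hQ]; exists (P + Q); exact: symD.
- move=> x y /IHk[P hP] /gen[c hc].
  exists (P * (0 + \sum_i c i *: mpolyX K (mnm1 i))); rewrite -addn1; apply: symM => //.
  rewrite -(subrK (\sum_i c i *: b i) y); apply: symD; first exact: sym_low.
  by apply: sym_sum => i _; apply: symZ; exact: sym_b.
Qed.

End SymbolCalculus.

(** * Nilpotence of the augmentation ideals *)

(** All that the filtered ring [K[[G]]] sees of a uniform group with Lie algebra [L]: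
the subgroups of [p^n]-th powers, the coordinates [kap] of [G / G^p = L / p L], and
elements [g i] of [G] whose classes form the basis dual to [kap]. *)
Record power_frame (K : fieldType) (p d : nat) (G : topGroupType) (kap : G -> 'I_d -> K)
  (g : 'I_d -> G)
  : Prop := PowerFrame {
  frame_subgroup : forall n, is_subgroup (powers G (p ^ n));
  frame_open : forall n, open (powers G (p ^ n));
  frame_comm : forall n x y, powers G (p ^ n) x -> powers G (p ^ n.+1) [~ x, y]%g;
  frame_morph : forall n x y, powers G (p ^ n.+1)
    (((x * y) ^+ (p ^ n))^-1 * (x ^+ (p ^ n) * y ^+ (p ^ n)))%g;
  frame_kapM : forall x y i, kap (x * y)%g i = kap x i + kap y i;
  frame_kap_g : forall i j, kap (g i) j = (i == j)%:R;
  frame_kap0 : forall x, powers G p x -> forall i, kap x i = 0;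
  frame_ind : forall P : set G, (forall i, P (g i)) ->
    (forall x y, P x -> P y -> P (x * y)%g) -> powers G p `<=` P -> forall x, P x;
  frame_cosets : forall n, exists (T : finType) (e : T -> G), #|T| = (p ^ (d * n))%N /\
    forall v w, powers G (p ^ n) ((e v)^-1 * e w)%g -> v = w;
  frame_cofinal : forall N : open_normal G, exists n, powers G (p ^ n) `<=` N
}.

Section NilpotentIdeals.
Context (K : fieldType) (A : algType K).
Implicit Types I J : set A.

Definition nilideal J := exists k, ideal_pow J k `<=` [set 0].

Lemma ideal_pow_sub I J k : I `<=` J -> ideal_pow I k `<=` ideal_pow J k.
Proof.
move=> IJ; elim: k => [|k IHk] //= x [s sP ->]; exists s => // u /sP[h1 h2].
by split; [exact: IHk|exact: IJ].
Qed.

Lemma ideal_pow_split J k l : ideal J ->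
  ideal_pow J (k + l) `<=` ideal_mul (ideal_pow J k) (ideal_pow J l).
Proof.
move=> idJ; elim: l => [|l IHl].
  by rewrite addn0 => x Jx; rewrite -[x]mulr1; exact: ideal_mulP.
have [M0 MD _] := ideal_mul_ideal (ideal_pow_ideal k idJ) (ideal_pow_ideal l.+1 idJ).
rewrite addnS; apply: ideal_mul_ind => // x y /IHl hx Jy; move: x hx; apply: ideal_mul_ind.
- by rewrite mul0r.
- by move=> u v hu hv; rewrite mulrDl; exact: MD.
- by move=> u v hu hv; rewrite -mulrA; apply: ideal_mulP => //; exact: ideal_mulP.
Qed.

Lemma ideal_pow_pow J k l : ideal J ->
  ideal_pow J (l * k) `<=` ideal_pow (ideal_pow J k) l.
Proof.
move=> idJ; elim: l => [|l IHl] //; rewrite mulSn addnC => x /(ideal_pow_split idJ).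
have [M0 MD _] := ideal_pow_ideal l.+1 (ideal_pow_ideal k idJ).
by move: x; apply: ideal_mul_ind => // x y /IHl hx hy; exact: ideal_mulP.
Qed.

(** One takes [J' = J + A c]: since [c] is central modulo [J], the [n]-th power of
[J'] lies in [J + A c^n]. *)
Lemma nilideal_add J (c : A) q : ideal J -> nilideal J -> (forall x, J (c * x - x * c)) ->
  J (c ^+ q) -> exists J' : set A, [/\ ideal J', nilideal J', J `<=` J' & J' c].
Proof.
move=> idJ [k Jk] cC cq; have [J0 JD JM] := idJ.
pose J' n : set A := [set x | exists r, J (x - r * c ^+ n)].
have JJ' n : J `<=` J' n by move=> x Jx; exists 0; rewrite mul0r subr0.
have cXC n x : J (c ^+ n * x - x * c ^+ n).
  elim: n => [|n IHn]; first by rewrite mul1r mulr1 subrr.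
  have -> : c ^+ n.+1 * x - x * c ^+ n.+1 =
      c * (c ^+ n * x - x * c ^+ n) + (c * x - x * c) * c ^+ n.
    by rewrite exprS mulrBr mulrBl !mulrA addrA subrK.
  by apply: JD; [have [] := JM c _ IHn|have [] := JM (c ^+ n) _ (cC x)].
have idJ' n : ideal (J' n).
  split; first exact: JJ'.
    by move=> x y [r hr] [s hs]; exists (r + s); rewrite mulrDl opprD addrACA; exact: JD.
  move=> y x [r hr]; split.
    by exists (y * r); rewrite -mulrA -mulrBr; have [] := JM y _ hr.
  exists (r * y); have -> : x * y - r * y * c ^+ n =
      (x - r * c ^+ n) * y + r * (c ^+ n * y - y * c ^+ n).
    by rewrite mulrBl mulrBr !mulrA addrA subrK.
  by apply: JD; [have [] := JM y _ hr|have [] := JM r _ (cXC n y)].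
have pow' n : ideal_pow (J' 1%N) n `<=` J' n.
  elim: n => [|n IHn]; first by move=> x _; exists x; rewrite mulr1 subrr.
  have [Z D M] := idJ' n.+1.
  apply: ideal_mul_ind => // x y /IHn[r hr] [s hs].
  exists (r * s); rewrite expr1 in hs; have -> : x * y - r * s * c ^+ n.+1 =
    (x - r * c ^+ n) * y + r * c ^+ n * (y - s * c) + r * (c ^+ n * s - s * c ^+ n) * c.
    by rewrite exprSr !mulrBl !mulrBr !mulrBl !mulrA !addrA subrK subrK.
  by apply: (JD); [apply: (JD)|]; [have [] := JM y _ hr|have [] := JM (r * c ^+ n) _ hs|
    have [/(JM c)[]] := JM r _ (cXC n s)].
exists (J' 1%N); split=> //; last by exists 1; rewrite mul1r subrr.
exists (k * q)%N => x /(ideal_pow_pow (idJ' 1%N)) hx; apply: Jk.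
apply: ideal_pow_sub hx => y /pow'[r hr]; rewrite -(subrK (r * c ^+ q) y).
by apply: JD => //; have [] := JM r _ cq.
Qed.
End NilpotentIdeals.

Section FrameNilpotent.
Context (K : fieldType) (p d : nat) (G : topGroupType) (kap : G -> 'I_d -> K) (g : 'I_d -> G).
Hypotheses (fr : power_frame p kap g).
Context (A : algType K).
Hypothesis charA : p \in [pchar A].
Context (iota : G -> A).
Hypotheses (iota1 : iota 1%g = 1) (iotaM : forall x y, iota (x * y)%g = iota x * iota y).
Hypothesis iota_span : forall x : A, exists s : seq (K * G), x = \sum_(u <- s) u.1 *: iota u.2.
Local Notation H n := (powers G (p ^ n)).

Lemma iotaX x n : iota (x ^+ n)%g = iota x ^+ n.
Proof. by elim: n => // n IHn; rewrite expgS iotaM IHn exprS. Qed.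

Lemma iota_sub1X x n : iota (x ^+ (p ^ n))%g - 1 = (iota x - 1) ^+ (p ^ n).
Proof.
elim: n => [|n IHn]; first by rewrite !expn0.
rewrite expnSr expgM iotaX exprM -IHn -[X in _ - X](expr1n _ p).
rewrite -!(pFrobenius_autE charA) pFrobenius_autB_comm //.
by rewrite /GRing.comm mulr1 mul1r.
Qed.

(** The ideal generated by the elements [h - 1], [h] in [H n]. *)
Definition Hideal n : set A :=
  \bigcap_(J in [set J : set A | ideal J /\ forall h, H n h -> J (iota h - 1)]) J.

Lemma Hideal_ideal n : ideal (Hideal n).
Proof.
split=> [J [[]]//|x y hx hy J hJ|y x hx].
  by have [[_ JD _] _] := hJ; apply: JD; [exact: hx|exact: hy].
by split=> J hJ; have [[_ _ JM] _] := hJ; have [] := JM y x (hx J hJ).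
Qed.

(** Descending induction from the level at which [H n] acts trivially. The
ideal of [H j] is obtained from that of [H (j+1)] by adding the [d] elements
[g_i^(p^j) - 1], which modulo the latter are central and have [p]-th power zero. *)
Lemma Hideal_nil n : (forall h, H n h -> iota h = 1) -> forall k, nilideal (Hideal k).
Proof.
move=> Hn; suff nd k : (k <= n)%N -> nilideal (Hideal (n - k)).
  have mono k l : (k <= l)%N -> Hideal l `<=` Hideal k.
    move=> kl x hx J [idJ hJ]; apply: hx; split=> // h Hh; apply: hJ.
    case: Hh => y _ <-; exists (y ^+ (p ^ (l - k)))%g => //.
    by rewrite -expgM -expnD subnK.
  move=> k; have [kn|nk] := leqP k n; first by rewrite -(subKn kn); apply: nd; exact: leq_subr.
  have [q hq] := nd 0%N (leq0n _); exists q => x hx; apply: hq.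
  by apply: ideal_pow_sub hx; apply: mono; rewrite subn0 ltnW.
elim: k => [|k IHk] kn.
  exists 1%N => x /(pow1 (Hideal_ideal _)) /(_ [set 0]); apply; split.
    split=> // [_ _ -> ->|b _ ->]; first by rewrite addr0.
    by rewrite mulr0 mul0r.
  by move=> h; rewrite subn0 => /Hn ->; rewrite subrr.
set j := (n - k.+1)%N; have jE : (n - k)%N = j.+1 by rewrite /j; lia.
have {IHk kn} := IHk (ltnW kn); rewrite jE => nilj.
have [H1 HM HV] := frame_subgroup fr j.+1.
have idj := Hideal_ideal j.+1; have inj h : H j.+1 h -> Hideal j.+1 (iota h - 1).
  by move=> Hh J [_]; apply.
have iotaV x : iota x * iota x^-1%g = 1 by rewrite -iotaM mulgV.
have central i x : Hideal j.+1 ((iota (g i ^+ (p ^ j))%g - 1) * x -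
    x * (iota (g i ^+ (p ^ j))%g - 1)).
  set u := (g i ^+ (p ^ j))%g; have Hu : H j u by exists (g i).
  have [s ->] := iota_span x; rewrite mulr_sumr mulr_suml -sumrB.
  have [I0 ID IM] := idj; elim/big_ind: _ => // -[c y] _ /=.
  have -> : (iota u - 1) * (c *: iota y) - (c *: iota y) * (iota u - 1) =
      (c *: iota (y * u)%g) * (iota [~ u, y]%g - 1).
    rewrite mulrBl mulrBr mul1r mulr1 opprB addrA subrK mulrBr mulr1 -!scalerAl -!scalerAr.
    by rewrite -!iotaM; congr (_ *: iota _ - _); rewrite commgEl conjgE !mulgA mulgK mulgV mul1g.
  by have [] := IM (c *: iota (y * u)%g) _ (inj _ (frame_comm fr y Hu)).
have pw i : Hideal j.+1 ((iota (g i ^+ (p ^ j))%g - 1) ^+ p).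
  have := iota_sub1X (g i ^+ (p ^ j))%g 1; rewrite expn1 => <-; apply: inj.
  by rewrite -expgM -expnSr; exists (g i).
(* adjoin the generators [g_l^(p^j) - 1], [l < i], one after the other *)
have chain i : (i <= d)%N -> exists J : set A, [/\ ideal J, nilideal J,
    Hideal j.+1 `<=` J & forall l : 'I_d, (l < i)%N -> J (iota (g l ^+ (p ^ j))%g - 1)].
  elim: i => [|i IHi] id; first by exists (Hideal j.+1); split.
  have [J [idJ nJ sJ gJ]] := IHi (ltnW id); pose l0 := Ordinal id.
  have [J' [idJ' nJ' sJ' cJ']] := nilideal_add idJ nJ
    (fun x => sJ _ (central l0 x)) (sJ _ (pw l0)).
  exists J'; split=> // [x /sJ/sJ'//|l]; rewrite ltnS leq_eqVlt => /orP[/eqP li|/gJ/sJ'//].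
  by rewrite (_ : l = l0) //; exact: val_inj.
(* the resulting ideal contains [h - 1] for all [h] in [H j], by induction on the roots [e] *)
have [J [idJ nJ sJ gJ]] := chain d (leqnn d); have [k' hk] := nJ; exists k' => x hx; apply: hk.
apply: ideal_pow_sub hx => y; apply; split=> // _ [e _ <-].
move: e; apply: (frame_ind fr) => [i|x' y' hx hy|_ [v _ <-]].
- exact: gJ.
- have hm := frame_morph fr j x' y'; set B := (_ * _)%g in hm.
  have e : iota ((x' * y') ^+ (p ^ j))%g * iota B =
      iota (x' ^+ (p ^ j))%g * iota (y' ^+ (p ^ j))%g by rewrite -!iotaM mulKVg.
  have -> : iota ((x' * y') ^+ (p ^ j))%g - 1 =
     - (iota ((x' * y') ^+ (p ^ j))%g * (iota B - 1)) +
     (iota (x' ^+ (p ^ j))%g * (iota (y' ^+ (p ^ j))%g - 1) + (iota (x' ^+ (p ^ j))%g - 1)).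
    by rewrite !mulrBr !mulr1 e opprB !subrKA.
  have [_ JD JM] := idJ; apply: (JD); last by apply: (JD) => //; have [] := JM (iota (x' ^+ (p ^ j))%g) _ hy.
  by rewrite -mulNr; have [] := JM (- iota ((x' * y') ^+ (p ^ j))%g) _ (sJ _ (inj _ hm)).
- by apply: sJ; apply: inj; rewrite -expgM -expnS; exists v.
Qed.

End FrameNilpotent.

Arguments ideal_pow : simpl never.

(** * Generators of the augmentation ideal *)

Section SortedProducts.
Context (K : fieldType) (p d : nat) (G : topGroupType) (kap : G -> 'I_d -> K) (g : 'I_d -> G).
Hypothesis (fr : power_frame p kap g).
Local Open Scope group_scope.
Local Notation H n := (powers G (p ^ n)).

Definition sprod (j : nat) (a : 'I_d -> nat) : G := \prod_(i < d) g i ^+ (p ^ j * a i).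

(** [H n / H (n+1)] is central in [G / H (n+1)], so that [c] can be moved to the
place [i] of the product. *)
Lemma prod_insert n (c : G) (i : 'I_d) (x y : 'I_d -> G) : H n c ->
  (forall l, l != i -> y l = x l) -> y i = x i * c ->
  H n.+1 ((\prod_(l < d) y l)^-1 * (\prod_(l < d) x l * c)).
Proof.
move=> Hc yx yi; have [H1 HM HV] := frame_subgroup fr n.+1.
have : i \in index_enum 'I_d by rewrite mem_index_enum.
have : uniq (index_enum 'I_d) by rewrite index_enum_uniq.
elim: (index_enum _) => [|l s IHs] //= /andP[ls us]; rewrite inE !big_cons.
case: (eqVneq i l) => [il _|il /= /(IHs us) h]; last first.
  by rewrite yx 1?eq_sym // invMg -!mulgA mulKg.
rewrite -{l}il in ls *.
have -> : \prod_(j <- s) y j = \prod_(j <- s) x j.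
  rewrite big_seq [RHS]big_seq; apply: eq_bigr => j js; apply: yx.
  by apply: contraNneq ls => ji; rewrite -ji.
rewrite yi; set P := \prod_(_ <- _) _.
have -> : (x i * c * P)^-1 * (x i * P * c) = [~ c, P]^-1.
  by rewrite invg_comm commgEl conjgE !invMg -!mulgA mulKg.
by apply: HV; exact: (frame_comm fr).
Qed.

Lemma sprod_H j a : H j (sprod j a).
Proof.
have [H1 HM HV] := frame_subgroup fr j; rewrite /sprod.
elim/big_ind: _ => // i _; exists (g i ^+ a i) => //.
by rewrite -expgM mulnC.
Qed.

(** [H n / H (n+1)] is generated by the [g_i^(p^n)]; these can be absorbed into a
sorted product. *)
Lemma sprod_approx j k x : H j x -> exists a, H (j + k) ((sprod j a)^-1 * x).
Proof.
move=> Hx; elim: k => [|k [a ha]].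
  exists (fun=> 0%N); have [H1 HM HV] := frame_subgroup fr j; rewrite addn0.
  by apply: HM => //; apply: HV; exact: sprod_H.
rewrite addnS; set n := (j + k)%N in ha *; case: ha => w _ wE.
have [H1 HM HV] := frame_subgroup fr n.+1.
have HJ u v : H n.+1 u -> H n.+1 (u ^ v).
  by case=> y _ <-; exists (y ^ v) => //; rewrite conjXg.
suff [a' ha'] : exists a', H n.+1 ((sprod j a')^-1 * (sprod j a * w ^+ (p ^ n))).
  by exists a'; move: ha'; rewrite wE mulKVg.
move: a {wE}; move: w; apply: (frame_ind fr) => [i a|x' y hx hy a|_ [v _ <-] a].
- exists (fun l => if l == i then (a i + p ^ k)%N else a l).
  apply: (prod_insert (i := i)); first by exists (g i).
    by move=> l /negPf ->.
  by rewrite eqxx mulnDr expgD -expnD.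
- have [a1 h1] := hx a; have [a2 h2] := hy a1; exists a2.
  have hm := frame_morph fr n x' y.
  set u := (_ * y) ^+ _ in hm *; set v := x' ^+ _ in hm h1; set w := y ^+ _ in hm h2.
  have -> : (sprod j a2)^-1 * (sprod j a * u) =
     (sprod j a2)^-1 * (sprod j a1 * w) * ((sprod j a1)^-1 * (sprod j a * v)) ^ w *
     (u^-1 * (v * w))^-1.
    by rewrite conjgE !invMg !invgK !mulgA !mulgK.
  by apply: (HM); [apply: (HM) => //; exact: HJ|exact: HV].
- exists a; rewrite mulKg -expgM -expnS; by exists v.
Qed.

End SortedProducts.

Section GroupAlgebra.
Context (K : fieldType) (p d : nat) (G : topGroupType) (kap : G -> 'I_d -> K) (g : 'I_d -> G).
Hypotheses (p_char : p \in [pchar K]) (p_gt2 : (2 < p)%N) (fr : power_frame p kap g).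
Context (A : algType K) (iota : G -> A).
Hypotheses (iota1 : iota 1%g = 1) (iotaM : forall x y, iota (x * y)%g = iota x * iota y).
Hypothesis iota_span : forall x : A, exists s : seq (K * G), x = \sum_(u <- s) u.1 *: iota u.2.
Context (m : set A) (idm : ideal m).
Hypotheses (m_iota : forall x, m (iota x - 1))
  (m_span : forall x, m x -> exists s : seq (K * G), x = \sum_(u <- s) u.1 *: (iota u.2 - 1)).
Local Notation pow k := (ideal_pow m k).
Local Notation b := (fun i => iota (g i) - 1).

Lemma charA : p \in [pchar A].
Proof.
have := p_char; rewrite !inE => /andP[-> /eqP p0] /=.
by rewrite -scaler_nat p0 scale0r.
Qed.

Lemma subX x n : iota (x ^+ (p ^ n))%g - 1 = (iota x - 1) ^+ (p ^ n).
Proof. exact: (iota_sub1X charA iota1 iotaM). Qed.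

Lemma b_in i : m (b i). Proof. exact: m_iota. Qed.

Lemma aug_A (x : A) : exists c : K, m (x - c *: 1).
Proof.
have [s ->] := iota_span x; exists (\sum_(u <- s) u.1).
rewrite scaler_suml -sumrB; have [m0 mD mM] := idm.
elim/big_ind: _ => // u _; rewrite -scalerBr -mulr_algl.
by have [] := mM (u.1%:A) _ (m_iota u.2).
Qed.

Lemma pow_powers x n : pow (p ^ n) (iota (x ^+ (p ^ n))%g - 1).
Proof. by rewrite subX; apply: powX1. Qed.

(** [x |-> x - 1] is additive modulo [m^2] and maps [G^p] into [m^p]. *)
Lemma iota_lin x : pow 2 (iota x - 1 - \sum_i kap x i *: b i).
Proof.
move: x; apply: (frame_ind fr) => [i|x y hx hy|_ [v _ <-]].
- rewrite (bigD1 i) //= big1 ?addr0 => [|j ji]; rewrite (frame_kap_g fr).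
    by rewrite eqxx scale1r subrr; exact: (pow0 idm 2).
  by rewrite eq_sym (negPf ji) scale0r.
- have -> : iota (x * y)%g - 1 = (iota x - 1) * (iota y - 1) + ((iota x - 1) + (iota y - 1)).
    by rewrite iotaM addrA -{2}[iota x - 1]mulr1 -mulrDr subrK mulrBl mul1r subrKA.
  rewrite (eq_bigr (fun i => kap x i *: b i + kap y i *: b i)) => [|i _]; last first.
    by rewrite (frame_kapM fr) scalerDl.
  rewrite big_split /= opprD -addrA addrACA.
  apply: (powD idm); last exact: (powD idm).
  by apply: (powM idm (k := 1) (l := 1)); apply/(pow1 idm).
- rewrite big1 => [|i _]; last by rewrite (frame_kap0 fr) ?scale0r //; exists v.
  rewrite subr0.
  apply: (pow_le idm (l := p)); first exact: ltnW.
  by have := pow_powers v 1; rewrite expn1.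
Qed.

Lemma gen_A x : m x -> exists c : 'I_d -> K, pow 2 (x - \sum_i c i *: b i).
Proof.
move=> /m_span[s ->]; exists (fun i => \sum_(u <- s) u.1 * kap u.2 i).
under [X in _ - X]eq_bigr => i _ do rewrite scaler_suml.
rewrite exchange_big -sumrB /=; apply: pow_sum => // u _.
under [X in _ - X]eq_bigr => i _ do rewrite -scalerA.
by rewrite -scaler_sumr -scalerBr; apply: powZ => //; exact: iota_lin.
Qed.

Lemma iota_comm x y : iota x * iota y - iota y * iota x = iota (y * x)%g * (iota [~ x, y]%g - 1).
Proof.
rewrite mulrBr mulr1 -!iotaM; congr (iota _ - _).
by rewrite commgEl conjgE !mulgA mulgK mulgV mul1g.
Qed.

Lemma sub1_comm (x y : A) : (x - 1) * y - y * (x - 1) = x * y - y * x.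
Proof. by rewrite mulrBl mulrBr mul1r mulr1 opprB addrA subrK. Qed.

(** A commutator of elements of [G] is a [p]-th power, so [[x, y] - 1] lies in [m^p],
and [p >= 3]. *)
Lemma comm_A x y : m x -> m y -> pow 3 (x * y - y * x).
Proof.
move=> /m_span[s ->] /m_span[r ->].
rewrite mulr_suml mulr_sumr -sumrB; apply: pow_sum => // u _.
rewrite mulr_sumr mulr_suml -sumrB; apply: pow_sum => // v _.
rewrite -!scalerAl -!scalerAr !scalerA [v.1 * _]mulrC -scalerBr; apply: powZ => //.
rewrite sub1_comm -[X in pow 3 X]opprB sub1_comm opprB iota_comm; apply: powMl => //.
have [|w _ <-] := frame_comm fr (n := 0) (x := u.2) v.2; first by exists u.2.
by apply: pow_le (pow_powers w 1) => //; rewrite expn1.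
Qed.
End GroupAlgebra.

(** * A basis of the group algebra of a level *)

Section LevelBasis.
Context (K : fieldType) (p d : nat) (G : topGroupType) (kap : G -> 'I_d -> K) (g : 'I_d -> G).
Hypotheses (p_char : p \in [pchar K]) (p_gt2 : (2 < p)%N) (fr : power_frame p kap g).
Context (A : algType K) (iota : G -> A).
Hypotheses (iota1 : iota 1%g = 1) (iotaM : forall x y, iota (x * y)%g = iota x * iota y).
Hypothesis iota_span : forall x : A, exists s : seq (K * G), x = \sum_(u <- s) u.1 *: iota u.2.
Context (m : set A) (idm : ideal m).
Hypotheses (m_iota : forall x, m (iota x - 1))
  (m_span : forall x, m x -> exists s : seq (K * G), x = \sum_(u <- s) u.1 *: (iota u.2 - 1)).
Local Notation H n := (powers G (p ^ n)).
Local Notation pow k := (ideal_pow m k).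
Local Notation MP := (mpoly d K).
Local Notation b := (fun i => iota (g i) - 1).
Local Notation homog k := (ishomog1 k mdeg).
Local Notation ev := (ev (K := K) b).
Local Notation mon := (mmap1 b).
Context (n : nat).
Hypotheses (iota_H : forall h, H n h -> iota h = 1)
  (iota_free : forall (T : finType) (e : T -> G),
     (forall v w, H n ((e v)^-1 * e w)%g -> v = w) ->
     forall c : T -> K, \sum_v c v *: iota (e v) = 0 -> forall v, c v = 0).

Let chA := charA p_char A.
Let sex k x := sym_ex idm (b_in g m_iota) (aug_A iota_span idm m_iota)
  (gen_A p_char p_gt2 fr iota1 iotaM idm m_iota m_span)
  (comm_A p_char p_gt2 fr iota1 iotaM idm m_iota m_span) (k := k) (x := x).

Lemma m_nil : exists k, pow k `<=` [set 0].
Proof.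
have [k hk] := Hideal_nil fr chA iota1 iotaM iota_span iota_H 0; exists k => x hx.
apply: hk; apply: ideal_pow_sub hx => _ /m_span[s ->] J [[J0 JD JM] hJ].
elim/big_ind: _ => // u _; rewrite -mulr_algl.
by have [] := JM (u.1%:A) _ (hJ u.2 (ex_intro2 _ _ u.2 Logic.I (expg1 _))).
Qed.

Lemma prod_zero (I : eqType) (s : seq I) (F : I -> A) i :
  i \in s -> F i = 0 -> \prod_(j <- s) F j = 0.
Proof.
elim: s => // j s IHs; rewrite inE big_cons => /orP[/eqP <- ->|/IHs h /h ->]; by rewrite ?mul0r ?mulr0.
Qed.

(** [b_i^(p^n) = g_i^(p^n) - 1 = 0] at the level [n]. *)
Lemma mon_big (e : multinom d) i : (p ^ n <= e i)%N -> mon e = 0.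
Proof.
move=> ei; apply: (@prod_zero _ _ _ i); first by rewrite mem_index_enum.
rewrite -(subnKC ei) exprD -(iota_sub1X chA iota1 iotaM) iota_H ?subrr ?mul0r //.
by exists (g i).
Qed.

(** The combinations of monomials of degree at least [k] with all exponents less than
[p^n]; evaluating such monomials in sorted order gives a basis of [m^k]. *)
Definition bnd k (Q : MP) := forall e : multinom d, mcoeff e Q != 0 -> (k <= mdeg e)%N /\ forall i, (e i < p ^ n)%N.

Lemma bndD k P Q : bnd k P -> bnd k Q -> bnd k (P + Q).
Proof.
move=> hP hQ e; rewrite mcoeffD.
by have [->|/hP//] := eqVneq (mcoeff e P) 0; rewrite add0r => /hQ.
Qed.

Lemma bnd_trunc k P : P \is homog k -> exists2 Q, bnd k Q & ev Q = ev P.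
Proof.
move=> /dhomogP hP; pose ok (e : multinom d) := [forall i, (e i < p ^ n)%N].
exists (\sum_(e <- msupp P | ok e) mcoeff e P *: mpolyX K e).
  move=> e; rewrite (raddf_sum (mcoeff e)) /=.
  have [/andP[eP oke] _|ne] := boolP ((e \in msupp P) && ok e).
    by split; [rewrite -(hP _ eP)|exact/forallP].
  rewrite big_seq_cond big1 ?eqxx // => f /andP[fP okf].
  rewrite mcoeffZ mcoeffX; case: eqP => [fe|_]; last by rewrite mulr0.
  by move: ne; rewrite -fe fP okf.
rewrite ev_lin evE big_mkcond /=; apply: eq_bigr => e _.
case: ifPn => // /forallPn[i]; rewrite -leqNgt => ei.
by rewrite (mon_big ei) scaler0.
Qed.

(** Leading forms are removed one degree at a time until [m^k] vanishes. *)
Lemma span_bnd k x : pow k x -> exists2 Q, bnd k Q & x = ev Q.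
Proof.
have [k0 hk0] := m_nil.
suff h : forall j k x, (k0 - j <= k)%N -> pow k x -> exists2 Q, bnd k Q & x = ev Q.
  by apply: (h k0); rewrite subnn.
elim=> [|j IHj] {}k {}x kj hx.
  exists 0; first by move=> e; rewrite mcoeff0 eqxx.
  by rewrite ev0; apply: hk0; apply: (pow_le idm) hx; rewrite -(subn0 k0).
have [P [hP hxP]] := sex hx; have [Q hQ QE] := bnd_trunc hP.
have [|R hR RE] := IHj k.+1 (x - ev P) _ hxP; first by lia.
exists (Q + R); last by rewrite evD QE -RE addrC subrK.
by apply: bndD => // e /hR[ke hi]; split=> //; exact: ltnW.
Qed.

(** There are [p^(d n)] sorted monomials with exponents less than [p^n], they span,
and the dimension is at least the number [p^(d n)] of cosets of [H n]. *)
Lemma bnd_indep Q : bnd 0 Q -> ev Q = 0 -> Q = 0.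
Proof.
move=> hQ Q0; have [T [e [cT eI]]] := frame_cosets fr n.
pose F := {ffun 'I_d -> 'I_(p ^ n)}.
pose mn (a : F) : multinom d := Multinom [tuple (a i : nat) | i < d].
have mnE a i : mn a i = a i.
  exact: mnmE.
have mnI : injective mn.
  by move=> a a' aa; apply/ffunP => i; apply: val_inj; rewrite /= -!mnE aa.
have evbnd R : bnd 0 R -> ev R = \sum_a mcoeff (mn a) R *: mon (mn a).
  move=> hR; rewrite {1}(_ : R = \sum_a mcoeff (mn a) R *: mpolyX K (mn a)).
    by rewrite ev_lin.
  apply/mpolyP => f; rewrite (raddf_sum (mcoeff f)) /=.
  have [R0|/hR[_ fn]] := eqVneq (mcoeff f R) 0.
    rewrite R0 big1 // => a _; rewrite mcoeffZ mcoeffX.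
    by case: eqP => [->|]; rewrite ?R0 ?mul0r ?mulr0.
  pose a0 : F := [ffun i => Ordinal (fn i)].
  have a0f : mn a0 = f by apply/mnmP => i; rewrite mnE ffunE.
  rewrite (bigD1 a0) //= a0f mcoeffZ mcoeffX eqxx mulr1 big1 ?addr0 // => a aa0.
  rewrite mcoeffZ mcoeffX -a0f; case: eqP => [/mnI aE|_]; last by rewrite mulr0.
  by rewrite aE eqxx in aa0.
have [R hR RE] : exists2 R : T -> MP, (forall v, bnd 0 (R v)) & forall v, iota (e v) = ev (R v).
  have h v : exists R, bnd 0 R /\ iota (e v) = ev R.
    by have [|R hR RE] := @span_bnd 0 (iota (e v)); [|exists R].
  by have [R RP] := choice h; exists R => v; have [] := RP v.
pose M := \matrix_(v < #|T|, a < #|F|) mcoeff (mn (enum_val a)) (R (enum_val v)).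
have EM (u : 'rV[K]_#|T|) :
    \sum_a (u *m M) 0 (enum_rank a) *: mon (mn a) = \sum_v u 0 (enum_rank v) *: iota (e v).
  under [RHS]eq_bigr => v _ do rewrite RE evbnd // scaler_sumr.
  rewrite exchange_big /=; apply: eq_bigr => a _; rewrite mxE scaler_suml.
  rewrite (reindex_onto enum_rank enum_val) /= => [|v _]; last exact: enum_valK.
  apply: eq_big => v; first by rewrite enum_rankK eqxx.
  by rewrite !mxE !enum_rankK scalerA.
(* [M] expresses the independent group elements in the sorted monomials *)
have rf : row_free M.
  apply/inj_row_free => u uM0; apply/rowP => v; rewrite mxE -(enum_valK v).
  apply: (iota_free eI (c := fun v => u 0 (enum_rank v))); rewrite -EM uM0.
  by rewrite big1 // => a _; rewrite mxE scale0r.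
have cF : #|T| = #|F| by rewrite card_ffun !card_ord cT mulnC expnM.
have rfull : row_full M by rewrite /row_full -[X in _ == X]cF.
have [u uE] : exists u : 'rV[K]_#|T|, \row_a mcoeff (mn (enum_val a)) Q = u *m M.
  by apply/submxP; exact: submx_full.
have u0 : u = 0.
  apply/rowP => v; rewrite mxE -(enum_valK v).
  apply: (iota_free eI (c := fun v => u 0 (enum_rank v))); rewrite -EM -uE -[RHS]Q0 evbnd //.
  by apply: eq_bigr => a _; rewrite mxE enum_rankK.
apply/mpolyP => f; rewrite mcoeff0; have [//|/hQ[_ fn]] := eqVneq (mcoeff f Q) 0.
pose a0 : F := [ffun i => Ordinal (fn i)].
have <- : mn a0 = f by apply/mnmP => i; rewrite mnE ffunE.
by have /rowP/(_ (enum_rank a0)) := uE; rewrite u0 mul0mx !mxE enum_rankK.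
Qed.

(** Both [P] and its expansion in the basis of [m^(k+1)] have exponents less than
[p^n], so they coincide; but [P] has degree [k]. *)
Lemma level_indep k P : P \is homog k -> (k < p ^ n)%N -> pow k.+1 (ev P) -> P = 0.
Proof.
move=> /dhomogP hP kn /span_bnd[Q hQ PQ].
have PE : P = Q.
  apply/eqP; rewrite -subr_eq0; apply/eqP; apply: bnd_indep; last by rewrite evB PQ subrr.
  apply: bndD => e; last by rewrite mcoeffN oppr_eq0 => /hQ[_ h].
  rewrite -mcoeff_msupp => /hP /= ek; split=> // i; apply: leq_ltn_trans kn.
  by rewrite -ek mdegE (bigD1 i) //= leq_addr.
apply/mpolyP => e; rewrite mcoeff0; apply/eqP; apply/negPn/negP => Pe.
have := Pe; rewrite -mcoeff_msupp => /hP /= ek; move: Pe; rewrite PE => /hQ[].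
by rewrite ek ltnn.
Qed.

Definition pth (Q : MP) := forall e : multinom d, mcoeff e Q != 0 -> forall i, (p %| e i)%N.

Lemma pthD P Q : pth P -> pth Q -> pth (P + Q).
Proof.
move=> hP hQ e; rewrite mcoeffD.
by have [->|/hP//] := eqVneq (mcoeff e P) 0; rewrite add0r => /hQ.
Qed.

Lemma pthZ c Q : pth Q -> pth (c *: Q).
Proof. by move=> hQ e; rewrite mcoeffZ mulf_eq0 negb_or => /andP[_ /hQ]. Qed.

Lemma bndZ k c Q : bnd k Q -> bnd k (c *: Q).
Proof. by move=> hQ e; rewrite mcoeffZ mulf_eq0 negb_or => /andP[_ /hQ]. Qed.

(** Modulo [H n] the element [h] is a sorted product of powers of the [g_i^p], and
[g_i^(p a) = (1 + b_i^p)^a]. *)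
Lemma iota_pth h : powers G p h -> exists Q, [/\ pth Q, bnd 0 Q & iota h = ev Q].
Proof.
have [H1 HM HV] := frame_subgroup fr n.
rewrite -{1}(expn1 p) => /(sprod_approx fr n)[a]; rewrite add1n => ha.
have {ha} : H n ((sprod p g 1 a)^-1 * h)%g.
  by case: ha => w _ <-; exists (w ^+ p)%g => //; rewrite -expgM -expnS.
move=> /iota_H hE; have -> : iota h = iota (sprod p g 1 a).
  by rewrite -[h](mulKVg (sprod p g 1 a)) iotaM hE mulr1.
pose N := (\sum_i a i).+1.
have aN i : (a i < N)%N by rewrite ltnS /N (bigD1 i) //= leq_addr.
pose F (f : {ffun 'I_d -> 'I_N}) : multinom d := Multinom [tuple (p * f i)%N | i < d].
have FE f i : F f i = (p * f i)%N by exact: mnmE.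
pose c (f : {ffun 'I_d -> 'I_N}) : K := \prod_i ('C(a i, f i))%:R.
have -> : iota (sprod p g 1 a) = \sum_f c f *: mon (F f).
  rewrite /sprod expn1 (big_morph iota iotaM iota1).
  transitivity (\prod_(i < d) \sum_(j < N) (('C(a i, j))%:R : K) *: b i ^+ (p * j)).
    apply: eq_bigr => i _; rewrite expgM (iotaX iota1 iotaM).
    have -> : iota (g i ^+ p)%g = 1 + b i ^+ p.
      have := iota_sub1X chA iota1 iotaM (g i) 1; rewrite expn1 => <-.
      by rewrite addrC subrK.
    rewrite exprDn_comm; last exact: commr_sym (commr1 _).
    have -> : N = ((a i).+1 + (N - (a i).+1))%N by rewrite subnKC.
    rewrite big_split_ord /= -[LHS]addr0; congr (_ + _); last first.
      by rewrite big1 // => j _; rewrite bin_small ?scale0r // leq_addr.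
    apply: eq_bigr => j _; rewrite expr1n mul1r exprM.
    by rewrite scaler_nat.
  rewrite bigA_distr_bigA /=; apply: eq_bigr => f _; rewrite /c /mmap1.
  rewrite scaler_prod; congr (_ *: _).
  by apply: eq_bigr => i _; rewrite FE.
pose ok (e : multinom d) := [forall i, (e i < p ^ n)%N].
exists (\sum_(f | ok (F f)) c f *: mpolyX K (F f)); split.
- move=> e; rewrite (raddf_sum (mcoeff e)) /= => ne0 i; apply/negPn/negP => npe.
  move: ne0; rewrite big1 ?eqxx // => f _; rewrite mcoeffZ mcoeffX.
  by case: eqP => [fe|_]; rewrite ?mulr0 // -fe FE dvdn_mulr in npe *.
- move=> e; rewrite (raddf_sum (mcoeff e)) /= => ne0; split=> // i; rewrite ltnNge; apply/negP => npe.
  move: ne0; rewrite big1 ?eqxx // => f /forallP/(_ i) okf; rewrite mcoeffZ mcoeffX.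
  by case: eqP => [fe|_]; rewrite ?mulr0 //; move: okf; rewrite fe ltnNge npe.
- rewrite ev_lin [RHS]big_mkcond; apply: eq_bigr => f _.
  case: ifPn => // /forallPn[i]; rewrite -leqNgt => ei.
  by rewrite (mon_big ei) scaler0.
Qed.

(** The expansion of [x] in the basis, which shows that [x] lies in [m^k], is also the
one obtained from the elements of [G^p]. *)
Lemma span_pth k x (s : seq (K * G)) : (forall u, u \in s -> powers G p u.2) ->
  x = \sum_(u <- s) u.1 *: iota u.2 -> pow k x ->
  exists Q, [/\ pth Q, bnd k Q & x = ev Q].
Proof.
move=> sH xE /span_bnd[Q hQ xQ].
have [P [hP bP xP]] : exists P, [/\ pth P, bnd 0 P & x = ev P].
  rewrite xE big_seq; elim/big_rec: _ => [|u y us [P [hP bP ->]]].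
    exists 0; split; [| |by rewrite ev0]; by move=> e; rewrite mcoeff0 eqxx.
  have [R [hR bR ->]] := iota_pth (sH u us); exists (u.1 *: R + P); split.
  - by apply: pthD => //; exact: pthZ.
  - by apply: bndD => //; exact: bndZ.
  - by rewrite evD evZ.
exists Q; split=> //; suff -> : Q = P by [].
apply/eqP; rewrite -subr_eq0; apply/eqP; apply: bnd_indep; last by rewrite evB -xP -xQ subrr.
rewrite -scaleN1r; apply: bndD; last exact: bndZ.
by move=> e /hQ[_].
Qed.

End LevelBasis.

(** * The finite levels of the Iwasawa algebra *)

Section Levels.
Context (K : fieldType) (G : topGroupType).
Implicit Types N M : open_normal G.

Definition aug_level N : set (malg K (quotg N)) := [set f | maug f = 0].
Arguments aug_level N _ : clear implicits.

Lemma aug_level_ideal N : ideal (aug_level N).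
Proof.
split; first exact: maug0.
- by move=> f g /= f0 g0; rewrite /aug_level /= maugD f0 g0 addr0.
- by move=> f g /= g0; split; rewrite /aug_level /= maugM g0 ?mulr0 ?mul0r.
Qed.

Definition grp N (x : G) : malg K (quotg N) := msing (qclass N x) 1.

Lemma grp1 N : grp N 1%g = 1. Proof. by []. Qed.
Lemma grpM N x y : grp N (x * y)%g = grp N x * grp N y.
Proof. by rewrite /grp malgM_sing mulr1 qclassM. Qed.

Lemma grp_repr N (a : quotg N) c : msing a c = c *: grp N (qrepr a).
Proof. by rewrite /grp malgZ_sing mulr1 qclass_repr. Qed.

Lemma malg_grp N (f : malg K (quotg N)) :
  f = \sum_(a <- finsupp f) f a *: grp N (qrepr a).
Proof. by rewrite {1}[f]malg_expand; apply: eq_bigr => a _; rewrite grp_repr. Qed.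

Lemma grp_span N (x : malg K (quotg N)) :
  exists s : seq (K * G), x = \sum_(u <- s) u.1 *: grp N u.2.
Proof.
exists [seq (x a, qrepr a) | a <- finsupp x].
by rewrite big_map; exact: malg_grp.
Qed.

Lemma maugN N (f : malg K (quotg N)) : maug (- f) = - maug f.
Proof. by rewrite -scaleN1r maugZ mulN1r. Qed.

Lemma maug1 N : maug (1 : malg K (quotg N)) = 1.
Proof. exact: maug_sing. Qed.

Lemma aug_grp N x : aug_level N (grp N x - 1).
Proof. by rewrite /aug_level /= maugD maugN maug1 maug_sing subrr. Qed.

Lemma maug_sum N (f : malg K (quotg N)) : maug f = \sum_(a <- finsupp f) f a.
Proof. by []. Qed.

Lemma aug_span N x : aug_level N x ->
  exists s : seq (K * G), x = \sum_(u <- s) u.1 *: (grp N u.2 - 1).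
Proof.
move=> x0; exists [seq (x a, qrepr a) | a <- finsupp x]; rewrite big_map /=.
under eq_bigr => a _ do rewrite scalerBr.
by rewrite sumrB -malg_grp -scaler_suml -maug_sum x0 scale0r subr0.
Qed.

Lemma grp_kernel N x : on_set N x -> grp N x = 1.
Proof. by move=> Nx; congr msing; apply/qclassP; have [_ _ NV] := on_subgroup N; rewrite mulg1; exact: NV. Qed.

Lemma grp_free N (T : finType) (e : T -> G) :
  (forall v w, on_set N ((e v)^-1 * e w)%g -> v = w) ->
  forall c : T -> K, \sum_v c v *: grp N (e v) = 0 -> forall v, c v = 0.
Proof.
move=> eI c c0 v; have := congr1 (fun f : malg K (quotg N) => f (qclass N (e v))) c0.
rewrite /= malg_sumE malg0E (bigD1 v) //= big1 ?addr0 => [|w wv].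
  by rewrite malgZE msingE eqxx mulr1.
rewrite malgZE msingE; case: eqP => [/esym/qclassP/eI vw|]; last by rewrite mulr0.
by rewrite vw eqxx in wv.
Qed.

Lemma maug_push N M (f : malg K (quotg M)) : maug (mpush (@quot_map G M N) f) = maug f.
Proof.
elim/malg_ind: f => [|f1 f2 e1 e2|x c].
- by rewrite mpush0 !maug0.
- by rewrite mpushD !maugD e1 e2.
- by rewrite mpush_sing !maug_sing.
Qed.

Lemma push_grp N M x : M `<=` N -> mpush (@quot_map G M N) (grp M x) = grp N x.
Proof. by move=> sMN; rewrite mpush_sing quot_mapE. Qed.

(** The projections between levels are compatible with the augmentations. *)
Lemma push_pow N M k f : M `<=` N -> ideal_pow (aug_level M) k f ->
  ideal_pow (aug_level N) k (mpush (@quot_map G M N) f).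
Proof.
move=> sMN; elim: k f => [|k IHk] f //; move: f; apply: ideal_mul_ind.
- by rewrite mpush0; have [] := ideal_pow_ideal k.+1 (aug_level_ideal N).
- move=> x y hx hy; rewrite mpushD.
  by have [_ D _] := ideal_pow_ideal k.+1 (aug_level_ideal N); exact: D.
- move=> x y hx hy; rewrite (mpushM (quot_mapM sMN)); apply: ideal_mulP; first exact: IHk.
  by rewrite /aug_level /= maug_push.
Qed.

Program Definition onI N M : open_normal G := @OpenNormal G (on_set N `&` on_set M) _ _ _.
Next Obligation. by move=> N M; apply: openI; exact: on_open. Qed.
Next Obligation.
move=> N M; have [a b c] := on_subgroup N; have [a' b' c'] := on_subgroup M.
split=> [|x y [h1 h2] [h3 h4]|x [h1 h2]]; first by split.
  by split; [exact: b|exact: b'].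
by split; [exact: c|exact: c'].
Qed.
Next Obligation. by move=> N M x g [h1 h2]; split; exact: on_normal. Qed.

End Levels.

(** * The augmentation filtration and its levels *)

Section Omega.
Context (K : fieldType) (p d : nat) (G : topGroupType) (kap : G -> 'I_d -> K) (g : 'I_d -> G).
Hypotheses (p_char : p \in [pchar K]) (p_gt2 : (2 < p)%N) (fr : power_frame p kap g).
Local Notation H n := (powers G (p ^ n)).
Local Notation Om := (iwasawa K G).
Local Notation mO := (@aug_ideal K G).
Local Notation mN N := (@aug_level K G N).
Local Notation idO := (aug_ideal_ideal K G).
Local Notation idN N := (aug_level_ideal K N).
Local Notation homog k := (ishomog1 k mdeg).

Lemma H_normal n : is_normal (H n).
Proof. by move=> _ x [y _ <-]; exists (y ^ x)%g => //; rewrite conjXg. Qed.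

Definition level n : open_normal G :=
  OpenNormal (frame_open fr n) (frame_subgroup fr n) (@H_normal n).

Lemma level_nil N : exists k, ideal_pow (mN N) k `<=` [set 0].
Proof.
have [n sn] := frame_cofinal fr N.
have hH h : H n h -> grp K N h = 1 by move=> /sn; exact: grp_kernel.
exact: (m_nil p_char fr (@grp1 K G N) (@grpM K G N) (@grp_span K G N) (@aug_span K G N) hH).
Qed.

Lemma omD (x y : Om) N : (x + y) N = x N + y N. Proof. by []. Qed.
Lemma omN (x : Om) N : (- x) N = - x N. Proof. by []. Qed.
Lemma omM (x y : Om) N : (x * y) N = x N * y N. Proof. by []. Qed.
Lemma omZ c (x : Om) N : (c *: x) N = c *: x N. Proof. by []. Qed.
Lemma om0 N : (0 : Om) N = 0. Proof. by []. Qed.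
Lemma om_sum I (r : seq I) (P : pred I) (F : I -> Om) N :
  (\sum_(i <- r | P i) F i) N = \sum_(i <- r | P i) (F i) N.
Proof. by elim/big_rec2: _ => // i x y _ <-. Qed.
Lemma omX (x : Om) n N : (x ^+ n) N = x N ^+ n.
Proof. by elim: n => // n IHn; rewrite !exprS omM IHn. Qed.
Lemma om_prod I (r : seq I) (P : pred I) (F : I -> Om) N :
  (\prod_(i <- r | P i) F i) N = \prod_(i <- r | P i) (F i) N.
Proof. by elim/big_rec2: _ => // i x y _ <-. Qed.

Definition iw_elt (x : G) : Om :=
  @Iwasawa K G (fun N => grp K N x) (fun M N sMN => push_grp K x sMN).

Lemma iw_elt1 : iw_elt 1%g = 1. Proof. exact: iwP. Qed.
Lemma iw_eltM x y : iw_elt (x * y)%g = iw_elt x * iw_elt y.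
Proof. by apply: iwP => N; rewrite omM; exact: grpM. Qed.

(** The elements of [K[[G]]] which lie in the [k]-th power of the augmentation ideal at
each finite level. This is the closure of [m^k], and in fact equal to it ([powE]). *)
Definition lpow k : set Om := [set x | forall N, ideal_pow (mN N) k (x N)].

Lemma aug_om (x : Om) N : mO x <-> mN N (x N).
Proof.
rewrite /aug_ideal /= /iw_aug /aug_level /=.
have sN : N `<=` whole_group G by move=> y _; rewrite /whole_group; case: setT_open_normal.
by rewrite -(iw_compat x sN) maug_push; split.
Qed.

Lemma pow_lpow k : ideal_pow mO k `<=` lpow k.
Proof.
elim: k => [|k IHk] //; apply: ideal_mul_ind.
- by move=> N; rewrite om0; exact: pow0 (idN N) k.+1.
- by move=> x y hx hy N; rewrite omD; exact: (powD (idN N) (hx N) (hy N)).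
- move=> x y /IHk hx hy N; rewrite omM; apply: ideal_mulP; first exact: hx.
  exact/(aug_om y N).
Qed.

Lemma lpow_le k l : (k <= l)%N -> lpow l `<=` lpow k.
Proof. by move=> kl x hx N; exact: (pow_le (idN N) kl (hx N)). Qed.
Lemma lpow0 k : lpow k 0. Proof. by move=> N; exact: pow0 (idN N) k. Qed.
Lemma lpowD k x y : lpow k x -> lpow k y -> lpow k (x + y).
Proof. by move=> hx hy N; exact: (powD (idN N) (hx N) (hy N)). Qed.
Lemma lpowN k x : lpow k x -> lpow k (- x).
Proof. by move=> hx N; rewrite omN; exact: (powN (idN N) (hx N)). Qed.
Lemma lpowB k x y : lpow k x -> lpow k y -> lpow k (x - y).
Proof. by move=> hx hy; apply: lpowD => //; exact: lpowN. Qed.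
Lemma lpow_sum k I (r : seq I) (P : pred I) (F : I -> Om) :
  (forall i, P i -> lpow k (F i)) -> lpow k (\sum_(i <- r | P i) F i).
Proof. by move=> hF; elim/big_ind: _ => //; [exact: lpow0|exact: lpowD]. Qed.
Lemma lpowM k l x y : lpow k x -> lpow l y -> lpow (k + l) (x * y).
Proof. by move=> hx hy N; exact: (powM (idN N) (hx N) (hy N)). Qed.

Lemma lpow_sep x : (forall k, lpow k x) -> x = 0.
Proof.
move=> hx; apply: iwP => N; have [k hk] := level_nil N.
by rewrite om0; apply: hk; exact: hx.
Qed.

Lemma lift_level N (y : malg K (quotg N)) : exists x : Om, x N = y.
Proof.
have [s ->] := grp_span y; exists (\sum_(u <- s) u.1 *: iw_elt u.2).
by rewrite om_sum.
Qed.

(** The projection to a level is onto, hence so is its restriction to the powers of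
the augmentation ideals. *)
Lemma lift_pow N k y : ideal_pow (mN N) k y -> exists2 x, ideal_pow mO k x & x N = y.
Proof.
elim: k y => [|k IHk] y; first by move=> _; have [x <-] := lift_level y; exists x.
move: y; apply: ideal_mul_ind.
- by exists 0 => //; exact: pow0 idO k.+1.
- by move=> x y [x' hx <-] [y' hy <-]; exists (x' + y') => //; exact: (powD idO hx hy).
- move=> x y /IHk[x' hx <-] hy; have [y' yE] := lift_level y.
  exists (x' * y'); last by rewrite omM yE.
  by apply: ideal_mulP => //; apply/(aug_om y' N); rewrite yE.
Qed.

(** The kernel of the projection to the level [n] is generated by the elements
[h - 1] with [h = w^(p^n)], and [w^(p^n) - 1 = (w - 1)^(p^n)]. *)
Lemma kernel_level n (x : Om) : x (level n) = 0 -> lpow (p ^ n) x.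
Proof.
move=> x0 N; pose M := onI N (level n).
have sMN : M `<=` N by move=> y [].
have sMn : M `<=` level n by move=> y [].
rewrite -(iw_compat x sMN); apply: push_pow => //.
(* compare [f] with a lift of its image in [K[G / H n]] *)
suff h f : ideal_pow (mN M) (p ^ n) (f -
    mpush (fun a : quotg (level n) => qclass M (qrepr a)) (mpush (@quot_map G M (level n)) f)).
  by have := h (x M); rewrite (iw_compat x sMn) x0 mpush0 subr0.
have idM := idN M.
elim/malg_ind: f => [|f1 f2 h1 h2|a c].
- by rewrite !mpush0 subr0; exact: pow0.
- by rewrite [mpush (quot_map _) (f1 + f2)]mpushD [mpush _ (_ + _)]mpushD opprD addrACA; exact: (powD idM h1 h2).
rewrite !mpush_sing !grp_repr -scalerBr; apply: (powZ idM).
set y := qrepr a; rewrite -[a in quot_map _ a]qclass_repr -/y quot_mapE //.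
set z := qrepr (qclass (level n) y).
have : on_set (level n) (z^-1 * y)%g by apply/qclassP; exact: qclass_repr.
move=> [w _ wE].
have -> : grp K M (qrepr (qclass M z)) = grp K M z by rewrite /grp qclass_repr.
rewrite -(mulKVg z y) grpM -{2}[grp K M z]mulr1 -mulrBr -wE; apply: (powMl idM).
exact: (pow_powers p_char (@grp1 K G M) (@grpM K G M) idM (@aug_grp K G M)).
Qed.

(** Membership in [lpow k] can be tested at one single level which is deep
enough. *)
Lemma level_lpow n k (x : Om) : (k <= p ^ n)%N -> ideal_pow (mN (level n)) k (x (level n)) -> lpow k x.
Proof.
move=> kn /lift_pow[y hy yE]; rewrite -(subrK y x); apply: lpowD; last exact: pow_lpow.
by apply: (lpow_le kn); apply: kernel_level; rewrite omD omN yE subrr.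
Qed.

Lemma ltn_pexp k : (k < p ^ k)%N.
Proof. by apply: ltn_expl; exact: ltnW. Qed.

(** At each level the terms of the series vanish from some index on, because the
augmentation ideal of the level is nilpotent. *)
Lemma lpow_series k (u : nat -> Om) : (forall s, lpow (k + s) (u s)) ->
  exists2 y, lpow k y & forall S, lpow (k + S) (y - \sum_(s < S) u s).
Proof.
move=> hu; have [kN kNP] := choice level_nil.
have tail N S T : (kN N <= S)%N -> (S <= T)%N ->
    (\sum_(s < T) u s) N = (\sum_(s < S) u s) N.
  move=> NS ST; rewrite !om_sum -!(big_mkord xpredT (fun s => u s N)).
  rewrite (big_cat_nat (leq0n S) ST) //= -[RHS]addr0; congr (_ + _).
  rewrite big_nat_cond big1 // => s /andP[/andP[Ss _] _].
  apply: kNP; apply: (pow_le (idN N)) (hu s N); lia.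
have compat (M N : open_normal G) : M `<=` N -> mpush (@quot_map G M N) ((\sum_(s < kN M) u s) M) = (\sum_(s < kN N) u s) N.
  move=> sMN; pose T := maxn (kN M) (kN N).
  rewrite -(@tail M _ T) ?leq_maxl // -(@tail N _ T) ?leq_maxr //.
  exact: iw_compat.
pose y := @Iwasawa K G (fun N => (\sum_(s < kN N) u s) N) compat.
have yS S : lpow (k + S) (y - \sum_(s < S) u s).
  move=> N; rewrite omD omN -[y N]/((\sum_(s < kN N) u s) N).
  have [SN|NS] := leqP (kN N) S; first by rewrite (tail N _ _ _ SN) // subrr; exact: pow0 (idN N) _.
  rewrite !om_sum -!(big_mkord xpredT (fun s => u s N)) (big_cat_nat (leq0n S) (ltnW NS)) //= addrAC subrr add0r.
  rewrite big_nat_cond; apply: (pow_sum (idN N)) => s /andP[/andP[Ss _] _].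
  by apply: (pow_le (idN N)) (hu s N); rewrite leq_add2l.
exists y => //; have := yS 0%N; by rewrite big_ord0 subr0 addn0.
Qed.

Local Notation bO := (fun i => iw_elt (g i) - 1).

Lemma lpow_step j (x : Om) : lpow j.+1 x ->
  exists2 X : 'I_d -> Om, (forall i, lpow j (X i)) & lpow j.+2 (x - \sum_i X i * bO i).
Proof.
move=> hx; pose n := j.+2; pose N := level n.
have [X hX hXx] : exists2 X : 'I_d -> malg K (quotg N), (forall i, ideal_pow (mN N) j (X i)) &
    ideal_pow (mN N) j.+2 (x N - \sum_i X i * (grp K N (g i) - 1)).
  have := hx N; move: (x N); apply: ideal_mul_ind.
  - exists (fun=> 0) => [i|]; first exact: pow0 (idN N) _.
    by rewrite big1 ?subr0 => [|i _]; [exact: pow0 (idN N) _|rewrite mul0r].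
  - move=> y z [Y hY hYy] [Z hZ hZz]; exists (fun i => Y i + Z i) => [i|]; first exact: (powD (idN N)).
    under eq_bigr => i _ do rewrite mulrDl.
    by rewrite big_split opprD addrACA; exact: (powD (idN N)).
  - move=> y z hy hz.
    have [c hc] := gen_A p_char p_gt2 fr (@grp1 K G N) (@grpM K G N) (idN N) (@aug_grp K G N) (@aug_span K G N) hz.
    exists (fun i => c i *: y) => [i|]; first exact: (powZ (idN N)).
    under eq_bigr => i _ do rewrite -scalerAl scalerAr.
    by rewrite -mulr_sumr -mulrBr -addn2; exact: (powM (idN N)).
have lft i : exists y : Om, lpow j y /\ y N = X i.
  by have [y hy yE] := lift_pow (hX i); exists y; split=> //; exact: pow_lpow.
have [Y YP] := choice lft; exists Y => [i|]; first by have [] := YP i.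
apply: (@level_lpow n); first exact: ltnW (ltn_pexp _).
rewrite omD omN om_sum; under eq_bigr => i _ do rewrite omM (YP i).2.
exact: hXx.
Qed.

(** Iterating [lpow_step] writes an element [x] of [lpow (k+1)] as [\sum_i Y_i b_i],
where each [Y_i] is the sum of a convergent series in [lpow k]. *)
Lemma lpow_pow k : lpow k `<=` ideal_pow mO k.
Proof.
elim: k => [|k IHk] // x hx.
have stepE : forall u : nat * Om, exists X : 'I_d -> Om, lpow u.1.+1 u.2 ->
    (forall i, lpow u.1 (X i)) /\ lpow u.1.+2 (u.2 - \sum_i X i * bO i).
  move=> [j y] /=; have [hy|ny] := pselect (lpow j.+1 y); last by exists (fun=> 0).
  by have [X hX hXy] := lpow_step hy; exists X.
have [X XP] := choice stepE.
pose f := fix f s := if s is s'.+1 then f s' - \sum_i X ((k + s')%N, f s') i * bO i else x.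
have fP s : lpow (k + s).+1 (f s).
  elim: s => [|s IHs]; first by rewrite addn0.
  by rewrite addnS; have [_] := XP ((k + s)%N, f s) IHs.
have XO i s : lpow (k + s) (X ((k + s)%N, f s) i) by have [h _] := XP ((k + s)%N, f s) (fP s).
have [Y YP] : exists Y : 'I_d -> Om, forall i, lpow k (Y i) /\
    forall S, lpow (k + S) (Y i - \sum_(s < S) X ((k + s)%N, f s) i).
  have h i : exists y, lpow k y /\ forall S, lpow (k + S) (y - \sum_(s < S) X ((k + s)%N, f s) i).
    by have [y h1 h2] := lpow_series (XO i); exists y.
  by have [Y YP] := choice h; exists Y.
have fE S : x - f S = \sum_i (\sum_(s < S) X ((k + s)%N, f s) i) * bO i.
  elim: S => [|S IHS]; first by rewrite subrr big1 // => i _; rewrite big_ord0 mul0r.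
  under eq_bigr => i _ do rewrite big_ord_recr /= mulrDl.
  by rewrite big_split /= -IHS opprB addrA addrAC.
have -> : x = \sum_i Y i * bO i.
  apply/eqP; rewrite -subr_eq0; apply/eqP; apply: lpow_sep => S.
  rewrite -(subrK (f S) x) fE addrAC -sumrB; apply: lpowD; last first.
    by apply: lpow_le (fP S); lia.
  apply: lpow_sum => i _; rewrite -mulrBl -[X in X * _]opprB mulNr; apply: lpowN.
  apply: (@lpow_le _ (k + S + 0)); first lia.
  by apply: lpowM => //; have [_] := YP i.
apply: (pow_sum idO) => i _; apply: ideal_mulP; first by apply: IHk; have [] := YP i.
by apply/(aug_om _ (whole_group G)); exact: aug_grp.
Qed.

Lemma powE k x : ideal_pow mO k x <-> lpow k x.
Proof. by split; [exact: pow_lpow|exact: lpow_pow]. Qed.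

Lemma iw_elt_aug x : mO (iw_elt x - 1).
Proof. by apply/(aug_om _ (whole_group G)); exact: aug_grp. Qed.

Lemma aug_O (x : Om) : exists c : K, mO (x - c *: 1).
Proof.
have [c hc] := aug_A (@grp_span K G (whole_group G)) (idN (whole_group G)) (@aug_grp K G _) (x (whole_group G)).
by exists c; apply/(aug_om _ (whole_group G)).
Qed.

Lemma gen_O (x : Om) : mO x -> exists c : 'I_d -> K, ideal_pow mO 2 (x - \sum_i c i *: bO i).
Proof.
move=> hx; pose N := level 1; have hN := (aug_om x N).1 hx.
have [c hc] := gen_A p_char p_gt2 fr (@grp1 K G N) (@grpM K G N) (idN N) (@aug_grp K G N) (@aug_span K G N) hN.
exists c; apply/powE; apply: (@level_lpow 1); first by rewrite expn1; exact: ltnW.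
by rewrite omD omN om_sum.
Qed.

Lemma comm_O (x y : Om) : mO x -> mO y -> ideal_pow mO 3 (x * y - y * x).
Proof.
move=> hx hy; apply/powE => N; rewrite omD omN !omM.
apply: (comm_A p_char p_gt2 fr (@grp1 K G N) (@grpM K G N) (idN N) (@aug_grp K G N) (@aug_span K G N)).
  exact/aug_om.
exact/aug_om.
Qed.

Lemma ev_level N P : (ev bO P) N = ev (fun i => grp K N (g i) - 1) P.
Proof.
rewrite !evE om_sum; apply: eq_bigr => e _; rewrite omZ; congr (_ *: _).
by rewrite /mmap1 om_prod; apply: eq_bigr => i _; rewrite omX.
Qed.

Lemma grp_level_free n (T : finType) (e : T -> G) :
  (forall v w, H n ((e v)^-1 * e w)%g -> v = w) ->
  forall c : T -> K, \sum_v c v *: grp K (level n) (e v) = 0 -> forall v, c v = 0.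
Proof. by move=> hI; exact: (@grp_free K G (level n) T e hI). Qed.

(** Tested at the level [k], where [k < p^k] leaves all monomials of degree [k] in
the basis. *)
Lemma indep_O k P : P \is homog k -> ideal_pow mO k.+1 (ev bO P) -> P = 0.
Proof.
move=> hP /powE/(_ (level k)); rewrite ev_level.
apply: (level_indep p_char p_gt2 fr (@grp1 K G _) (@grpM K G _) (@grp_span K G _) (idN _)
  (@aug_grp K G _) (@aug_span K G _) (n := k)) => //; last exact: ltn_pexp.
  by move=> h hh; exact: grp_kernel.
exact: grp_level_free.
Qed.

(** The filtration which [K[[G]]] induces on [K[[G^p]]]: symbols of elements of
[K[[G^p]]] are forms in the [p]-th powers of the variables. *)
Lemma sub_sym k (x : Om) : iw_sub (powers G p) x -> ideal_pow mO k x ->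
  exists2 P, pth p P & sym mO bO k x P.
Proof.
move=> hx /powE hk; pose n := k.+1; pose N := level n.
have [Q [pQ bQ xQ]] : exists Q, [/\ pth p Q, bnd p n k Q & x N = ev (fun i => grp K N (g i) - 1) Q].
  pose s := [seq (x N a, if pselect (exists2 h, powers G p h & a = qclass N h) is left ex
     then projT1 (cid2 ex) else 1%g) | a <- finsupp (x N)].
  apply: (span_pth p_char p_gt2 fr (@grp1 K G _) (@grpM K G _) (@grp_span K G _) (idN _)
    (@aug_grp K G _) (@aug_span K G _) (n := n) _ _ (s := s)) => //.
  - by move=> h hh; exact: grp_kernel.
  - exact: grp_level_free.
  - move=> u /mapP[a ax ->] /=; case: pselect => [ex|]; first by case: (cid2 ex).
    by case; apply: hx; rewrite mem_finsupp in ax.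
  - rewrite big_map [LHS]malg_grp big_seq [RHS]big_seq; apply: eq_bigr => a ax /=.
    congr (_ *: _); case: pselect => [ex|]; last by case; apply: hx; rewrite mem_finsupp in ax.
    by case: (cid2 ex) => h hh /= ->; rewrite /grp qclass_repr.
pose P := \sum_(e <- msupp Q | mdeg e == k) mcoeff e Q *: mpolyX K e.
have PE f : mcoeff f P = if mdeg f == k then mcoeff f Q else 0.
  rewrite /P (raddf_sum (mcoeff f)) /=.
  case: ifPn => fk; last first.
    rewrite big1 // => e /eqP ek; rewrite mcoeffZ mcoeffX; case: eqP => [ef|]; last by rewrite mulr0.
    by rewrite -ef ek eqxx in fk.
  have [fQ|fQ] := boolP (f \in msupp Q).
    rewrite -big_filter (bigD1_seq f) ?filter_uniq ?msupp_uniq ?mem_filter ?fk //= mcoeffZ mcoeffX eqxx mulr1.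
    by rewrite big1 ?addr0 // => e /negPf ef; rewrite mcoeffZ mcoeffX ef mulr0.
  rewrite (memN_msupp_eq0 fQ) big_seq_cond big1 // => e /andP[eQ _].
  rewrite mcoeffZ mcoeffX; case: eqP => [ef|]; last by rewrite mulr0.
  by rewrite -ef eQ in fQ.
(* [P] is the component of degree [k] of the expansion [Q] of [x N] *)
exists P.
  by move=> e; rewrite PE; case: ifP => _; [exact: pQ|rewrite eqxx].
split.
  by apply/dhomogP => e; rewrite mcoeff_msupp PE; case: ifP => [/eqP//|_]; rewrite eqxx.
apply/powE; apply: (@level_lpow n); first exact: ltnW (ltn_pexp _).
rewrite omD omN ev_level xQ -evB evE big_seq.
apply: (pow_sum (idN N)) => e; rewrite mcoeff_msupp mcoeffB PE => ne0; apply: (powZ (idN N)).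
apply: (pow_le (idN N)) (pow_mon (idN N) (b_in g (@aug_grp K G N)) e).
move: ne0; case: ifP => [_|/negbT/eqP ek]; first by rewrite subrr eqxx.
rewrite subr0 => /bQ[ke _]; lia.
Qed.

End Omega.

(** * The associated graded ring is a polynomial ring *)

Section Symbols.
Context (K : fieldType) (A : algType K) (F : filtration A).

Lemma grpi0 : grpi (0 : rees F) = 0.
Proof. by apply: (addrI (grpi (0 : rees F))); rewrite -grpiD !addr0. Qed.

Lemma grpiM (u v : rees F) : grpi (u * v) = grpi u * grpi v.
Proof. by rewrite -gr_mulE. Qed.

Lemma grpi_sum I (r : seq I) (P : pred I) (E : I -> rees F) :
  grpi (\sum_(i <- r | P i) E i) = \sum_(i <- r | P i) grpi (E i).
Proof. by elim/big_rec2: _ => [|i x y _ <-]; rewrite ?grpi0 // grpiD. Qed.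

Lemma rees_inj (u v : rees F) : rees_val u = rees_val v -> u = v.
Proof. exact: val_inj. Qed.

Lemma rees_valD (u v : rees F) : rees_val (u + v) = rees_val u + rees_val v.
Proof. exact: (raddfD (val : rees F -> _)). Qed.

Lemma rees_valM (u v : rees F) : rees_val (u * v) = rees_val u * rees_val v.
Proof. exact: (rmorphM (val : rees F -> _)). Qed.

Lemma rees_val_sum I (r : seq I) (P : pred I) (E : I -> rees F) :
  rees_val (\sum_(i <- r | P i) E i) = \sum_(i <- r | P i) rees_val (E i).
Proof. exact: (raddf_sum (val : rees F -> _)). Qed.

Lemma symbD n x y : F n x -> F n y -> symb F n (x + y) = symb F n x + symb F n y.
Proof.
move=> Fx Fy; have [u -> uE] := symbE Fx; have [v -> vE] := symbE Fy.
have [w -> wE] := symbE (filD Fx Fy); rewrite -grpiD; congr grpi.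
by apply: rees_inj; rewrite rees_valD wE uE vE msingD.
Qed.

Lemma symbM n k x y : F n x -> F k y -> symb F n x * symb F k y = symb F (n + k) (x * y).
Proof.
move=> Fx Fy; have [u -> uE] := symbE Fx; have [v -> vE] := symbE Fy.
have [w -> wE] := symbE (filM Fx Fy); rewrite -grpiM; congr grpi.
by apply: rees_inj; rewrite rees_valM wE uE vE malgM_sing.
Qed.

Lemma symb1 : symb F 0 1 = 1.
Proof. by have [u -> uE] := symbE (fil1 F); congr grpi; apply: rees_inj; rewrite uE. Qed.

Lemma gr_expand (u : rees F) :
  grpi u = \sum_(k <- finsupp (rees_val u)) symb F k (rees_val u k).
Proof.
have h (k : zmon) : exists w : rees F, symb F k (rees_val u k) = grpi w /\
    rees_val w = msing k (rees_val u k).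
  by have [w e1 e2] := symbE (rees_fil u k); exists w.
have [w wP] := choice h.
under eq_bigr => k _ do rewrite (wP k).1.
rewrite -grpi_sum; congr grpi; apply: rees_inj.
rewrite rees_val_sum {1}(malg_expand (rees_val u)).
by apply: eq_bigr => k _; rewrite (wP k).2.
Qed.

(** The homogeneous components of an element of the graded ring are unique. *)
Lemma symb_sum_eq0 I (r : seq I) (n : I -> int) (x : I -> A) :
  (forall i, F (n i) (x i)) -> \sum_(i <- r) symb F (n i) (x i) = 0 ->
  forall k : int, F (k - 1) (\sum_(i <- r | n i == k) x i).
Proof.
move=> hx; have h i : exists w : rees F, symb F (n i) (x i) = grpi w /\
    rees_val w = msing (n i : zmon) (x i).
  by have [w e1 e2] := symbE (hx i); exists w.
have [w wP] := choice h.
under eq_bigr => i _ do rewrite (wP i).1.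
rewrite -grpi_sum -grpi0 => /grpiP; rewrite subr0 => /rees_idealP hw k.
have := hw k; rewrite rees_val_sum malg_sumE.
rewrite [X in F _ X -> _](_ : _ = \sum_(i <- r | n i == k) x i) //.
by rewrite [RHS]big_mkcond /=; apply: eq_bigr => i _; rewrite (wP i).2 msingE eq_sym.
Qed.

End Symbols.

Section GradedIso.
Context (K : fieldType) (p d : nat) (G : topGroupType) (kap : G -> 'I_d -> K) (g : 'I_d -> G).
Hypotheses (p_char : p \in [pchar K]) (p_gt2 : (2 < p)%N) (fr : power_frame p kap g).
Local Notation mO := (@aug_ideal K G).
Local Notation idO := (aug_ideal_ideal K G).
Local Notation MP := (mpoly d K).
Local Notation homog k := (ishomog1 k mdeg).
Local Notation bO := (fun i => iw_elt K (g i) - 1).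
Local Notation F := (iw_filtration K G).
Local Notation ev := (ev (K := K) bO).
Local Notation sym := (sym mO bO).
Local Notation pi k P := (pihomog mdeg k P).
Local Notation "-: k" := (- (Posz k)) (at level 10).

Lemma bO_in i : mO (bO i).
Proof. exact: iw_elt_aug. Qed.

Lemma filE k x : F (-: k) x <-> ideal_pow mO k x.
Proof. by case: k. Qed.

Lemma filE1 k x : F (-: k - 1) x <-> ideal_pow mO k.+1 x.
Proof. by rewrite -opprD -PoszD addn1 filE. Qed.

Lemma symb_pos n x : 0 < n -> symb F n x = 0.
Proof. by case: n => [[|n]|n] // _; apply: symb_low; rewrite -addn1 PoszD addrK. Qed.

(** The isomorphism of [K[X_1, ..., X_d]] with [gr K[[G]]] which maps [X_i] to the symbol of
[g_i - 1]. *)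
Definition gr_poly (P : MP) : gr F := \sum_(k < msize P) symb F (-: k) (ev (pi k P)).

Lemma gr_polywE N P : (msize P <= N)%N -> gr_poly P = \sum_(k < N) symb F (-: k) (ev (pi k P)).
Proof.
move=> PN; rewrite /gr_poly -!(big_mkord xpredT (fun k => symb F (-: k) (ev (pi k P)))).
rewrite (big_cat_nat (leq0n _) PN) /= -[LHS]addr0; congr (_ + _).
rewrite big_nat_cond big1 // => k /andP[/andP[Pk _] _].
rewrite (_ : pi k P = 0) ?ev0 ?symb0 // pihomogE big_seq_cond big1 // => e /andP[eP /eqP ek].
by have := msize_mdeg_lt eP; rewrite /= in ek; rewrite ek ltnNge Pk.
Qed.

Lemma pi_fil k P : F (-: k) (ev (pi k P)).
Proof. by apply/filE; apply: (pow_ev idO bO_in); exact: pihomogP. Qed.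

Lemma gr_polyD P Q : gr_poly (P + Q) = gr_poly P + gr_poly Q.
Proof.
pose N := maxn (msize (P + Q)) (maxn (msize P) (msize Q)).
rewrite !(@gr_polywE N) /N ?leq_maxl // ?leq_max ?leqnn ?orbT // -big_split; apply: eq_bigr => k _ /=.
by rewrite pihomogD evD symbD //; exact: pi_fil.
Qed.

Lemma gr_poly0 : gr_poly 0 = 0.
Proof. by apply: (addrI (gr_poly 0)); rewrite -gr_polyD !addr0. Qed.

Lemma gr_polyN P : gr_poly (- P) = - gr_poly P.
Proof. by apply: (addrI (gr_poly P)); rewrite -gr_polyD !subrr gr_poly0. Qed.

Lemma gr_poly_sum I (r : seq I) (C : pred I) (E : I -> MP) :
  gr_poly (\sum_(i <- r | C i) E i) = \sum_(i <- r | C i) gr_poly (E i).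
Proof. by elim/big_rec2: _ => [|i x y _ <-]; rewrite ?gr_poly0 // gr_polyD. Qed.

Lemma gr_poly_homog k P : P \is homog k -> gr_poly P = symb F (-: k) (ev P).
Proof.
move=> hP; rewrite (@gr_polywE (maxn (msize P) k.+1)) ?leq_maxl //.
have kN : (k < maxn (msize P) k.+1)%N by rewrite leq_maxr.
rewrite (bigD1 (Ordinal kN)) //= pihomog_dE // big1 ?addr0 // => j jk.
by rewrite (pihomog_ne0 _ hP) ?ev0 ?symb0 // eq_sym.
Qed.

Lemma gr_poly_sym k x P : sym k x P -> gr_poly P = symb F (-: k) x.
Proof.
move=> sx; have xk := sym_pow idO bO_in sx; case: sx => hP hx; rewrite (gr_poly_homog hP).
apply: symb_eq; [by apply/filE; exact: (pow_ev idO bO_in)|exact/filE|].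
by apply/filE1; rewrite -opprB; exact: (powN idO).
Qed.

Lemma symOM k l x y P Q : sym k x P -> sym l y Q -> sym (k + l) (x * y) (P * Q).
Proof. exact: (symM idO bO_in (@aug_O K G) (comm_O p_char p_gt2 fr)). Qed.

Lemma sym_monom c e : sym (mdeg e) (ev (c *: mpolyX K e)) (c *: mpolyX K e).
Proof.
split; last by rewrite subrr; exact: pow0 idO _.
by apply: dhomogZ; rewrite dhomogX.
Qed.

(** On monomials it holds because sorting a product does not change its symbol. *)
Lemma gr_polyM P Q : gr_poly (P * Q) = gr_poly P * gr_poly Q.
Proof.
elim/mpolyind: P => [|c e P _ _ IHP]; first by rewrite mul0r gr_poly0 mul0r.
rewrite mulrDl !gr_polyD mulrDl IHP; congr (_ + _).
elim/mpolyind: Q {IHP} => [|c' f Q _ _ IHQ]; first by rewrite mulr0 gr_poly0 mulr0.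
rewrite mulrDr !gr_polyD mulrDr IHQ; congr (_ + _).
have s1 := sym_monom c e; have s2 := sym_monom c' f.
rewrite (gr_poly_sym s1) (gr_poly_sym s2) symbM; last 2 first.
- by apply/filE; exact: (sym_pow idO bO_in s1).
- by apply/filE; exact: (sym_pow idO bO_in s2).
have e12 : -: (mdeg e + mdeg f) = -: (mdeg e) + -: (mdeg f) by rewrite PoszD opprD.
by rewrite -e12 (gr_poly_sym (symOM s1 s2)).
Qed.

Lemma gr_poly1 : gr_poly 1 = 1.
Proof. by rewrite (gr_poly_sym (sym1 idO bO)) symb1. Qed.

Lemma gr_polyX P n : gr_poly (P ^+ n) = gr_poly P ^+ n.
Proof. by elim: n => [|n IHn]; rewrite ?gr_poly1 // !exprS gr_polyM IHn. Qed.

(** The homogeneous components of a polynomial with image zero have symbol zero,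
and they vanish by [indep_O]. *)
Lemma gr_poly_inj : injective gr_poly.
Proof.
suff h P : gr_poly P = 0 -> P = 0.
  by move=> P Q PQ; apply/eqP; rewrite -subr_eq0; apply/eqP/h; rewrite gr_polyD gr_polyN PQ subrr.
rewrite /gr_poly => P0; rewrite (@pihomog_partitionE _ _ mdeg (msize P) P) // big1 // => k _.
apply: (indep_O p_char p_gt2 fr (k := k)); first exact: pihomogP.
apply/filE1; have := symb_sum_eq0 (n := fun i : 'I_(msize P) => -: i)
  (fun i => pi_fil i P) P0 (-: k).
rewrite (bigD1 k) //= big1 ?addr0 // => j /andP[/eqP jk /eqP].
by case; apply: val_inj => /=; lia.
Qed.

Lemma symb_sym n x : F n x -> exists2 P, symb F n x = gr_poly P & n <= 0 -> sym `|n|%N x P.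
Proof.
have [n0 _|n0 hx] := ltP 0 n.
  by exists 0 => //; rewrite symb_pos // gr_poly0.
have nE : n = -: `|n|%N by lia.
move: hx; rewrite {1}nE => /filE hx.
have [P sP] := sym_ex idO bO_in (@aug_O K G) (gen_O p_char p_gt2 fr) (comm_O p_char p_gt2 fr) hx.
by exists P => // ; rewrite (gr_poly_sym sP) -nE.
Qed.

Lemma gr_poly_surj b : exists P, b = gr_poly P.
Proof.
rewrite -(grpi_repr b) gr_expand; elim/big_rec: _ => [|k y _ [P ->]]; first by exists 0; rewrite gr_poly0.
have [Q -> _] := symb_sym (rees_fil (qrepr b) k).
by exists (Q + P); rewrite gr_polyD.
Qed.

Lemma homogeneous_gr_poly b : homogeneous b -> exists k P, [/\ b = gr_poly P & P \is homog k].
Proof.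
case=> n [x [hx ->]]; have [n0|n0] := ltP 0 n.
  by exists 0%N, 0; rewrite symb_pos // gr_poly0; split=> //; exact: dhomog0.
by have [P -> /(_ n0)[hP _]] := symb_sym hx; exists `|n|%N, P.
Qed.

Lemma iw_filtered : filtered_algebra F.
Proof.
split=> [x|x hx]; first by exists 0.
by apply: (lpow_sep p_char fr) => k; apply/(powE p_char p_gt2 fr)/filE.
Qed.

(** A Cauchy sequence has a subsequence whose increments form a series as in
[lpow_series]. *)
Lemma iw_complete : complete_filtration F.
Proof.
move=> u hu.
have hu' k : exists M, forall i j, (M <= i)%N -> (M <= j)%N -> lpow k (u i - u j).
  have [M hM] := hu (-: k); exists M => i j hi hj.
  by apply/(powE p_char p_gt2 fr)/filE; exact: hM.
have [M0 M0P] := choice hu'.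
pose M s := (\sum_(i < s.+1) M0 i)%N.
have MP' s i j : (M s <= i)%N -> (M s <= j)%N -> lpow s (u i - u j).
  have M0s : (M0 s <= M s)%N by rewrite /M big_ord_recr leq_addl.
  by move=> hi hj; apply: M0P; exact: leq_trans M0s _.
have Mmono s t : (s <= t)%N -> (M s <= M t)%N.
  move=> /subnK <-; elim: (t - s)%N => // n IHn; apply: leq_trans IHn _.
  by rewrite addSn /M [X in (_ <= X)%N]big_ord_recr leq_addr.
pose v s := u (M s.+1) - u (M s).
have hv s : lpow (0 + s) (v s) by apply: MP' => //; exact: Mmono.
have [y _ yP] := lpow_series p_char p_gt2 fr hv.
have tel S : \sum_(s < S) v s = u (M S) - u (M 0%N).
  elim: S => [|S IHS]; first by rewrite big_ord0 subrr.
  by rewrite big_ord_recr /= IHS /v addrC addrA subrK.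
exists (y + u (M 0%N)) => n; exists (M `|n|%N) => i hi.
apply: (@fil_incr _ _ F (-: `|n|%N)); first by lia.
apply/filE/(powE p_char p_gt2 fr).
have -> : u i - (y + u (M 0%N)) = (u i - u (M `|n|%N)) - (y - \sum_(s < `|n|%N) v s).
  by rewrite tel opprB -[X in _ = _ + X]addrA subrKA opprD [- y - _]addrC.
apply: lpowB; first by apply: MP' => //.
by have := yP `|n|%N.
Qed.

End GradedIso.

(** * The basis theorem of Hilbert *)

Section Noetherian.

Lemma monotone_subsequence (u : nat -> nat) :
  exists phi : nat -> nat, {homo phi : i j / (i < j)%N} /\ {homo u \o phi : i j / (i <= j)%N}.
Proof.
have next k : exists j, (k <= j)%N /\ forall i, (k <= i)%N -> (u j <= u i)%N.
  have ex : exists v, `[< exists2 j, (k <= j)%N & u j = v >] by exists (u k); apply/asboolP; exists k.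
  case: (ex_minnP ex) => v /asboolP[j kj <-] vmin; exists j; split=> // i ki.
  by apply: vmin; apply/asboolP; exists i.
have [nx nxP] := choice next.
pose phi := fix phi k := if k is k'.+1 then nx (phi k').+1 else nx 0%N.
have phiS k : (phi k < phi k.+1)%N by have [] := nxP (phi k).+1.
exists phi; split; first by apply: homo_ltn => // ? ? ?; exact: ltn_trans.
apply: homo_leq => //= [? ? ?|[|k]]; first exact: leq_trans.
  by have [_] := nxP 0%N; apply.
by have [_] := nxP (phi k).+1; apply; apply: ltn_trans (phiS k) (phiS k.+1).
Qed.

(** A sequence has a subsequence along which all coordinates increase; it is extracted
one coordinate at a time. *)
Lemma dickson n (u : nat -> multinom n) : exists i j, (i < j)%N /\ forall l, (u i l <= u j l)%N.
Proof.
have h (s : seq 'I_n) : exists phi : nat -> nat, {homo phi : i j / (i < j)%N} /\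
    forall l, l \in s -> {homo (fun k => u (phi k) l) : i j / (i <= j)%N}.
  elim: s => [|l s [phi [ip mp]]]; first by exists id; split.
  have [psi [ip' mp']] := monotone_subsequence (fun k => u (phi k) l).
  exists (phi \o psi); split=> [i j ij /=|l']; first by apply: ip; exact: ip'.
  rewrite inE => /orP[/eqP -> i j ij|ls i j ij]; first exact: mp'.
  apply: mp => //=; move: ij; rewrite leq_eqVlt => /orP[/eqP -> //|/ip'/ltnW//].
have [phi [ip mp]] := h (enum 'I_n); exists (phi 0%N), (phi 1%N); split; first exact: ip.
by move=> l; apply: (mp l) => //; rewrite mem_enum.
Qed.

Context (K : fieldType) (n : nat).
Local Notation MP := (mpoly n K).

Lemma mlead_min (S : set MP) : (exists P, S P) ->
  exists2 P, S P & forall Q, S Q -> ~~ (mlead Q < mlead P)%O.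
Proof.
move=> [P0 SP0]; apply: contrapT => nmin.
suff h e P : mlead P = e -> ~ S P by exact: (h _ P0 erefl).
move: P; elim/(well_founded_ind (@ltom_wf n)): e => e IHe P Pe SP.
apply: nmin; exists P => // Q SQ; apply/negP => QP.
by apply: (IHe (mlead Q) _ Q) => //; rewrite -Pe.
Qed.

(** If [I] is not finitely generated, choose successively [f_k] in [I] with least
leading monomial among the elements outside the ideal generated by the previous ones.
By [dickson] the leading monomial of some [f_i] divides that of some [f_j], [i < j]; then
[f_j] minus a multiple of [f_i] contradicts the choice of [f_j]. *)
Lemma hilbert_basis (I : set MP) : ideal I ->
  exists (k : nat) (f : 'I_k -> MP), (forall i, I (f i)) /\
    forall P, I P -> exists c : 'I_k -> MP, P = \sum_(i < k) c i * f i.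
Proof.
move=> [I0 ID IM]; apply: contrapT => nfg.
pose span (s : seq MP) P := exists c : 'I_(size s) -> MP, P = \sum_i c i * s`_i.
pose good (s : seq MP) P := (forall x, x \in s -> I x) -> [/\ I P, ~ span s P &
  forall Q, I Q -> ~ span s Q -> ~~ (mlead Q < mlead P)%O].
have ex s : exists P, good s P.
  have [sI|ns] := pselect (forall x, x \in s -> I x); last by exists 0.
  have [|P [IP nP] minP] := @mlead_min [set P | I P /\ ~ span s P].
    apply: contrapT => nP; apply: nfg; exists (size s), (fun i => s`_i); split.
      by move=> i; apply: sI; exact: mem_nth.
    by move=> P IP; apply: contrapT => h; apply: nP; exists P.
  by exists P => _; split=> // Q IQ nQ; exact: minP.
have [next nextP] := choice ex.
pose seqs := fix seqs k := if k is k'.+1 then rcons (seqs k') (next (seqs k')) else [::].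
pose f k := next (seqs k).
have seqI k x : x \in seqs k -> I x.
  elim: k x => [|k IHk] x //=; rewrite mem_rcons inE => /orP[/eqP ->|/IHk//].
  by have [] := nextP _ IHk.
have szs k : size (seqs k) = k by elim: k => //= k IHk; rewrite size_rcons IHk.
have nths i k : (i < k)%N -> (seqs k)`_i = f i.
  elim: k => //= k IHk; rewrite nth_rcons szs ltnS leq_eqVlt => /orP[/eqP ->|ik].
    by rewrite ltnn eqxx.
  by rewrite ik IHk.
have fP k := nextP (seqs k) (@seqI k).
have [i [j [ij lij]]] := dickson (fun k => mlead (f k)).
have [Ij nj minj] := fP j; have [Ii ni _] := fP i; rewrite -!/(f _) in Ij nj minj Ii ni.
have span0 s : span s 0 by exists (fun=> 0); rewrite big1 // => l _; rewrite mul0r.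
have fi0 : f i != 0 by apply: contra_notN ni => /eqP ->.
pose e := mnm_sub (mlead (f j)) (mlead (f i)).
pose c := mcoeff (mlead (f j)) (f j) / mcoeff (mlead (f i)) (f i).
(* the multiple of [f i] with the same leading term as [f j] *)
pose q := (c *: mpolyX K e) * f i.
have spanD s P Q : span s P -> span s Q -> span s (P + Q).
  move=> [a ->] [b ->]; exists (fun l => a l + b l).
  by rewrite -big_split; apply: eq_bigr => l _; rewrite mulrDl.
have spanq : span (seqs j) q.
  have isz : (i < size (seqs j))%N by rewrite szs.
  exists (fun l => if l == Ordinal isz then c *: mpolyX K e else 0).
  rewrite (bigD1 (Ordinal isz)) //= eqxx nths // big1 ?addr0 // => l /negPf ->.
  by rewrite mul0r.
have Iq : I q by have [] := IM (c *: mpolyX K e) _ Ii.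
have fj0 : f j != 0 by apply: contra_notN nj => /eqP ->.
have cfi : mcoeff (mlead (f i)) (f i) != 0 by rewrite mleadc_eq0.
have cfj : mcoeff (mlead (f j)) (f j) != 0 by rewrite mleadc_eq0.
have c0 : c != 0 by rewrite mulf_neq0 ?invr_eq0.
have ele : mnm_add e (mlead (f i)) = mlead (f j).
  by apply/mnmP => l; rewrite mnmDE mnmBE subnK.
have lq : mlead q = mlead (f j).
  rewrite /q -scalerAl mleadZ_proper; last first.
    by rewrite mulf_neq0 // mleadc_eq0 mulf_neq0 // -msize_poly_eq0 msizeX.
  by rewrite mleadM ?mleadXm // -msize_poly_eq0 msizeX.
have cq : mcoeff (mlead (f j)) q = mcoeff (mlead (f j)) (f j).
  rewrite /q -scalerAl mcoeffZ -{1}ele [mnm_add _ _]addmC [_ * f i]mulrC [mnm_add _ _]addmC.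
  by rewrite mcoeffMX /c divfK.
have nr : ~ span (seqs j) (f j - q).
  by move=> h; apply: nj; rewrite -(subrK q (f j)); exact: spanD.
have Ir : I (f j - q) by apply: ID => //; rewrite -mulN1r; have [] := IM (-1) _ Iq.
have := minj _ Ir nr; case/negP.
rewrite lt_neqAle; apply/andP; split; last first.
  by apply: le_trans (mleadB_le _ _) _; rewrite lq joinxx.
apply/eqP => h; have : mcoeff (mlead (f j)) (f j - q) = 0 by rewrite mcoeffB cq subrr.
rewrite -h => /eqP; rewrite mleadc_eq0 => /eqP r0; apply: nr; rewrite r0; exact: span0.
Qed.

End Noetherian.

(** * The Frobenius pair of a power frame *)

Section SubIwasawa.
Context (K : fieldType) (G : topGroupType) (H : set G) (gH : is_subgroup H).

Lemma iw_sub_subalgebra : subalgebra (iw_sub (K := K) H).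
Proof.
have [H1 HM HV] := gH.
split.
- move=> N a; rewrite [(1 : iwasawa K G) N]/(msing 1%g 1 : malg K (quotg N)) msingE.
  by case: ifP => [/eqP -> _|_]; [exists 1%g|rewrite eqxx].
- move=> x y hx hy N a; rewrite [(x + y) N]/(x N + y N) malgDE.
  by have [->|/hx//] := eqVneq (x N a) 0; rewrite add0r => /hy.
- by move=> c x hx N a; rewrite [(c *: x) N]/(c *: x N) malgZE mulf_eq0 negb_or => /andP[_ /hx].
- move=> x y hx hy N a; rewrite [(x * y) N]/(mmul (x N) (y N)) /mmul /mext malg_sumE => ne0.
  apply: contrapT => nex; move: ne0; rewrite big_seq big1 ?eqxx // => b xb.
  rewrite malg_sumE big_seq big1 // => c yc; rewrite msingE; case: eqP => // abc.
  case: nex; rewrite !mem_finsupp in xb yc.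
  have [h Hh bE] := hx _ _ xb; have [k Hk cE] := hy _ _ yc.
  by exists (h * k)%g; [exact: HM|rewrite abc bE cE qclassM].
Qed.

Lemma iw_sub_iw_elt x : H x -> iw_sub (K := K) H (iw_elt K x).
Proof.
move=> Hx N a; rewrite [iw_elt K x N]/(grp K N x) msingE.
by case: ifP => [/eqP -> _|_]; [exists x|rewrite eqxx].
Qed.

End SubIwasawa.

Section Pth.
Context (K : fieldType) (p d : nat).
Hypothesis (p_char : p \in [pchar K]).
Local Notation MP := (mpoly d K).

Lemma p_gt0 : (0 < p)%N.
Proof. by apply: prime_gt0; exact: pcharf_prime p_char. Qed.

Lemma pchar_mpoly : p \in [pchar MP].
Proof.
have := p_char; rewrite !inE => /andP[-> /eqP p0] /=.
by rewrite -(mpolyC_nat d) p0 mpolyC0.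
Qed.

Lemma pth0 : pth p (0 : MP).
Proof. by move=> e; rewrite mcoeff0 eqxx. Qed.

Lemma pthX c (e : multinom d) : (forall i, (p %| e i)%N) -> pth p (c *: mpolyX K e : MP).
Proof.
move=> he f; rewrite mcoeffZ mcoeffX; case: (e =P f) => [<- //|]; by rewrite mulr0 eqxx.
Qed.

Lemma pth_sum I (r : seq I) (C : pred I) (E : I -> MP) :
  (forall i, C i -> pth p (E i)) -> pth p (\sum_(i <- r | C i) E i).
Proof. by move=> hE; elim/big_ind: _ => //; [exact: pth0|exact: pthD]. Qed.

Lemma pth_pow (P : MP) : pth p (P ^+ p).
Proof.
rewrite -(pFrobenius_autE pchar_mpoly); elim/mpolyind: P => [|c e P _ _ IH].
  by rewrite rmorph0; exact: pth0.
rewrite rmorphD /=; apply: pthD => //; rewrite pFrobenius_autE exprZn mpolyXn.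
by apply: pthX => i; rewrite mulmnE dvdn_mull.
Qed.

Definition expm (e : {ffun 'I_d -> 'I_p}) : multinom d := Multinom [tuple (e i : nat) | i < d].

Lemma expmE e i : expm e i = e i. Proof. exact: mnmE. Qed.

(** Euclidean division of the exponents by [p]. *)
Lemma pth_decomp (P : MP) : exists! c : {ffun {ffun 'I_d -> 'I_p} -> MP},
  (forall e, pth p (c e)) /\ P = \sum_e c e * mpolyX K (expm e).
Proof.
pose md (f : multinom d) : {ffun 'I_d -> 'I_p} := [ffun i => Ordinal (ltn_pmod (f i) p_gt0)].
have mdE f i : expm (md f) i = (f i %% p)%N by rewrite expmE ffunE.
pose qt (f : multinom d) : multinom d := Multinom [tuple (p * (f i %/ p))%N | i < d].
have qtE f i : qt f i = (p * (f i %/ p))%N by exact: mnmE.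
have fE f : mnm_add (qt f) (expm (md f)) = f.
  by apply/mnmP => i; rewrite mnmDE qtE mdE mulnC -divn_eq.
(* uniqueness: only the summand [e] contributes to the coefficient of [X^(e + q)] *)
have cu (c : {ffun {ffun 'I_d -> 'I_p} -> MP}) : (forall e, pth p (c e)) ->
    \sum_e c e * mpolyX K (expm e) = 0 -> forall e, c e = 0.
  move=> hc c0 e; apply/mpolyP => q; rewrite mcoeff0; apply/eqP/negPn/negP => ne0.
  have hq := hc e q ne0; have := congr1 (mcoeff (mnm_add (expm e) q)) c0.
  rewrite mcoeff0 (raddf_sum (mcoeff _)) /= (bigD1 e) //= mcoeffMX big1 ?addr0.
    by move/eqP; rewrite (negPf ne0).
  move=> f fe; apply/eqP/negPn/negP; rewrite -mcoeff_msupp.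
  rewrite (perm_mem (msuppMX _ _)) => /mapP[/= q' q'c qq'].
  have hq' := hc f q'; rewrite -mcoeff_msupp in hq'; case/eqP: fe; apply/ffunP => i; apply: val_inj => /=.
  have := congr1 (fun m : multinom d => (m i %% p)%N) qq'; rewrite !mnmDE !expmE.
  have /dvdnP[k1 ->] := hq i; have /dvdnP[k2 ->] := hq' q'c i.
  by rewrite ![(_ + _ * p)%N]addnC !modnMDl !modn_small ?ltn_ord // => ->.
pose c := [ffun e : {ffun 'I_d -> 'I_p} => \sum_(f <- msupp P | md f == e) mcoeff f P *: mpolyX K (qt f) : MP].
have hc e : pth p (c e).
  by rewrite ffunE; apply: pth_sum => f _; apply: pthX => i; rewrite qtE dvdn_mulr.
have PE : P = \sum_e c e * mpolyX K (expm e).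
  rewrite {1}(mpolyE P) (partition_big md xpredT) //=; apply: eq_bigr => e _.
  rewrite ffunE mulr_suml; apply: eq_bigr => f /eqP <-.
  by rewrite -scalerAl -mpolyXD fE.
exists c; split=> // c' [hc' PE'].
have h0 := cu [ffun e => c e - c' e] _ _.
apply/ffunP => e; apply/eqP; rewrite -subr_eq0.
have := h0 _ _ e; rewrite ffunE => -> //.
  by move=> f; rewrite ffunE -scaleN1r; apply: pthD => //; exact: pthZ.
under eq_bigr => f _ do rewrite ffunE mulrBl.
by rewrite sumrB -PE -PE' subrr.
Qed.

End Pth.

Section Frobenius.
Context (K : fieldType) (p d : nat) (G : topGroupType) (kap : G -> 'I_d -> K) (g : 'I_d -> G).
Hypotheses (p_char : p \in [pchar K]) (p_gt2 : (2 < p)%N) (fr : power_frame p kap g).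
Local Notation Om := (iwasawa K G).
Local Notation idO := (aug_ideal_ideal K G).
Local Notation MP := (mpoly d K).
Local Notation bO := (fun i => iw_elt K (g i) - 1).
Local Notation F := (iw_filtration K G).
Local Notation ev := (ev (K := K) bO).
Local Notation gr_poly := (@gr_poly K d G g).
Local Notation A1 := (iw_sub (K := K) (powers G p)).
Local Notation "-: k" := (- (Posz k)) (at level 10).

Lemma H1_subgroup : is_subgroup (powers G p).
Proof. by have := frame_subgroup fr 1; rewrite expn1. Qed.

Let sub1 := iw_sub_subalgebra K H1_subgroup.

Lemma bO_pow i : bO i ^+ p = iw_elt K (g i ^+ p)%g - 1.
Proof.
have := iota_sub1X (charA p_char Om) (@iw_elt1 K G) (@iw_eltM K G) (g i) 1.
by rewrite expn1 => ->.
Qed.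

Lemma A1_mon c (e : multinom d) : (forall i, (p %| e i)%N) -> A1 (ev (c *: mpolyX K e)).
Proof.
have [S1 SD SZ SM] := sub1; move=> he; rewrite evZ evX; apply: (SZ); rewrite /mmap1.
elim/big_ind: _ => // i _; rewrite -(divnK (he i)) mulnC exprM bO_pow.
elim: (_ %/ _)%N => [|n IHn]; first by rewrite expr0.
rewrite exprS; apply: (SM) => //; apply: (SD); first by apply: iw_sub_iw_elt; exists (g i).
by rewrite -scaleN1r; apply: (SZ).
Qed.

Lemma A1_pi P k : pth p P -> A1 (ev (pihomog mdeg k P)).
Proof.
have [S1 SD SZ SM] := sub1; move=> hP; rewrite pihomogE ev_sum big_seq_cond.
have S0 : A1 0 by rewrite -(scale0r 1); apply: SZ.
elim/big_ind: _ => // e /andP[eP _]; apply: A1_mon; apply: hP.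
by rewrite -mcoeff_msupp.
Qed.

(** One inclusion is [sub_sym]; for the other, [b_i^p = g_i^p - 1] lies in
[K[[G^p]]]. *)
Lemma gr_sub_pth b : gr_sub F A1 b <-> exists2 P, pth p P & b = gr_poly P.
Proof.
have [S1 SD SZ SM] := sub1; have S0 : A1 0 by rewrite -(scale0r 1); apply: SZ.
split=> [[u uA ->]|[P hP ->]].
  rewrite gr_expand; elim/big_rec: _ => [|k y _ [P hP ->]]; first by exists 0; [exact: pth0|rewrite gr_poly0].
  have [k0|k0] := ltP 0 k; first by exists P => //; rewrite symb_pos // add0r.
  have kE : k = -: `|k|%N by lia.
  have := rees_fil u k; rewrite {1}kE => /filE hu.
  have [Q hQ sQ] := sub_sym p_char p_gt2 fr (uA k) hu.
  exists (Q + P); first exact: pthD.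
  by rewrite gr_polyD (gr_poly_sym sQ) -kE.
have h (k : 'I_(msize P)) : exists w : rees F, symb F (-: k) (ev (pihomog mdeg k P)) = grpi w /\
    rees_val w = msing (-: k : zmon) (ev (pihomog mdeg k P)).
  by have [w e1 e2] := symbE (pi_fil g k P); exists w.
have [w wP] := choice h; exists (\sum_k w k).
  move=> n; rewrite rees_val_sum malg_sumE; elim/big_ind: _ => // k _.
  by rewrite (wP k).2 msingE; case: ifP => // _; exact: A1_pi.
by rewrite grpi_sum; apply: eq_bigr => k _; rewrite (wP k).1.
Qed.

(** Membership in [K[[G^p]]] is tested at the finite levels, where the topology is
discrete. *)
Lemma iw_closed : filtration_closed F A1.
Proof.
move=> x hx N a; have [k hk] := level_nil p_char fr N.
have [y yA /filE/(powE p_char p_gt2 fr)/(_ N) hy] := hx (-: k).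
have : x N - y N = 0 by apply: hk.
by move/eqP; rewrite subr_eq0 => /eqP ->; exact: yA.
Qed.

(** Transported from the polynomial ring. *)
Lemma gr_domain : commutative_noetherian_domain (gr F).
Proof.
split.
- move=> a b; have [P ->] := gr_poly_surj p_char p_gt2 fr a; have [Q ->] := gr_poly_surj p_char p_gt2 fr b.
  by rewrite -!(gr_polyM p_char p_gt2 fr) mulrC.
- rewrite -(@gr_poly1 K d G g) -(@gr_poly0 K d G g) => /(gr_poly_inj p_char p_gt2 fr)/eqP.
  by rewrite oner_eq0.
- move=> a b; have [P ->] := gr_poly_surj p_char p_gt2 fr a; have [Q ->] := gr_poly_surj p_char p_gt2 fr b.
  rewrite -(gr_polyM p_char p_gt2 fr) -[0](@gr_poly0 K d G g) => /(gr_poly_inj p_char p_gt2 fr)/eqP.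
  by rewrite mulf_eq0 => /orP[/eqP ->|/eqP ->]; [left|right]; rewrite gr_poly0.
- move=> I [I0 ID IM].
  have idI : ideal [set P | I (gr_poly P)].
    split=> [|P Q hP hQ|P Q hQ]; rewrite /= ?gr_poly0 ?gr_polyD //; first exact: ID.
    by rewrite !(gr_polyM p_char p_gt2 fr); exact: IM.
  have [k [f [fI fgen]]] := hilbert_basis idI; exists k, (fun i => gr_poly (f i)).
  apply/seteqP; split=> b /=.
    have [P ->] := gr_poly_surj p_char p_gt2 fr b => /fgen[c ->].
    by exists (fun i => gr_poly (c i)); rewrite gr_poly_sum; apply: eq_bigr => i _; rewrite (gr_polyM p_char p_gt2 fr).
  by move=> [c ->]; elim/big_ind: _ => // i _; have [] := IM (c i) _ (fI i).
Qed.

Lemma gr_poly_mon (e : multinom d) : gr_poly (mpolyX K e) = \prod_(i < d) gr_poly (mpolyX K (mnm1 i)) ^+ e i.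
Proof.
rewrite mpolyXE_id (big_morph gr_poly (gr_polyM p_char p_gt2 fr) (@gr_poly1 K d G g)).
by apply: eq_bigr => i _; rewrite (gr_polyX p_char p_gt2 fr).
Qed.

Theorem iw_frobenius : frobenius_pair p F A1.
Proof.
split.
- exact: (iw_filtered p_char p_gt2 fr).
- exact: (iw_complete p_char p_gt2 fr).
- exact: sub1.
- exact: iw_closed.
- exact: gr_domain.
- move=> b; have [P ->] := gr_poly_surj p_char p_gt2 fr b; apply/gr_sub_pth; exists (P ^+ p).
    exact: pth_pow.
  by rewrite (gr_polyX p_char p_gt2 fr).
exists d, (fun i => gr_poly (mpolyX K (mnm1 i))); split=> [i|b].
  exists (-: 1), (bO i); split; first by apply/filE; apply/(pow1 idO); exact: iw_elt_aug.
  by rewrite (gr_poly_sym (sym_b idO bO i)).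
have [P bE] := gr_poly_surj p_char p_gt2 fr b.
have [c [[hc PE] cu]] := pth_decomp p_char P.
have mE (c' : {ffun {ffun 'I_d -> 'I_p} -> MP}) : gr_poly (\sum_e c' e * mpolyX K (expm e)) =
    \sum_e gr_poly (c' e) * \prod_(i < d) gr_poly (mpolyX K (mnm1 i)) ^+ e i.
  rewrite gr_poly_sum; apply: eq_bigr => e _; rewrite (gr_polyM p_char p_gt2 fr) gr_poly_mon; congr (_ * _).
  by apply: eq_bigr => i _; rewrite expmE.
exists [ffun e => gr_poly (c e)]; split.
  split=> [e|]; first by rewrite ffunE; apply/gr_sub_pth; exists (c e).
  by rewrite bE {1}PE mE; apply: eq_bigr => e _; rewrite ffunE.
move=> c' [hc' bE']; have h e : exists Q, pth p Q /\ c' e = gr_poly Q.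
  by have /gr_sub_pth[Q h1 h2] := hc' e; exists Q.
have [Q QP] := choice h; apply/ffunP => e; rewrite ffunE (QP e).2; congr gr_poly.
rewrite (cu [ffun e => Q e]) ?ffunE //; split=> [f|]; first by rewrite ffunE; have [] := QP f.
apply: (gr_poly_inj p_char p_gt2 fr); rewrite -bE bE' mE; apply: eq_bigr => f _.
by rewrite ffunE (QP f).2.
Qed.

End Frobenius.

(** * Divisibility of Frobenius twisted combinations *)

Section Moore.
Context (K : fieldType) (p d : nat).
Hypotheses (p_char : p \in [pchar K]) (frobK : forall c : K, c ^+ p = c).
Local Notation MP := (mpoly d K).
Local Notation X_ k := (mpolyX K (mnm1 k) : MP).

Definition mdvd (X f : MP) := exists y, f = X * y.

Lemma mdvd0 X : mdvd X 0. Proof. by exists 0; rewrite mulr0. Qed.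
Lemma mdvdD X f g : mdvd X f -> mdvd X g -> mdvd X (f + g).
Proof. by move=> [y ->] [z ->]; exists (y + z); rewrite mulrDr. Qed.
Lemma mdvdM X f g : mdvd X g -> mdvd X (f * g).
Proof. by move=> [y ->]; exists (f * y); rewrite mulrCA. Qed.
Lemma mdvdZ X (c : K) g : mdvd X g -> mdvd X (c *: g).
Proof. by rewrite -mul_mpolyC; exact: mdvdM. Qed.
Lemma mdvdB X f g : mdvd X f -> mdvd X g -> mdvd X (f - g).
Proof. by move=> hf hg; apply: mdvdD => //; rewrite -mulN1r; exact: mdvdM. Qed.
Lemma mdvd_sum X I (r : seq I) (P : pred I) (E : I -> MP) :
  (forall i, P i -> mdvd X (E i)) -> mdvd X (\sum_(i <- r | P i) E i).
Proof. by move=> h; elim/big_ind: _ => //; [exact: mdvd0|exact: mdvdD]. Qed.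

Let p_pr : prime p := pcharf_prime p_char.

Lemma charMP : p \in [pchar MP].
Proof.
have := p_char; rewrite !inE => /andP[-> /eqP p0] /=.
by rewrite -(mpolyC_nat d) p0 mpolyC0.
Qed.

Lemma frobD (x y : MP) r : (x + y) ^+ (p ^ r) = x ^+ (p ^ r) + y ^+ (p ^ r).
Proof.
elim: r => [|r IHr]; first by rewrite !expr1.
by rewrite expnSr !exprM IHr -!(pFrobenius_autE charMP) rmorphD.
Qed.

Lemma frob_sum I (s : seq I) (P : pred I) (E : I -> MP) r :
  (\sum_(i <- s | P i) E i) ^+ (p ^ r) = \sum_(i <- s | P i) E i ^+ (p ^ r).
Proof.
elim/big_rec2: _ => [|i x y _ <-]; last exact: frobD.
by rewrite expr0n expn_eq0 -leqn0 leqNgt prime_gt0.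
Qed.

Lemma frobZ (c : K) (x : MP) r : (c *: x) ^+ (p ^ r) = c *: x ^+ (p ^ r).
Proof.
by elim: r => [|r IHr]; rewrite ?expr1 // expnSr !exprM IHr exprZn frobK.
Qed.

(** Both sides are polynomials in [W] with leading coefficient [w] which vanish
at the [p] multiples of [w] by elements of the prime field. *)
Lemma moore_factor (W w : MP) :
  W ^+ p * w - W * w ^+ p = w * \prod_(n < p) (W - (n%:R : K) *: w).
Proof.
have [->|w0] := eqVneq w 0.
  by rewrite expr0n -leqn0 leqNgt prime_gt0 // !mulr0 mul0r subrr.
have p1 := prime_gt1 p_pr.
pose rs := [seq (n%:R : K) *: w | n <- iota 0 p].
pose Q : {poly MP} := \prod_(z <- rs) ('X - z%:P).
pose P : {poly MP} := 'X^p - (w ^+ p.-1) *: 'X.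
have szQ : size Q = p.+1 by rewrite size_prod_XsubC size_map size_iota.
(* two monic polynomials of degree [p] with [p] common roots *)
have PQ : P = Q.
  apply/eqP; rewrite -subr_eq0; apply/negPn/negP => D0.
  have hroot : all (root (P - Q)) rs.
    apply/allP => z zr; rewrite /root hornerD hornerN.
    have -> : Q.[z] = 0 by apply/eqP; rewrite -[_ == _]/(root Q z) root_prod_XsubC.
    case/mapP: zr => n _ ->; rewrite subr0 hornerD hornerN hornerXn hornerZ hornerX.
    have := frobZ n%:R w 1; rewrite expn1 => ->.
    by rewrite -scalerAr -exprSr prednK ?prime_gt0 // subrr.
  have urs : uniq rs.
    rewrite map_inj_in_uniq ?iota_uniq // => n k; rewrite !mem_iota !add0n /= => np kp.
    move=> /eqP; rewrite -subr_eq0 -scalerBl scaler_eq0 (negPf w0) orbF subr_eq0 => /eqP.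
    wlog nk : n k np kp / (n <= k)%N.
      by move=> hw; case: (leqP n k) => [|/ltnW] h e; [|symmetry]; exact: hw.
    move=> /eqP; rewrite eq_sym -subr_eq0 -natrB // -(dvdn_pcharf p_char) => pd.
    apply/eqP; rewrite eqn_leq nk /= leqNgt; apply/negP; rewrite -subn_gt0 => kn0.
    have := dvdn_leq kn0 pd; rewrite leqNgt; case/negP.
    by apply: leq_ltn_trans kp; exact: leq_subr.
  have := max_poly_roots D0 hroot urs; rewrite size_map size_iota ltnNge; case/negP.
  apply/leq_sizeP => j; rewrite leq_eqVlt => /orP[/eqP <-|pj].
    have lQ : Q`_p = 1.
      have := monic_prod_XsubC rs xpredT id; rewrite monicE lead_coefE -/Q szQ /= => /eqP.
      exact.
    rewrite coefB coefB coefXn coefZ coefX lQ eqxx (gtn_eqF p1) mulr0 subr0.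
    by rewrite subrr.
  rewrite coefB coefB coefXn coefZ coefX (gtn_eqF pj) (gtn_eqF (ltn_trans p1 pj)).
  by rewrite mulr0 subr0 nth_default ?szQ // subrr.
have := congr1 (horner^~ W) PQ; rewrite hornerD hornerN hornerXn hornerZ hornerX.
have iE : iota 0 p = index_iota 0 p by rewrite /index_iota subn0.
rewrite /Q horner_prod big_map iE big_mkord => e.
have -> : \prod_(n < p) (W - (n%:R : K) *: w) = W ^+ p - w ^+ p.-1 * W.
  by rewrite e; apply: eq_bigr => n _; rewrite hornerXsubC.
by rewrite mulrBr mulrA -exprS prednK ?prime_gt0 // ![w * _]mulrC [W * _]mulrC.
Qed.

(** Elimination of the Frobenius twists, as in the evaluation of a Moore determinant.
Multiply the relation for [r+1] by [w_0^(p^r)], the one for [r] by [w_0^(p^(r+1))] and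
subtract: [h_0] disappears and [w_i] is replaced by [w_i^p w_0 - w_i w_0^p]. By
[moore_factor] the nontrivial combinations of the new [w_i] are again products of
nontrivial combinations of the old ones. The multiplicative set [S] collects the factors
which have to be inverted. *)
Lemma moore (S : set MP) n (w : 'I_n -> MP) : S 1 -> (forall x y, S x -> S y -> S (x * y)) ->
  (forall c : 'I_n -> K, (exists i, c i != 0) -> S (\sum_i c i *: w i)) ->
  forall X (h : 'I_n -> MP) R, (forall r, (R <= r)%N -> mdvd X (\sum_i w i ^+ (p ^ r) * h i)) ->
  exists2 s, S s & forall i, mdvd X (s * h i).
Proof.
move=> S1 SM; elim: n w => [|n IHn] w wS X h R hR; first by exists 1 => // -[].
pose w0 := w ord0; pose u i := w (lift ord0 i).
pose w' i := u i ^+ p * w0 - u i * w0 ^+ p.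
have Sw0 : S w0.
  have := wS (fun i => (i == ord0)%:R); rewrite (bigD1 ord0) //= scale1r big1 ?addr0.
    by apply; exists ord0; rewrite eqxx oner_eq0.
  by move=> i /negPf ->; rewrite scale0r.
have SX x k : S x -> S (x ^+ k) by move=> Sx; elim: k => // k IHk; rewrite exprS; exact: SM.
have wS' (c : 'I_n -> K) : (exists i, c i != 0) -> S (\sum_i c i *: w' i).
  move=> [i0 ci0]; pose W := \sum_i c i *: u i.
  have -> : \sum_i c i *: w' i = W ^+ p * w0 - W * w0 ^+ p.
    have := frob_sum (index_enum 'I_n) xpredT (fun i => c i *: u i) 1; rewrite expn1 => ->.
    rewrite !mulr_suml -sumrB; apply: eq_bigr => i _; rewrite scalerBr.
    by have := frobZ (c i) (u i) 1; rewrite expn1 => ->; rewrite !scalerAl.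
  rewrite moore_factor; apply: (SM) => //; elim/big_ind: _ => // k _.
  have := wS (fun i => if unlift ord0 i is Some j then c j else - k%:R).
  rewrite big_ord_recl unlift_none; under eq_bigr => i _ do rewrite liftK.
  by rewrite scaleNr addrC; apply; exists (lift ord0 i0); rewrite liftK.
have [|s Ss hs] := IHn w' wS' X (fun i => h (lift ord0 i)) R.
  move=> r rR; have h1 := hR r rR; have h2 := hR r.+1 (leqW rR).
  have := mdvdB (mdvdM (w0 ^+ (p ^ r)) h2) (mdvdM (w0 ^+ (p ^ r.+1)) h1).
  rewrite !big_ord_recl -/w0 !mulrDr opprD addrACA !mulrA [w0 ^+ (p ^ r.+1) * _]mulrC subrr add0r.
  rewrite !mulr_sumr -sumrB.
  rewrite (eq_bigr (fun i => w' i ^+ (p ^ r) * h (lift ord0 i))) // => i _.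
  have frobN (x : MP) : (- x) ^+ (p ^ r) = - x ^+ (p ^ r).
    by have := frobZ (-1) x r; rewrite !scaleN1r.
  rewrite /w' frobD frobN !exprMn -!exprM -expnS mulrBl -/(u i) !mulrA.
  by congr (_ * _ - _ * _); rewrite mulrC.
(* the relation for [R] gives back [h 0], multiplied by a power of [w0] *)
exists (s * w0 ^+ (p ^ R)); first by apply: SM => //; exact: SX.
move=> i; case: (unliftP ord0 i) => [j ->|->].
  by rewrite [s * _]mulrC -mulrA; apply: mdvdM; exact: hs.
have := mdvdM s (hR R (leqnn R)); rewrite big_ord_recl -/w0 mulrDr => h1.
rewrite -mulrA -(addrK (s * \sum_(j < n) w (lift ord0 j) ^+ (p ^ R) * h (lift ord0 j)) (s * _)).
apply: mdvdB => //; rewrite mulr_sumr; apply: mdvd_sum => j _.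
by rewrite mulrCA; apply: mdvdM; exact: hs.
Qed.

Implicit Types (P Q X : MP).

Definition lin (l : 'I_d -> K) : MP := \sum_k l k *: X_ k.

Lemma lin_coef l k : mcoeff (mnm1 k) (lin l) = l k.
Proof.
rewrite /lin (raddf_sum (mcoeff _)) /= (bigD1 k) //= mcoeffZ mcoeffX eqxx mulr1.
by rewrite big1 ?addr0 // => j /negPf jk; rewrite mcoeffZ mcoeffX eq_mnm1 jk mulr0.
Qed.

Lemma lin_neq0 l : (exists i, l i != 0) -> lin l != 0.
Proof. by move=> [i li]; apply: contraNneq li => l0; rewrite -lin_coef l0 mcoeff0. Qed.

Section Substitution.
Context (l : 'I_d -> K) (k0 : 'I_d) (lk0 : l k0 != 0).

(** Replacing [X_k0] by its value on the hyperplane [lin l = 0] is a retraction of the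
polynomial ring onto its quotient by the linear form [lin l]. *)
Definition subst_val (k : 'I_d) : MP := X_ k - (if k == k0 then (l k0)^-1 *: lin l else 0).
Definition subst : MP -> MP := mmap (@mpolyC d K) subst_val.

Lemma substX k : subst (X_ k) = subst_val k.
Proof. by rewrite /subst mmapX mmap1U. Qed.

Lemma substM P Q : subst (P * Q) = subst P * subst Q. Proof. exact: rmorphM. Qed.
Lemma substD P Q : subst (P + Q) = subst P + subst Q. Proof. exact: rmorphD. Qed.
Lemma substZ c P : subst (c *: P) = c *: subst P.
Proof. by rewrite /subst mmapZ mul_mpolyC. Qed.
Lemma subst_sum I (r : seq I) (C : pred I) (E : I -> MP) :
  subst (\sum_(i <- r | C i) E i) = \sum_(i <- r | C i) subst (E i).
Proof. exact: rmorph_sum. Qed.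
Lemma substXn P n : subst (P ^+ n) = subst P ^+ n. Proof. exact: rmorphXn. Qed.

Lemma subst_lin c : subst (lin c) = lin (fun k => c k - c k0 / l k0 * l k).
Proof.
rewrite /lin subst_sum; under eq_bigr => k _ do rewrite substZ substX scalerBr.
under [RHS]eq_bigr => k _ do rewrite scalerBl.
rewrite !sumrB; congr (_ - _); rewrite (bigD1 k0) //= eqxx big1 ?addr0.
  by rewrite scalerA /lin scaler_sumr; apply: eq_bigr => k _; rewrite scalerA.
by move=> k /negPf ->; rewrite scaler0.
Qed.

Lemma subst_l : subst (lin l) = 0.
Proof. by rewrite subst_lin /lin big1 // => k _; rewrite divff // mul1r subrr scale0r. Qed.

Lemma subst_mod P : mdvd (lin l) (P - subst P).
Proof.
elim/mpolyind: P => [|c e P _ _ IH]; first by rewrite /subst mmap0 subrr; exact: mdvd0.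
rewrite substD substZ opprD addrACA; apply: mdvdD => //; rewrite -scalerBr; apply: mdvdZ.
have mM x y : mdvd (lin l) (x - subst x) -> mdvd (lin l) (y - subst y) ->
    mdvd (lin l) (x * y - subst (x * y)).
  move=> hx hy; have -> : x * y - subst (x * y) = y * (x - subst x) + subst x * (y - subst y).
    by rewrite substM; ring.
  by apply: mdvdD; exact: mdvdM.
have m1 : mdvd (lin l) (1 - subst 1) by rewrite [subst 1]rmorph1 subrr; exact: mdvd0.
rewrite mpolyXE_id; elim/big_ind: _ => // i _.
elim: (e i) => [|n IHn]; first by rewrite expr0.
rewrite exprS; apply: mM => //; rewrite substX /subst_val opprB addrC subrK.
by case: eqP => _; [apply: mdvdZ; exists 1; rewrite mulr1|exact: mdvd0].
Qed.

Lemma mdvd_subst P : mdvd (lin l) P <-> subst P = 0.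
Proof.
split=> [[y ->]|P0]; first by rewrite substM subst_l mul0r.
by rewrite -[P]subr0 -P0; exact: subst_mod.
Qed.

End Substitution.

(** Products of nonzero linear forms; these are the denominators which [moore] introduces
when the [w_i] are the variables. *)
Inductive linprod : MP -> Prop :=
| linprod1 : linprod 1
| linprodM l P : (exists i, l i != 0) -> linprod P -> linprod (lin l * P).

Lemma linprod_mul P Q : linprod P -> linprod Q -> linprod (P * Q).
Proof.
move=> hP hQ; elim: hP => [|l {}P hl _ IH]; first by rewrite mul1r.
by rewrite -mulrA; exact: linprodM.
Qed.

(** A system of linear equations with trivial kernel has a left inverse. *)
Lemma kernel_span (I : finType) (c : I -> 'I_d -> K) :
  (forall z : 'I_d -> K, (forall i, \sum_j c i j * z j = 0) -> forall j, z j = 0) ->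
  exists b : 'I_d -> I -> K, forall (z : 'I_d -> MP) l,
    z l = \sum_i b l i *: \sum_j c i j *: z j.
Proof.
move=> kc; pose M : 'M[K]_(d, #|I|) := \matrix_(j, i) c (enum_val i) j.
have : row_free M.
  apply/inj_row_free => v vM0; apply/rowP => j; rewrite [RHS]mxE.
  apply: (kc (fun j => v 0 j)) => i; have /rowP/(_ (enum_rank i)) := vM0.
  rewrite !mxE => e; rewrite -[RHS]e; apply: eq_bigr => k _.
  by rewrite !mxE enum_rankK mulrC.
move=> /row_freeP[B MB]; exists (fun l i => B (enum_rank i) l) => z l.
under eq_bigr => i _ do rewrite scaler_sumr.
rewrite exchange_big /=.
under eq_bigr => j _ do under eq_bigr => i _ do rewrite scalerA.
under eq_bigr => j _ do rewrite -scaler_suml.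
have BE j : \sum_i B (enum_rank i) l * c i j = (j == l)%:R.
  have /matrixP/(_ j l) := MB; rewrite !mxE => <-.
  rewrite (reindex_onto enum_rank enum_val) /= => [|i _]; last exact: enum_valK.
  by apply: eq_big => i; rewrite ?enum_rankK ?eqxx // !mxE ?enum_rankK mulrC.
under eq_bigr => j _ do rewrite BE.
rewrite (bigD1 l) //= eqxx scale1r big1 ?addr0 // => j /negPf ->.
by rewrite scale0r.
Qed.

Context (C : 'I_d -> 'I_d -> 'I_d -> K).
Hypothesis nondeg : forall z l : 'I_d -> K,
  (forall i, exists a, forall k, \sum_j C i j k * z j = a * l k) -> forall j, z j = 0.

(** With [C i j] the coordinates of [[e_i, e_j]] modulo [p] and [f j] the partial
derivatives of [Y], this is what the sources of derivations say about [Y]. *)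
Definition twist_closed X R (f : 'I_d -> MP) := forall i r, (R <= r)%N ->
  mdvd X (\sum_j lin (C i j) ^+ (p ^ r) * f j).

Lemma frob_lin c r : lin c ^+ (p ^ r) = \sum_k c k *: X_ k ^+ (p ^ r).
Proof. by rewrite /lin frob_sum; apply: eq_bigr => k _; rewrite frobZ. Qed.

Lemma moore_lin (S : set MP) (c : 'I_d -> 'I_d -> K) X R (f : 'I_d -> MP) :
  S 1 -> (forall x y, S x -> S y -> S (x * y)) ->
  (forall l, (exists i, l i != 0) -> S (lin l)) ->
  (forall r, (R <= r)%N -> mdvd X (\sum_j lin (c j) ^+ (p ^ r) * f j)) ->
  exists2 s, S s & forall k, mdvd X (s * \sum_j c j k *: f j).
Proof.
move=> S1 SM Sl hf; apply: (@moore S d (fun k => X_ k)) => // [r /hf].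
rewrite [X in mdvd _ X -> _](_ : _ = \sum_i X_ i ^+ (p ^ r) * \sum_j c j i *: f j) //.
under eq_bigr => j _ do rewrite frob_lin mulr_suml.
rewrite exchange_big /=; apply: eq_bigr => k _; rewrite mulr_sumr; apply: eq_bigr => j _.
by rewrite -scalerAl scalerAr.
Qed.

(** If [lin l] does not divide [X], it can be cancelled. Otherwise [X = lin l * X'],
[f_j = X' h_j], and [lin l] has to divide every [h_j]. Modulo [lin l] the twisted sums
of the [h_j] vanish, so [moore] over the domain [K[X] / (lin l)] makes the [h_j] a solution
of linear equations with coefficients in [K]. A nonzero solution in [K] of these
equations would be a [z] such that all [[e_i, z]] are multiples of [l]. *)
Lemma strip_linear X R l f : (exists i, l i != 0) -> twist_closed X R f ->
  (forall j, mdvd X (lin l * f j)) -> forall j, mdvd X (f j).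
Proof.
move=> hl hf /choice[h hE]; have [k0 lk0] := hl; have l0 := lin_neq0 hl.
have [X0|X0] := eqVneq (subst l k0 X) 0; last first.
  move=> j; have : subst l k0 (X * h j) = 0 by rewrite -hE substM subst_l // mul0r.
  rewrite substM => /eqP; rewrite mulf_eq0 (negPf X0) => /eqP/(mdvd_subst lk0)[y hy].
  by exists y; apply: (mulfI l0); rewrite hE hy mulrCA.
have [X' X'E] := (mdvd_subst lk0 X).2 X0.
have fE j : f j = X' * h j by apply: (mulfI l0); rewrite hE X'E mulrA.
have [X'0|X'0] := eqVneq X' 0; first by move=> j; rewrite fE X'0 mul0r; exact: mdvd0.
suff hl0 : forall j, mdvd (lin l) (h j).
  by move=> j; have [y hy] := hl0 j; exists y; rewrite fE X'E hy mulrCA mulrA.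
pose c i j k := C i j k - C i j k0 / l k0 * l k.
have hc i k : \sum_j c i j k *: subst l k0 (h j) = 0.
  (* over a domain, divisibility by [0] is vanishing and every nonzero factor cancels *)
  have [|x y x0 y0|u|r rR|s s0 hs] := @moore_lin [set x | x != 0] (c i) 0 R (fun j => subst l k0 (h j)).
  - exact: oner_neq0.
  - by rewrite /= mulf_neq0.
  - exact: lin_neq0.
  - have [y yE] := hf i r rR; exists 0; rewrite mul0r.
    have -> : \sum_j lin (c i j) ^+ (p ^ r) * subst l k0 (h j) =
        subst l k0 (\sum_j lin (C i j) ^+ (p ^ r) * h j).
      rewrite subst_sum; apply: eq_bigr => j _.
      by rewrite substM substXn subst_lin.
    apply/(mdvd_subst lk0); exists y; apply: (mulfI X'0); rewrite mulrCA mulrA -X'E -yE mulr_sumr.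
    by apply: eq_bigr => j _; rewrite fE mulrCA.
  - have [y] := hs k; rewrite mul0r => /eqP; rewrite mulf_eq0 (negPf s0).
    by move=> /eqP.
have [|b hb] := @kernel_span ('I_d * 'I_d)%type (fun u => fun j => c u.1 j u.2).
  move=> z hz; apply: (nondeg (l := l)) => i; exists ((\sum_j C i j k0 * z j) / l k0) => k.
  have := hz (i, k); rewrite /= /c; under eq_bigr => j _ do rewrite mulrBl.
  rewrite sumrB => /eqP; rewrite subr_eq0 => /eqP ->.
  rewrite mulrAC mulr_suml mulr_suml; apply: eq_bigr => j _; ring.
move=> j; apply/(mdvd_subst lk0); rewrite (hb (fun j => subst l k0 (h j))) big1 // => u _; by rewrite hc scaler0.
Qed.

(** By [moore], [X] divides [f_j] times a product of nonzero linear forms, as the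
combinations [\sum_j C_ijk f_j] span all the [f_j]. These linear forms are removed one
by one by [strip_linear]. *)
Theorem twist_closed_dvd X R f : twist_closed X R f -> forall j, mdvd X (f j).
Proof.
move=> hf; have hs i : exists s, linprod s /\ forall k, mdvd X (s * \sum_j C i j k *: f j).
  have [||||s Ss hs] := @moore_lin linprod (C i) X R f; last by exists s.
  - exact: linprod1.
  - exact: linprod_mul.
  - by move=> l hl; rewrite -[lin l]mulr1; apply: linprodM => //; exact: linprod1.
  - exact: hf.
have [s sP] := choice hs; pose t := \prod_i s i.
have lt : linprod t.
  by rewrite /t; elim/big_ind: _; [exact: linprod1|exact: linprod_mul|move=> i _; have [] := sP i].
have ht : forall j, mdvd X (t * f j).
  have [|b hb] := @kernel_span ('I_d * 'I_d)%type (fun u => fun j => C u.1 j u.2).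
    move=> z hz; apply: (nondeg (l := fun=> 0)) => i; exists 0 => k.
    by rewrite mul0r; exact: (hz (i, k)).
  move=> j; rewrite [f j]hb mulr_sumr; apply: mdvd_sum => u _; rewrite -scalerAr; apply: mdvdZ.
  rewrite /t (bigD1 u.1) //= [s _ * _]mulrC -mulrA; apply: mdvdM.
  by have [_] := sP u.1; apply.
(* the property [twist_closed] passes to multiples of [f] *)
elim: lt f hf ht {hs sP} => [|l P hl _ IH] f hf ht; first by move=> j; rewrite -[f j]mul1r.
apply: IH => //; apply: (strip_linear (R := R) hl) => [i r rR|j]; last first.
  by rewrite mulrA.
have -> : \sum_j lin (C i j) ^+ (p ^ r) * (P * f j) = P * \sum_j lin (C i j) ^+ (p ^ r) * f j.
  by rewrite mulr_sumr; apply: eq_bigr => j _; rewrite mulrCA.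
by apply: mdvdM; exact: hf.
Qed.

End Moore.

(** * Cartan matrices modulo a prime *)

Section Cartan.
Context (K : fieldType).
Hypotheses (two0 : (2 : K) != 0) (three0 : (3 : K) != 0).
Implicit Types (c : nat -> K) (T : dynkin).

Lemma lincomb (x y k e : K) : e = 0 -> x - y = k * e -> x = y.
Proof. by move=> -> xy; apply/eqP; rewrite -subr_eq0 xy mulr0. Qed.

Lemma lincomb2 (x y k1 e1 k2 e2 : K) : e1 = 0 -> e2 = 0 -> x - y = k1 * e1 + k2 * e2 -> x = y.
Proof. by move=> -> -> xy; apply/eqP; rewrite -subr_eq0 xy !mulr0 addr0. Qed.

Lemma mul0_cancel (a x : K) : a != 0 -> a * x = 0 -> x = 0.
Proof. by move=> a0 /eqP; rewrite mulf_eq0 (negPf a0) => /eqP. Qed.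

Definition cartan_kernel T c := forall j, (j < dyn_rank T)%N ->
  \sum_(i < dyn_rank T) (dyn_cartan T j i)%:~R * c i = 0.

Lemma sum_support (r : nat) (s : seq nat) (F : nat -> K) : uniq s -> all (fun i => i < r)%N s ->
  (forall i, (i < r)%N -> i \notin s -> F i = 0) -> \sum_(i < r) F i = \sum_(i <- s) F i.
Proof.
move=> us /allP sr s0; rewrite -(big_mkord xpredT F) (bigID [in s]) /= -[RHS]addr0; congr (_ + _); last first.
  by rewrite big_nat_cond big1 // => i /andP[/s0 h /h].
rewrite -big_filter; apply: perm_big; apply: uniq_perm => //.
  by rewrite filter_uniq // iota_uniq.
move=> i; rewrite mem_filter mem_index_iota /=.
by case: (boolP (i \in s)) => // /sr ->.
Qed.

(** Along a branch of the diagram that starts at an end node, the rows of the Cartan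
matrix make the coordinates grow linearly. *)
Lemma chain_values c n : (forall j, (j < n)%N -> 2 * c j = (if j is j'.+1 then c j' else 0) + c j.+1) ->
  forall j, (j <= n)%N -> c j = j.+1%:R * c 0%N.
Proof.
move=> hc; suff h j : (j <= n)%N -> c j = j.+1%:R * c 0%N /\ (forall k, (k < j)%N -> c k = k.+1%:R * c 0%N).
  by move=> j /h[].
elim: j => [|j IHj] jn; first by split=> //; rewrite mul1r.
have [cj ck] := IHj (ltnW jn); split; last first.
  by move=> k; rewrite ltnS leq_eqVlt => /orP[/eqP ->|/ck].
have := hc j jn; case: j jn cj ck {IHj} => [|j] jn cj ck e.
  by rewrite add0r in e; rewrite -e.
have cj' := ck j (ltnSn j).
have -> : c j.+2 = 2 * c j.+1 - c j by rewrite e addrAC subrr add0r.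
by rewrite cj cj'; ring.
Qed.

Lemma kernel_row T c j (s : seq (nat * int)) : cartan_kernel T c -> (j < dyn_rank T)%N ->
  sorted ltn (unzip1 s) -> all (fun u => (u.1 < dyn_rank T)%N && (dyn_cartan T j u.1 == u.2)) s ->
  (forall i, (i < dyn_rank T)%N -> all (fun u => i != u.1) s -> dyn_cartan T j i = 0) ->
  \sum_(u <- s) u.2%:~R * c u.1 = 0.
Proof.
move=> hc jr us /allP sr s0; rewrite -[RHS](hc j jr).
rewrite (@sum_support _ (unzip1 s) (fun i => (dyn_cartan T j i)%:~R * c i)).
- rewrite big_map big_seq [RHS]big_seq; apply: eq_bigr => u us'.
  by have /andP[_ /eqP ->] := sr u us'.
- exact: (sorted_uniq ltn_trans ltnn).
- by apply/allP => _ /mapP[u /sr/andP[h _] ->].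
- move=> i ir iu; rewrite s0 ?mul0r //; apply/allP => u us'; apply: contraNneq iu => ->.
  exact: map_f.
Qed.

Ltac cartan_side :=
  rewrite ?inE /= /dyn_cartan /dyn_edge /dyn_mult /=; repeat (case: ifP => ?); lia.

(* reads off row j of the kernel equations, s listing its nonzero entries *)
Ltac get_row h hc T c j s :=
  have h : \sum_(u <- s) u.2%:~R * c u.1 = 0;
  [ apply: (@kernel_row T c j s hc);
    [ cartan_side | cartan_side | cartan_side | move=> ?; cartan_side]
  | rewrite !big_cons big_nil /= ?mulrNz in h ].

(** The last row gives [(n+1) c_0 = 0]. *)
Lemma kernelA n c : n.+1%:R != 0 :> K -> cartan_kernel (DynA n) c -> forall i, (i < n)%N -> c i = 0.
Proof.
move=> n1 hc; case: n n1 hc => [|n] // n1 hc.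
have hch : forall j, (j < n)%N -> 2 * c j = (if j is j'.+1 then c j' else 0) + c j.+1.
  case=> [|j] jn.
    get_row h hc (DynA n.+1) c 0%N [:: (0%N, 2 : int); (1%N, -1)].
    by apply: (lincomb (k := 1) h); ring.
  get_row h hc (DynA n.+1) c j.+1 [:: (j, -1 : int); (j.+1, 2); (j.+2, -1)].
  by apply: (lincomb (k := 1) h); ring.
have cE := chain_values hch.
suff c0 : c 0%N = 0 by move=> i ilt; rewrite cE // c0 mulr0.
case: n n1 hc hch cE => [|n] n1 hc hch cE.
  get_row h hc (DynA 1) c 0%N [:: (0%N, 2 : int)].
  by apply: (mul0_cancel two0); apply: (lincomb (k := 1) h); ring.
get_row h hc (DynA n.+2) c n.+1 [:: (n, -1 : int); (n.+1, 2)].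
apply: (mul0_cancel n1); apply: (lincomb (k := 1) h).
rewrite (cE n) // (cE n.+1) //; ring.
Qed.

Lemma kernelB n c : (2 <= n)%N -> cartan_kernel (DynB n) c -> forall i, (i < n)%N -> c i = 0.
Proof.
move=> n2 hc; case: n n2 hc => [|[|n]] // _ hc.
have hch : forall j, (j < n)%N -> 2 * c j = (if j is j'.+1 then c j' else 0) + c j.+1.
  case=> [|j] jn.
    get_row h hc (DynB n.+2) c 0%N [:: (0%N, 2 : int); (1%N, -1)].
    by apply: (lincomb (k := 1) h); ring.
  get_row h hc (DynB n.+2) c j.+1 [:: (j, -1 : int); (j.+1, 2); (j.+2, -1)].
  by apply: (lincomb (k := 1) h); ring.
have cE := chain_values hch.
get_row h2 hc (DynB n.+2) c n.+1 [:: (n, -1 : int); (n.+1, 2)].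
have e2 : 2 * c n.+1 = n.+1%:R * c 0%N.
  by rewrite -(cE n) //; apply: (lincomb (k := 1) h2); ring.
have c0 : c 0%N = 0.
  case: n hc hch cE h2 e2 => [|n] hc hch cE h2 e2.
    get_row h1 hc (DynB 2) c 0%N [:: (0%N, 2 : int); (1%N, -2)].
    have e : 2 * c 0%N = c 0%N by rewrite -[RHS]mul1r -e2; apply: (lincomb (k := 1) h1); ring.
    by apply: (lincomb (k := 1) (e := 2 * c 0%N - c 0%N)); [rewrite e subrr|ring].
  get_row h1 hc (DynB n.+3) c n.+1 [:: (n, -1 : int); (n.+1, 2); (n.+2, -2)].
  apply: (lincomb (k := 1) h1); rewrite (cE n) // (cE n.+1) //.
  by have -> : (-2)%:~R * c n.+2 = - (n.+2%:R * c 0%N); [rewrite -e2; ring|ring].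
move=> i; rewrite ltnS leq_eqVlt => /orP[/eqP ->|ilt]; last by rewrite cE // c0 mulr0.
by apply: (mul0_cancel two0); rewrite e2 c0 mulr0.
Qed.

Lemma kernelC n c : (3 <= n)%N -> cartan_kernel (DynC n) c -> forall i, (i < n)%N -> c i = 0.
Proof.
move=> n3 hc; case: n n3 hc => [|[|[|n]]] // _ hc.
have hch : forall j, (j < n.+2)%N -> 2 * c j = (if j is j'.+1 then c j' else 0) + c j.+1.
  case=> [|j] jn.
    get_row h hc (DynC n.+3) c 0%N [:: (0%N, 2 : int); (1%N, -1)].
    by apply: (lincomb (k := 1) h); ring.
  get_row h hc (DynC n.+3) c j.+1 [:: (j, -1 : int); (j.+1, 2); (j.+2, -1)].
  by apply: (lincomb (k := 1) h); ring.
have cE := chain_values hch.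
get_row h hc (DynC n.+3) c n.+2 [:: (n.+1, -2 : int); (n.+2, 2)].
move=> i ilt; rewrite cE //; suff -> : c 0%N = 0 by rewrite mulr0.
apply: (mul0_cancel two0); apply: (lincomb (k := 1) h); rewrite (cE n.+1) // (cE n.+2) //.
ring.
Qed.

Lemma kernelD n c : (4 <= n)%N -> cartan_kernel (DynD n) c -> forall i, (i < n)%N -> c i = 0.
Proof.
move=> n4 hc; case: n n4 hc => [|[|[|[|n]]]] // _ hc.
have hch : forall j, (j < n.+1)%N -> 2 * c j = (if j is j'.+1 then c j' else 0) + c j.+1.
  case=> [|j] jn.
    get_row h hc (DynD n.+4) c 0%N [:: (0%N, 2 : int); (1%N, -1)].
    by apply: (lincomb (k := 1) h); ring.
  get_row h hc (DynD n.+4) c j.+1 [:: (j, -1 : int); (j.+1, 2); (j.+2, -1)].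
  by apply: (lincomb (k := 1) h); ring.
have cE := chain_values hch.
get_row h1 hc (DynD n.+4) c n.+1 [:: (n, -1 : int); (n.+1, 2); (n.+2, -1); (n.+3, -1)].
get_row h2 hc (DynD n.+4) c n.+2 [:: (n.+1, -1 : int); (n.+2, 2)].
get_row h3 hc (DynD n.+4) c n.+3 [:: (n.+1, -1 : int); (n.+3, 2)].
rewrite (cE n) // (cE n.+1) // in h1; rewrite (cE n.+1) // in h2; rewrite (cE n.+1) // in h3.
have c0 : c 0%N = 0.
  apply: (mul0_cancel two0); apply: (lincomb (k := 2) h1).
  have e2 : 2 * c n.+2 = n.+2%:R * c 0%N by apply: (lincomb (k := 1) h2); ring.
  have e3 : 2 * c n.+3 = n.+2%:R * c 0%N by apply: (lincomb (k := 1) h3); ring.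
  transitivity (2 * c 0%N + (2 * c n.+2 - n.+2%:R * c 0%N) * -1 + (2 * c n.+3 - n.+2%:R * c 0%N) * -1).
    by rewrite e2 e3 !subrr; ring.
  ring.
move=> i; rewrite ltnS leq_eqVlt => /orP[/eqP ->|].
  by apply: (mul0_cancel two0); apply: (lincomb (k := 1) h3); rewrite c0; ring.
rewrite ltnS leq_eqVlt => /orP[/eqP ->|ilt]; last by rewrite cE // c0 mulr0.
by apply: (mul0_cancel two0); apply: (lincomb (k := 1) h2); rewrite c0; ring.
Qed.

Lemma kernelF c : cartan_kernel DynF4 c -> forall i, (i < 4)%N -> c i = 0.
Proof.
move=> hc.
get_row h0 hc DynF4 c 0%N [:: (0%N, 2 : int); (1%N, -1)].
get_row h1 hc DynF4 c 1%N [:: (0%N, -1 : int); (1%N, 2); (2%N, -2)].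
get_row h2 hc DynF4 c 2%N [:: (1%N, -1 : int); (2%N, 2); (3%N, -1)].
get_row h3 hc DynF4 c 3%N [:: (2%N, -1 : int); (3%N, 2)].
have e1 : c 1%N = 2 * c 0%N by apply: (lincomb (k := -1) h0); ring.
have e2 : c 2%N = 2 * c 3%N by apply: (lincomb (k := -1) h3); ring.
rewrite e1 e2 in h1 h2.
have c0 : c 0%N = 0 by apply: (lincomb2 (k1 := 3) (k2 := 4) h1 h2); ring.
have c3 : c 3%N = 0 by apply: (lincomb2 (k1 := 2) (k2 := 3) h1 h2); ring.
by move=> [|[|[|[|]]]] // _; rewrite ?e1 ?e2 ?c0 ?c3 ?mulr0.
Qed.

(** The rows of the nodes up to the trivalent one and its neighbour on the long branch
express these coordinates through [c_0]; they are the same for the three diagrams. *)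
Lemma branchE n c : (6 <= n <= 8)%N -> cartan_kernel (DynE n) c ->
  [/\ c 2%N = 2 * c 0%N, c 3%N = 3 * c 0%N, 2 * c 1%N = 3 * c 0%N, 2 * c 4%N = 5 * c 0%N & c 5%N = 2 * c 0%N].
Proof.
move=> n8 hc.
get_row h0 hc (DynE n) c 0%N [:: (0%N, 2 : int); (2%N, -1)].
get_row h1 hc (DynE n) c 1%N [:: (1%N, 2 : int); (3%N, -1)].
get_row h2 hc (DynE n) c 2%N [:: (0%N, -1 : int); (2%N, 2); (3%N, -1)].
get_row h3 hc (DynE n) c 3%N [:: (1%N, -1 : int); (2%N, -1); (3%N, 2); (4%N, -1)].
get_row h4 hc (DynE n) c 4%N [:: (3%N, -1 : int); (4%N, 2); (5%N, -1)].
have e2 : c 2%N = 2 * c 0%N by apply: (lincomb (k := -1) h0); ring.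
have e3 : c 3%N = 3 * c 0%N by apply: (lincomb (k := -1) h2); rewrite e2; ring.
have e1 : 2 * c 1%N = 3 * c 0%N by apply: (lincomb (k := 1) h1); rewrite e3; ring.
have e4 : 2 * c 4%N = 5 * c 0%N.
  apply: (lincomb2 (k1 := -2) (k2 := -1) (e2 := 2 * c 1%N - 3 * c 0%N) h3).
    by rewrite e1 subrr.
  by rewrite e2 e3; ring.
split=> //; apply: (lincomb2 (k1 := -1) (k2 := 1) (e2 := 2 * c 4%N - 5 * c 0%N) h4).
  by rewrite e4 subrr.
by rewrite e3; ring.
Qed.

Lemma kernelE n c : (6 <= n <= 8)%N -> cartan_kernel (DynE n) c -> forall i, (i < n)%N -> c i = 0.
Proof.
move=> n8 hc; have [e2 e3 e1 e4 e5] := branchE n8 hc.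
have sol : c 0%N = 0 -> [/\ c 1%N = 0, c 2%N = 0, c 3%N = 0, c 4%N = 0 & c 5%N = 0].
  move=> c0; split; rewrite ?e2 ?e3 ?e5 ?c0 ?mulr0 //; apply: (mul0_cancel two0).
    by rewrite e1 c0 mulr0.
  by rewrite e4 c0 mulr0.
have [n6|[n7|nE]] : n = 6%N \/ n = 7%N \/ n = 8%N by lia.
- subst n; get_row h5 hc (DynE 6) c 5%N [:: (4%N, -1 : int); (5%N, 2)].
  have /sol[c1 c2 c3 c4 c5] : c 0%N = 0.
    apply: (mul0_cancel three0).
    apply: (lincomb2 (k1 := 2) (k2 := 1) (e2 := 2 * c 4%N - 5 * c 0%N) h5); first by rewrite e4 subrr.
    by rewrite e5; ring.
  have c0 : c 0%N = 0 by apply: (mul0_cancel two0); rewrite -e5 c5.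
  by move=> [|[|[|[|[|[|]]]]]] .
- subst n; get_row h5 hc (DynE 7) c 5%N [:: (4%N, -1 : int); (5%N, 2); (6%N, -1)].
  get_row h6 hc (DynE 7) c 6%N [:: (5%N, -1 : int); (6%N, 2)].
  have c0 : c 0%N = 0.
    have e6 : c 6%N = 4 * c 0%N - c 4%N by apply: (lincomb (k := -1) h5); rewrite e5; ring.
    apply: (lincomb2 (k1 := 1) (k2 := 1) (e2 := 2 * c 4%N - 5 * c 0%N) h6); first by rewrite e4 subrr.
    by rewrite e5 e6; ring.
  have [c1 c2 c3 c4 c5] := sol c0.
  have c6 : c 6%N = 0 by apply: (lincomb (k := -1) h5); rewrite c4 c5; ring.
  by move=> [|[|[|[|[|[|[|]]]]]]].
- subst n; get_row h5 hc (DynE 8) c 5%N [:: (4%N, -1 : int); (5%N, 2); (6%N, -1)].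
  get_row h6 hc (DynE 8) c 6%N [:: (5%N, -1 : int); (6%N, 2); (7%N, -1)].
  get_row h7 hc (DynE 8) c 7%N [:: (6%N, -1 : int); (7%N, 2)].
  have e6 : c 6%N = 4 * c 0%N - c 4%N by apply: (lincomb (k := -1) h5); rewrite e5; ring.
  have e7 : c 7%N = 2 * c 6%N - c 5%N by apply: (lincomb (k := -1) h6); ring.
  have c0 : c 0%N = 0.
    apply: (lincomb2 (k1 := 2) (k2 := 3) (e2 := 2 * c 4%N - 5 * c 0%N) h7); first by rewrite e4 subrr.
    by rewrite e7 e6 e5; ring.
  have [c1 c2 c3 c4 c5] := sol c0.
  have c6 : c 6%N = 0 by rewrite e6 c0 c4 mulr0 subr0.
  have c7 : c 7%N = 0 by rewrite e7 c6 c5 mulr0 subr0.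
  by move=> [|[|[|[|[|[|[|[|]]]]]]]].
Qed.

Lemma kernelG c : cartan_kernel DynG2 c -> forall i, (i < 2)%N -> c i = 0.
Proof.
move=> hc.
get_row h0 hc DynG2 c 0%N [:: (0%N, 2 : int); (1%N, -1)].
get_row h1 hc DynG2 c 1%N [:: (0%N, -3 : int); (1%N, 2)].
have e1 : c 1%N = 2 * c 0%N by apply: (lincomb (k := -1) h0); ring.
have c0 : c 0%N = 0 by apply: (lincomb (k := 1) h1); rewrite e1; ring.
by move=> [|[|]] // _; rewrite ?e1 c0 ?mulr0.
Qed.

Lemma cartan_nondegenerate T c : dyn_valid T -> (forall n, T = DynA n -> n.+1%:R != 0 :> K) ->
  cartan_kernel T c -> forall i, (i < dyn_rank T)%N -> c i = 0.
Proof.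
case: T => [n|n|n|n|n||] /= vT hA hc.
- by apply: kernelA hc; exact: hA.
- exact: kernelB hc.
- exact: kernelC hc.
- exact: kernelD hc.
- exact: kernelE hc.
- exact: kernelF hc.
- exact: kernelG hc.
Qed.

(** The matrix is block diagonal, so a vector of the kernel restricts to vectors
of the kernels of the blocks. *)
Lemma dyn_block_nondegenerate Ts (c : nat * nat -> K) : all dyn_valid Ts ->
  (forall n, DynA n \in Ts -> n.+1%:R != 0 :> K) ->
  (forall u, u \in dyn_nodes Ts -> \sum_(v <- dyn_nodes Ts) (dyn_block Ts u v)%:~R * c v = 0) ->
  forall u, u \in dyn_nodes Ts -> c u = 0.
Proof.
move=> vT hA hc u uT; have /allpairsPdep[k [i [kT iT uE]]] := uT.
rewrite mem_iota /= add0n in kT; rewrite mem_iota /= add0n in iT.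
set T := nth DynG2 Ts k in iT; have TTs : T \in Ts by rewrite mem_nth.
rewrite uE; apply: (@cartan_nondegenerate T (fun i => c (k, i))) => //.
- exact: (allP vT).
- by move=> n Tn; apply: hA; rewrite -Tn.
move=> j jT; have jn : (k, j) \in dyn_nodes Ts.
  by apply/allpairsPdep; exists k, j; rewrite !mem_iota.
rewrite -[RHS](hc _ jn) big_allpairs_dep /=.
rewrite (bigD1_seq k) ?mem_iota ?iota_uniq //= [X in _ + X]big1 ?addr0; last first.
  move=> k' kk'; rewrite big1 // => i' _.
  by rewrite /dyn_block /= eq_sym (negPf kk') mul0r.
have iE : iota 0 (dyn_rank T) = index_iota 0 (dyn_rank T) by rewrite /index_iota subn0.
rewrite -/T iE big_mkord; apply: eq_bigr => i' _.
by rewrite /dyn_block /= eqxx.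
Qed.

End Cartan.

(** * Reduction modulo p of a lattice with a basis *)

Section PadicReduction.
Context (p : nat) (p_pr : prime p).
Implicit Types c : padic p.

(** The truncation of index [1] is the class modulo [p]. *)
Definition red c : 'F_p := (c 1%N)%:~R.

Lemma Fp_modz (a : int) : ((a %% p%:Z)%Z)%:~R = a%:~R :> 'F_p.
Proof.
rewrite [in RHS](divz_eq a p%:Z) [RHS]intrD intrM.
rewrite -[X in _ = _ * X + _]pmulrn pchar_Fp_0 //.
by rewrite mulr0 add0r.
Qed.

Lemma redD c c' : red (c + c') = red c + red c'.
Proof. by rewrite /red /= expn1 Fp_modz intrD. Qed.

Lemma redM c c' : red (c * c') = red c * red c'.
Proof. by rewrite /red /= expn1 Fp_modz intrM. Qed.

Lemma red1 : red 1 = 1.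
Proof. by rewrite /red /= expn1 Fp_modz. Qed.

Lemma red0 : red 0 = 0.
Proof. by apply: (addrI (red 0)); rewrite -redD !addr0. Qed.

Lemma redN c : red (- c) = - red c.
Proof. by apply: (addrI (red c)); rewrite -redD !subrr red0. Qed.

Lemma red_nat n : red n%:R = n%:R.
Proof. by elim: n => [|n IHn]; rewrite ?red0 // !mulrS redD red1 IHn. Qed.

Lemma red_int (n : int) : red n%:~R = n%:~R.
Proof. by case: n => n; rewrite ?NegzE ?mulrNz ?redN -!pmulrn red_nat. Qed.

Lemma red_surj (v : 'F_p) : exists c, red c = v.
Proof. by exists (v : nat)%:R; rewrite red_nat natr_Zp. Qed.

Lemma padic_natE k n : (k%:R : padic p) n = (k%:Z %% (p ^ n)%N%:Z)%Z.
Proof.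
elim: k => [|k IHk]; first by [].
by rewrite mulrS /= IHk modzDml modzDmr -addn1 PoszD addrC.
Qed.

Lemma padic_mulp c n : (p%:R * c) n = ((p%:Z * c n) %% (p ^ n)%N%:Z)%Z.
Proof. by rewrite /= padic_natE modzMml. Qed.

Lemma padic_tfree c : p%:R * c = 0 -> c = 0.
Proof.
move=> pc; apply: padicP => n; rewrite [RHS]mod0z (pcoef_compat c n).
have := congr1 (fun x : padic p => x n.+1) pc.
rewrite padic_mulp [RHS]mod0z expnS PoszM => /dvdz_mod0P.
rewrite dvdz_mul2l; last by rewrite eqz_nat -lt0n prime_gt0.
by move=> /dvdz_mod0P.
Qed.

(** Dividing all the truncations by [p] and shifting the index by one gives the
quotient. *)
Lemma padic_red0 c : red c = 0 -> exists c', c = p%:R * c'.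
Proof.
move=> c0; have p0 : p%:Z != 0 by rewrite eqz_nat -lt0n prime_gt0.
have c1 : (p%:Z %| c 1%N)%Z.
  have p1 := pchar_Fp p_pr.
  move: c0; rewrite /red; have := pcoef_mod c 1%N; rewrite expn1.
  have : 0 <= c 1%N by rewrite -pcoef_mod modz_ge0 // expn1.
  case: (c 1%N) => // k _ _ /eqP; rewrite -pmulrn -(dvdn_pcharf p1) => pk.
  by rewrite dvdzE.
have cd n : (p%:Z %| c n.+1)%Z.
  elim: n => // n IHn; rewrite (divz_eq (c n.+2) (p ^ n.+1)%N%:Z) -pcoef_compat.
  by rewrite rpredD ?dvdz_mull // expnS PoszM dvdz_mulr.
have mk n : ((c n.+2 %/ p%:Z)%Z %% (p ^ n)%N%:Z)%Z = ((c n.+1 %/ p%:Z)%Z %% (p ^ n)%N%:Z)%Z.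
  have e : c n.+1 = (c n.+2 %% (p ^ n.+1)%N%:Z)%Z by exact: pcoef_compat.
  rewrite [in RHS]e [in LHS](divz_eq (c n.+2) (p ^ n.+1)%N%:Z) expnS PoszM.
  by rewrite mulrCA mulrC divzMDl // modzMDl.
exists (padic_mk mk); apply: padicP => n; rewrite padic_mulp /= modzMmr mulrC divzK //.
exact: pcoef_compat.
Qed.

End PadicReduction.

Section PadicBasis.
Context (p : nat) (p_pr : prime p) (L : lmodType (padic p)) (I : finType) (bas : I -> L).
Hypothesis basP : forall x : L, exists! c : {ffun I -> padic p}, x = \sum_i c i *: bas i.

Lemma crd_ex x : exists c : {ffun I -> padic p}, x = \sum_i c i *: bas i.
Proof. by have [c [cx _]] := basP x; exists c. Qed.

Definition crd x := projT1 (cid (crd_ex x)).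

Lemma crdE x : x = \sum_i crd x i *: bas i.
Proof. exact: projT2 (cid (crd_ex x)). Qed.

Lemma crd_uniq x (c : I -> padic p) : x = \sum_i c i *: bas i -> forall i, crd x i = c i.
Proof.
move=> xc i; have [c0 [_ c0U]] := basP x.
rewrite -(c0U _ (crdE x)) (c0U (finfun c)) ?ffunE // xc.
by apply: eq_bigr => j _; rewrite ffunE.
Qed.

(** The coordinates in [L / p L]. *)
Definition mco x i := red (crd x i).

Lemma mcoD x y i : mco (x + y) i = mco x i + mco y i.
Proof.
rewrite -(redD p_pr); congr red; apply: (@crd_uniq _ (fun j => crd x j + crd y j)).
rewrite [in LHS](crdE x) [in LHS](crdE y) -big_split.
by apply: eq_bigr => j _; rewrite scalerDl.
Qed.

Lemma mcoZ c x i : mco (c *: x) i = red c * mco x i.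
Proof.
rewrite -(redM p_pr); congr red; apply: (@crd_uniq _ (fun j => c * crd x j)).
by rewrite [in LHS](crdE x) scaler_sumr; apply: eq_bigr => j _; rewrite scalerA.
Qed.

Lemma mco0r i : mco 0 i = 0.
Proof. by apply: (addrI (mco 0 i)); rewrite -mcoD !addr0. Qed.

Lemma mcoN x i : mco (- x) i = - mco x i.
Proof. by apply: (addrI (mco x i)); rewrite -mcoD !subrr mco0r. Qed.

Lemma mco_sum J (r : seq J) (P : pred J) (E : J -> L) i :
  mco (\sum_(j <- r | P j) E j) i = \sum_(j <- r | P j) mco (E j) i.
Proof. exact: (big_morph (fun x => mco x i) (fun x y => mcoD x y i) (mco0r i)). Qed.

Lemma mco_bas i j : mco (bas i) j = (i == j)%:R.
Proof.
rewrite /mco (@crd_uniq _ (fun k => (i == k)%:R)) ?(red_nat p_pr) //.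
rewrite (bigD1 i) //= eqxx scale1r big1 ?addr0 // => k.
by rewrite eq_sym => /negPf ->; rewrite scale0r.
Qed.

Lemma mco_surj (v : I -> 'F_p) : exists x, forall i, mco x i = v i.
Proof.
have /choice[c cv] : forall i, exists c, red c = v i by move=> i; exact: red_surj.
exists (\sum_i c i *: bas i) => i; rewrite mco_sum (bigD1 i) //= mcoZ mco_bas eqxx mulr1.
by rewrite cv big1 ?addr0 // => j /negPf ji; rewrite mcoZ mco_bas ji mulr0.
Qed.

Lemma mco_mulp x i : mco (p%:R *: x) i = 0.
Proof. by rewrite mcoZ (red_nat p_pr) pchar_Fp_0 // mul0r. Qed.

Lemma mco_eq0 x : (forall i, mco x i = 0) -> exists y, x = p%:R *: y.
Proof.
move=> x0; have /choice[c cE] : forall i, exists c, crd x i = p%:R * c.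
  by move=> i; exact: padic_red0 (x0 i).
exists (\sum_i c i *: bas i); rewrite scaler_sumr [LHS]crdE.
by apply: eq_bigr => i _; rewrite cE scalerA.
Qed.

Lemma lmod_tfree (x : L) : p%:R *: x = 0 -> x = 0.
Proof.
move=> px; rewrite [x]crdE big1 // => i _; suff -> : crd x i = 0 by rewrite scale0r.
have e : forall j, crd (p%:R *: x) j = p%:R * crd x j.
  apply: crd_uniq; rewrite [in LHS](crdE x) scaler_sumr.
  by apply: eq_bigr => j _; rewrite scalerA.
have e0 : forall j, crd (p%:R *: x) j = 0.
  by apply: crd_uniq; rewrite px big1 // => j _; rewrite scale0r.
by apply: (padic_tfree p_pr); rewrite -e e0.
Qed.

Lemma mco_lie (br : lie_bracket L) u x k :
  mco (br u x) k = \sum_i mco x i * mco (br u (bas i)) k.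
Proof.
have br0 : br u 0 = 0 by apply: (addrI (br u 0)); rewrite -lieDr !addr0.
rewrite [in LHS](crdE x) (big_morph (br u) (lieDr br u) br0) mco_sum.
by apply: eq_bigr => i _; rewrite lieZr mcoZ.
Qed.

End PadicBasis.

(** * The Chevalley algebra modulo p *)

Section Chevalley.
Context (p : nat) (p_pr : prime p) (Phi : rootSystem).
Hypothesis p_nice : nice_prime p Phi.
Local Notation l := (rs_rank Phi).
Local Notation V := 'rV[rat]_l.
Local Notation roots := (rs_roots Phi).
Local Notation coroot := (@rs_coroot Phi).
Context (L : lmodType (padic p)) (br : lie_bracket L) (D : 'I_l -> V) (h : 'I_l -> L) (e : V -> L).
Hypotheses (baseD : is_base roots D) (chev : chevalley_basis br D h e).
Local Notation I := ('I_l + roots)%type.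

Definition chev_vec (i : I) : L := match i with inl i => h i | inr a => e (val a) end.

Lemma chev_vecP (x : L) : exists! c : {ffun I -> padic p}, x = \sum_i c i *: chev_vec i.
Proof.
have [[c1 c2] [/= xc cU]] := chev_basis chev x.
exists [ffun i : I => match i with inl i => c1 i | inr a => c2 a end]; split.
  rewrite xc big_sumType /=; congr (_ + _); apply: eq_bigr => i _; by rewrite ffunE.
move=> c' xc'.
have /cU[-> ->] : x = \sum_i (([ffun i => c' (inl i)] : {ffun 'I_l -> padic p}), ([ffun a => c' (inr a)] : {ffun roots -> padic p})).1 i *: h i
   + \sum_(a : roots) (([ffun i => c' (inl i)] : {ffun 'I_l -> padic p}), ([ffun a => c' (inr a)] : {ffun roots -> padic p})).2 a *: e (val a).
  rewrite {1}xc' big_sumType /=; congr (_ + _); apply: eq_bigr => i _; by rewrite ffunE.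
by apply/ffunP => -[i|a]; rewrite !ffunE.
Qed.

Local Notation co := (mco chev_vecP).
Local Notation n_ i a := ((numq (pairing coroot a (D i)))%:~R : 'F_p).

Lemma Fp_nat_neq0 k : (0 < k < 5)%N -> k%:R != 0 :> 'F_p.
Proof.
case: p_nice => p5 _ /andP[k0 k5]; rewrite -(dvdn_pcharf (pchar_Fp p_pr)).
by apply/negP => /(dvdn_leq k0); lia.
Qed.

Lemma pairing_intE a b : a \in roots -> b \in roots -> pairing coroot a b = (numq (pairing coroot a b))%:~R.
Proof.
move=> aR bR; have [_ _ _ /(_ b a bR aR)[ab _ _]] := rs_axiom Phi.
by have /intrP[z ->] := ab; rewrite numq_int.
Qed.

Lemma pairingN a b : pairing coroot (- a) b = - pairing coroot a b.
Proof. by rewrite /pairing mulNmx mxE. Qed.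

Lemma root_opp a : a \in roots -> - a \in roots.
Proof.
move=> aR; have [_ _ /(_ a aR) aa /(_ a a aR aR)[_ + _]] := rs_axiom Phi.
by rewrite aa scaler_nat mulr2n opprD addrA subrr add0r.
Qed.

Lemma root_neq0 a : a \in roots -> a != 0.
Proof. by move=> aR; apply: contraNneq (_ : 0 \notin roots) => [<- //|]; case: (rs_axiom Phi). Qed.

Lemma baseR i : D i \in roots. Proof. by case: baseD. Qed.

Lemma n_opp i a : a \in roots -> n_ i (- a) = - n_ i a.
Proof. by move=> aR; rewrite pairingN numqN mulrNz. Qed.

Lemma co_hh i j k : co (br (h i) (h j)) k = 0.
Proof. by rewrite (chev_hh chev) mco0r. Qed.

Lemma co_he i (a : roots) k : co (br (h i) (e (val a))) k = n_ i (val a) * (inr a == k)%:R.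
Proof. by rewrite (chev_he chev) ?fsvalP // mcoZ // red_int // -(mco_bas p_pr chev_vecP (inr a)). Qed.

Lemma co_anti x y k : co (br x y) k = - co (br y x) k.
Proof.
rewrite -mcoN //; congr mco; apply/eqP; rewrite -addr_eq0; apply/eqP.
have := liexx br (x + y); rewrite lieDl !lieDr !liexx add0r addr0 => <-; by rewrite addrC.
Qed.

(** The integers [m i] describe both the coroot of [a] and the bracket of [e a] with
[e (- a)]. *)
Lemma opp_coroot a : a \in roots -> exists2 m : 'I_l -> int,
  coroot a = \sum_i (m i)%:~R *: coroot (D i) &
  forall k, co (br (e a) (e (- a))) k = if k is inl i then (m i)%:~R else 0.
Proof.
move=> aR; have [m cm bm] := chev_opp chev aR; exists m => // k.
rewrite bm mco_sum //.
have E i : co ((m i)%:~R *: h i) k = (m i)%:~R * (inl i == k)%:R.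
  by rewrite mcoZ // red_int // -(mco_bas p_pr chev_vecP (inl i)).
rewrite (eq_bigr _ (fun i _ => E i)); case: k {E} => [i|a'].
  rewrite (bigD1 i) //= eqxx mulr1 big1 ?addr0 // => j ji.
  by rewrite (_ : (inl j == inl i :> I) = false) ?mulr0 //; apply/eqP => -[ji']; rewrite ji' eqxx in ji.
by rewrite big1 // => j _; rewrite mulr0.
Qed.

Lemma pairing_coroot (m : 'I_l -> int) a b : coroot b = \sum_i (m i)%:~R *: coroot (D i) ->
  a \in roots -> b \in roots -> numq (pairing coroot a b) = \sum_i m i * numq (pairing coroot a (D i)).
Proof.
move=> bm aR bR; apply: (@intr_inj rat); rewrite -pairing_intE // /pairing bm mulmx_sumr summxE.
rewrite rmorph_sum; apply: eq_bigr => i _ /=.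
by rewrite -scalemxAr mxE intrM -pairing_intE ?baseR.
Qed.

(** A bracket of root vectors [e a] and [e b] with [a + b] nonzero is a multiple of
[e (a + b)], and [a + b] is not [b]. *)
Lemma co_ee (a b : roots) k : val a + val b != 0 -> 
  (if k is inr c then c = b else True) -> co (br (e (val a)) (e (val b))) k = 0.
Proof.
move=> ab0 kb; have aR := fsvalP a; have bR := fsvalP b.
case: (boolP (val a + val b \in roots)) => [abR|abR]; last by rewrite (chev_ee0 chev) ?mco0r.
have ne : co (e (val a + val b)) k = 0.
  rewrite -[e _]/(chev_vec (inr [` abR]%fset)) mco_bas //; case: k kb => [i _|c ->]; first by [].
  case: eqP => // -[/(congr1 val) /= /eqP].
  by rewrite -subr_eq0 addrK (negPf (root_neq0 aR)).
have [r _ [->|->]] := chev_ee chev aR bR abR; rewrite ?mcoN // mcoZ // ne mulr0 ?oppr0 //.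
Qed.

Lemma dyn_nodes_uniq Ts : uniq (dyn_nodes Ts).
Proof.
apply: allpairs_uniq_dep => [|k _|]; rewrite ?iota_uniq //.
by move=> /= [k i] [k' i'] _ _ [-> ->].
Qed.

(** For the base [D'] with a known Cartan matrix [P], expressing the coroots of [D']
in those of [D] factors [P] over the integers as [N M], where the rows of [N] are the roots
[D' i] as functions on the torus. As [P] is invertible modulo [p], so is [N]. *)
Lemma torus_annihilator (z : 'I_l -> 'F_p) :
  (forall a, a \in roots -> \sum_i z i * n_ i a = 0) -> forall i, z i = 0.
Proof.
move=> hz; have [Ts hTs] := rs_types Phi; have [vT sT [D' [D'R _ _] D'P]] := hTs.
have /choice[m mP] : forall j, exists m : 'I_l -> int, coroot (D' j) = \sum_i (m i)%:~R *: coroot (D i).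
  by move=> j; have [m mE _] := opp_coroot (D'R j); exists m.
pose nd i := nth (0, 0)%N (dyn_nodes Ts) i.
pose P : 'M['F_p]_l := \matrix_(i, j) (dyn_block Ts (nd i) (nd j))%:~R.
pose N : 'M['F_p]_l := \matrix_(i, j) n_ j (D' i).
pose M : 'M['F_p]_l := \matrix_(i, j) (m j i)%:~R.
have PNM : P = N *m M.
  apply/matrixP => i j; rewrite !mxE.
  have -> : dyn_block Ts (nd i) (nd j) = numq (pairing coroot (D' i) (D' j)) by rewrite D'P numq_int.
  rewrite (pairing_coroot (mP j)) // (big_morph _ (@intrD 'F_p) (erefl _)).
  by apply: eq_bigr => k _; rewrite intrM !mxE mulrC.
have Pu : P \in unitmx.
  rewrite unitmxE unitfE -det_tr; apply/negP => /det0P[v v0 vP].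
  case/negP: v0; apply/eqP/rowP => i; rewrite mxE.
  (* a vector of the kernel as a function on the nodes of the diagram *)
  pose c u := if insub (index u (dyn_nodes Ts)) is Some j then v 0 (j : 'I_l) else 0.
  have cE (j : 'I_l) : c (nd j) = v 0 j.
    by rewrite /c index_uniq ?dyn_nodes_uniq ?sT // insubT //= => jl; congr (v 0 _); exact: val_inj.
  rewrite -cE; apply: (@dyn_block_nondegenerate _ _ _ Ts c) => //.
  - exact: (@Fp_nat_neq0 2).
  - exact: (@Fp_nat_neq0 3).
  - move=> n nT; rewrite -(dvdn_pcharf (pchar_Fp p_pr)).
    by case: p_nice => _ /(_ Ts n hTs nT).
  - move=> u uT; rewrite (big_nth (0, 0)%N) sT big_mkord.
    have uE : u = nd (index u (dyn_nodes Ts)) by rewrite /nd nth_index.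
    have ul : (index u (dyn_nodes Ts) < l)%N by rewrite -sT index_mem.
    have := congr1 (fun A : 'rV_l => A 0 (Ordinal ul)) vP; rewrite !mxE => E.
    rewrite -[RHS]E; apply: eq_bigr => j _.
    by rewrite cE !mxE /= -uE mulrC.
  - by rewrite mem_nth ?sT.
have Nu : N \in unitmx by move: Pu; rewrite PNM unitmx_mul => /andP[].
pose zc : 'cV['F_p]_l := \col_i z i.
have Nz : N *m zc = 0.
  apply/matrixP => i j; rewrite !mxE -[RHS](hz _ (D'R i)).
  by apply: eq_bigr => k _; rewrite !mxE mulrC.
move=> i; have := congr1 (fun A : 'cV_l => (invmx N *m A) i 0) Nz.
by rewrite mulKmx // mulmx0 !mxE.
Qed.

(** Let all brackets of [Z] with basis elements lie on one line modulo [p]. If [Z] has a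
nonzero coordinate at [a], then [[e (- a), Z]] has a nonzero toral coordinate and
generates the line. Since [[h_i, Z]] has no toral coordinate, it vanishes, which forces
[a] to vanish on the torus; but [a] takes the value [2] on its coroot and [p] is odd. So [Z] is
toral, [[e b, Z]] is a multiple of [e b], and comparing [b] with [- b] shows that all these
multiples are zero. Then [Z = 0] by [torus_annihilator]. *)
Lemma chevalley_nondegenerate (Z : L) (ell : I -> 'F_p) :
  (forall u : I, exists x, forall k, co (br (chev_vec u) Z) k = x * ell k) ->
  forall k, co Z k = 0.
Proof.
move=> hZ; pose z := co Z.
have brZ u k : co (br u Z) k =
    \sum_i z (inl i) * co (br u (h i)) k + \sum_(a : roots) z (inr a) * co (br u (e (val a))) k.
  by rewrite mco_lie // big_sumType.
have brh i k : co (br (h i) Z) k = if k is inr a then z (inr a) * n_ i (val a) else 0.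
  rewrite brZ big1 ?add0r => [|j _]; last by rewrite co_hh mulr0.
  case: k => [j|a]; first by rewrite big1 // => a _; rewrite co_he !mulr0.
  rewrite (bigD1 a) //= co_he eqxx mulr1 big1 ?addr0 // => b /negPf ba; rewrite co_he.
  by rewrite (_ : (inr b == inr a :> I) = (b == a)) // ba !mulr0.
have z0 (a : roots) : z (inr a) = 0.
  apply/eqP; apply: contraT => za.
  have aR := fsvalP a; have a'R := root_opp aR.
  have [m mE mP] := opp_coroot a'R.
  (* the sum of the [m i * n_i (a)] is [-2] *)
  have [i mi ni] : exists2 i, (m i)%:~R != 0 :> 'F_p & n_ i (val a) != 0.
    have := congr1 (fun n : int => n%:~R : 'F_p) (pairing_coroot mE aR a'R).
    have -> : numq (pairing coroot (val a) (- val a)) = -2.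
      apply: (@intr_inj rat); rewrite -pairing_intE //.
      have [_ _ /(_ _ a'R) + _] := rs_axiom Phi.
      by rewrite pairingN => /eqP; rewrite eqr_oppLR => /eqP ->.
    rewrite (big_morph _ (@intrD 'F_p) (erefl _)) => E.
    have : \sum_i (m i * numq (pairing coroot (val a) (D i)))%:~R != 0 :> 'F_p.
      by rewrite -E mulrNz oppr_eq0; exact: (@Fp_nat_neq0 2).
    case: (pselect (exists2 i, (m i)%:~R != 0 :> 'F_p & n_ i (val a) != 0)) => // nex.
    case/eqP; apply: big1 => i _; apply/eqP; rewrite intrM mulf_eq0.
    apply/negPn/negP; rewrite negb_or => /andP[? ?]; by apply: nex; exists i.
  (* the toral coordinates of [[e (- a), Z]] come from the coordinate of [Z] at [a] alone *)
  have eai : co (br (e (- val a)) Z) (inl i) = z (inr a) * (m i)%:~R.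
    rewrite brZ big1 ?add0r => [|j _]; last first.
      rewrite co_anti (co_he j [` a'R]%fset) (_ : (inr _ == inl i :> I) = false) //.
      by rewrite mulr0 oppr0 mulr0.
    rewrite (bigD1 a) //= big1 ?addr0 => [|b ba]; last first.
      rewrite (@co_ee [` a'R]%fset b) ?mulr0 //= addrC subr_eq0.
      by apply: contraNneq ba => /val_inj ->.
    by congr (_ * _); rewrite -[X in br _ (e X)]opprK mP.
  have [x xP] := hZ (inr [` a'R]%fset).
  have li : ell (inl i) != 0.
    by apply/eqP => li0; have := xP (inl i); rewrite eai li0 mulr0 => /eqP;
       rewrite mulf_eq0 (negPf za) (negPf mi).
  have [y yP] := hZ (inl i).
  have y0 : y = 0.
    have := yP (inl i); rewrite brh => /esym/eqP.
    by rewrite mulf_eq0 (negPf li) orbF => /eqP.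
  have := yP (inr a); rewrite brh y0 mul0r => /eqP.
  by rewrite mulf_eq0 (negPf za) (negPf ni).
pose s b := \sum_i z (inl i) * n_ i b.
have bre (b : roots) k : co (br (e (val b)) Z) k = - s (val b) * (inr b == k)%:R.
  rewrite brZ [X in _ + X]big1 ?addr0 => [|a _]; last by rewrite z0 mul0r.
  rewrite /s -sumrN mulr_suml; apply: eq_bigr => i _.
  by rewrite co_anti co_he mulrN mulrA mulNr.
(* otherwise the line would be spanned by the coordinate vectors at [b] and at [- b] *)
have s0 b : b \in roots -> s b = 0.
  move=> bR; apply/eqP; apply: contraT => sb; have b'R := root_opp bR.
  have [x xP] := hZ (inr [` bR]%fset); have [y yP] := hZ (inr [` b'R]%fset).
  have sb' : s (- b) = - s b.
    by rewrite /s -sumrN; apply: eq_bigr => i _; rewrite n_opp // mulrN.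
  have := xP (inr [` bR]%fset); rewrite bre eqxx mulr1 /= => xb.
  have x0 : x != 0 by apply: contraNneq sb => x0; rewrite x0 mul0r in xb; rewrite -oppr_eq0 xb.
  have := xP (inr [` b'R]%fset); rewrite bre (_ : (_ == _) = false); last first.
    apply/eqP => /(congr1 (fun k : I => if k is inr c then val c else 0)) /= bb.
    have : b *+ 2 = 0 by rewrite mulr2n {2}bb subrr.
    move/eqP; rewrite -scaler_nat scaler_eq0 pnatr_eq0 /= => /eqP b0.
    by have := root_neq0 bR; rewrite b0 eqxx.
  rewrite mulr0 => /esym/eqP; rewrite mulf_eq0 (negPf x0) /= => /eqP l0.
  have := yP (inr [` b'R]%fset); rewrite bre l0 eqxx mulr1 mulr0 /= sb' opprK => /eqP.
  by rewrite (negPf sb).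
by case=> [i|a]; [exact: (torus_annihilator s0)|exact: z0].
Qed.

End Chevalley.

Definition ring_comm (A : pzRingType) (x y : A) := x * y - y * x.

(** * Commutators with group elements *)

Section RingCommutator.
Context (K : fieldType) (A : algType K).
Implicit Types a x y : A.

Lemma ring_commM a x y : ring_comm a (x * y) = ring_comm a x * y + x * ring_comm a y.
Proof. by rewrite /ring_comm mulrBl mulrBr !mulrA addrA subrK. Qed.

Lemma ring_commD a x y : ring_comm a (x + y) = ring_comm a x + ring_comm a y.
Proof. by rewrite /ring_comm mulrDr mulrDl opprD addrACA. Qed.

Lemma ring_commN a x : ring_comm a (- x) = - ring_comm a x.
Proof. by rewrite /ring_comm mulrN mulNr opprB addrC opprK. Qed.

Lemma ring_commZ a (c : K) x : ring_comm a (c *: x) = c *: ring_comm a x.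
Proof. by rewrite /ring_comm -scalerAl -scalerAr scalerBr. Qed.

Lemma ring_comm0 a : ring_comm a 0 = 0.
Proof. by rewrite /ring_comm mulr0 mul0r subrr. Qed.

Lemma ring_comm1 a : ring_comm a 1 = 0.
Proof. by rewrite /ring_comm mulr1 mul1r subrr. Qed.

Lemma ring_comm_sum a I (r : seq I) (P : pred I) (E : I -> A) :
  ring_comm a (\sum_(i <- r | P i) E i) = \sum_(i <- r | P i) ring_comm a (E i).
Proof. exact: (big_morph (ring_comm a) (ring_commD a) (ring_comm0 a)). Qed.

Lemma ring_comm_sub1 a x : ring_comm (a - 1) x = ring_comm a x.
Proof. exact: sub1_comm. Qed.

Lemma ring_comm_subr1 a x : ring_comm a (x - 1) = ring_comm a x.
Proof. by rewrite ring_commD ring_commN ring_comm1 subr0. Qed.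

End RingCommutator.

Section Bracket.
Context (K : fieldType) (p d : nat) (G : topGroupType) (kap : G -> 'I_d -> K) (g : 'I_d -> G).
Hypotheses (p_char : p \in [pchar K]) (p_gt2 : (2 < p)%N) (fr : power_frame p kap g).
Local Notation H n := (powers G (p ^ n)).
Local Notation Om := (iwasawa K G).
Local Notation mO := (@aug_ideal K G).
Local Notation idO := (aug_ideal_ideal K G).
Local Notation pow k := (ideal_pow mO k).
Local Notation MP := (mpoly d K).
Local Notation homog k := (ishomog1 k mdeg).
Local Notation bO := (fun i => iw_elt K (g i) - 1).
Local Notation F := (iw_filtration K G).
Local Notation ev := (ev (K := K) bO).
Local Notation sym := (sym mO bO).
Local Notation gr_poly := (@gr_poly K d G g).
Local Notation A1 := (iw_sub (K := K) (powers G p)).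
Local Notation "-: k" := (- (Posz k)) (at level 10).
Local Notation X_ j := (mpolyX K (mnm1 j)).
Local Notation bO_in := (@bO_in K d G g).

Lemma iw_elt_pow (x : G) n : iw_elt K (x ^+ (p ^ n))%g - 1 = (iw_elt K x - 1) ^+ (p ^ n).
Proof. exact: (iota_sub1X (charA p_char Om) (@iw_elt1 K G) (@iw_eltM K G)). Qed.

Lemma ring_comm_iw_elt (x y : G) : ring_comm (iw_elt K x) (iw_elt K y) = iw_elt K (y * x)%g * (iw_elt K [~ x, y]%g - 1).
Proof. exact: (iota_comm (@iw_eltM K G)). Qed.

(** The coordinates of [x] in [G / G^p] are the coefficients of the linear symbol of
[x - 1]. *)
Lemma sym_iw_elt (x : G) : sym 1 (iw_elt K x - 1) (lin (kap x)).
Proof.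
rewrite /lin -[\sum_k _]add0r -(subrK (\sum_i kap x i *: bO i) (iw_elt K x - 1)).
apply: (symD idO).
  apply: sym_low.
  exact: (iota_lin p_char p_gt2 fr (@iw_elt1 K G) (@iw_eltM K G) idO (@iw_elt_aug K G)).
apply: (sym_sum idO) => i _; apply: (symZ idO); exact: (sym_b idO).
Qed.

Lemma sym_iw_elt0 (x : G) : sym 0 (iw_elt K x) 1.
Proof.
rewrite -(subrK 1 (iw_elt K x)) -[X in sym _ _ X]add0r; apply: (symD idO); last exact: (sym1 idO).
by apply: sym_low; apply/(pow1 idO); exact: iw_elt_aug.
Qed.

Context (a : G) (s : nat).
Hypothesis comm_a : forall y, H s [~ a, y]%g.
Local Notation rho := (iw_elt K a - 1).

(** [a y - y a = y a ([a, y] - 1)] for [y] in [G], and [[a, y]] is a [p^s]-th power;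
such elements span the finite levels. *)
Lemma ring_comm_low (x : Om) : pow (p ^ s) (ring_comm rho x).
Proof.
apply/(powE p_char p_gt2 fr) => N; have idN := aug_level_ideal K N.
rewrite ring_comm_sub1 /ring_comm omD omN !omM.
have [r ->] := grp_span (x N).
rewrite mulr_sumr mulr_suml -sumrB; apply: (pow_sum idN) => u _.
rewrite -scalerAl -scalerAr -scalerBr; apply: (powZ idN).
rewrite (iota_comm (@grpM K G N)); apply: (powMl idN).
have [c _ <-] := comm_a u.2.
exact: (pow_powers p_char (@grp1 K G N) (@grpM K G N) idN (@aug_grp K G N)).
Qed.

(** Leibniz rule: a factor of degree [1] is replaced by one of degree [p^s]. *)
Lemma ring_comm_pow k (x : Om) : pow k x -> pow (k + (p ^ s).-1) (ring_comm rho x).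
Proof.
have s0 : (0 < p ^ s)%N by rewrite expn_gt0; apply/orP; left; exact: leq_trans p_gt2.
have m1 y : mO y -> pow (p ^ s) (ring_comm rho y) by move=> _; exact: ring_comm_low.
elim: k x => [|k IHk] x.
  by move=> _; apply: (pow_le idO) (ring_comm_low x); rewrite add0n leq_pred.
suff : ideal_mul (pow k) mO `<=` [set x | pow (k.+1 + (p ^ s).-1) (ring_comm rho x)] by apply.
apply: ideal_mul_ind => /=.
- by rewrite ring_comm0; exact: (pow0 idO).
- by move=> {}x y hx hy; rewrite ring_commD; exact: (powD idO).
- move=> {}x y hx hy; rewrite ring_commM; apply: (powD idO).
    rewrite addSn -addn1; apply: (powM idO); first exact: IHk.
    exact/(pow1 idO).
  apply: (pow_eq (k := k + p ^ s)); first by rewrite -[in LHS](prednK s0) addnS addSn.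
  by apply: (powM idO) => //; exact: m1.
Qed.

Lemma filtration_bracket (k : int) (x : Om) :
  F k x -> F (k - (p ^ s).-1%:Z) (ring_comm rho x).
Proof.
have [k0|k0] := ltP 0 k.
  move=> _; apply: (@fil_incr _ _ F (-: (p ^ s).-1)); first by rewrite lerBrDr addNr ltW.
  by apply/filE; have := @ring_comm_pow 0 x; rewrite add0n; apply.
have kE : k = -: `|k|%N by lia.
by rewrite kE => /filE hx; rewrite -opprD -PoszD; apply/filE; exact: ring_comm_pow.
Qed.

Section OnPowers.
Hypothesis comm_ap : forall y, H s.+1 [~ a, y ^+ p]%g.

(** Leibniz rule again, now with factors [b_i^p = g_i^p - 1] of degree [p], replaced by
factors of degree [p^(s+1)]. *)
Lemma ring_comm_pth k P : P \is homog k -> pth p P ->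
  pow (k + (p ^ s.+1 - p)) (ring_comm rho (ev P)).
Proof.
have p0 : (0 < p)%N by exact: leq_trans p_gt2.
have ps : (p <= p ^ s.+1)%N by rewrite -{1}[p]expn1 leq_pexp2l.
move=> /dhomogP hP pP; rewrite evE big_seq ring_comm_sum; apply: (pow_sum idO) => e eP.
rewrite ring_commZ; apply: (powZ idO).
have he i : (p %| e i)%N by apply: pP; rewrite -mcoeff_msupp.
have <- : mdeg e = k by exact: hP.
rewrite mdegE /mmap1; move: (p ^ s.+1 - p)%N (subnK ps) => D Dp.
suff [] : pow (\sum_(i < d) e i) (\prod_(i < d) bO i ^+ e i) /\
  pow ((\sum_(i < d) e i) + D) (ring_comm rho (\prod_(i < d) bO i ^+ e i)) by [].
have M k1 k2 (x y : Om) : pow k1 x /\ pow (k1 + D) (ring_comm rho x) ->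
    pow k2 y /\ pow (k2 + D) (ring_comm rho y) ->
    pow (k1 + k2) (x * y) /\ pow (k1 + k2 + D) (ring_comm rho (x * y)).
  move=> [x1 x2] [y1 y2]; split; first exact: (powM idO).
  rewrite ring_commM; apply: (powD idO).
    by apply: (pow_eq (k := k1 + D + k2)); [rewrite addnAC|exact: (powM idO)].
  by rewrite -addnA; exact: (powM idO).
have one : pow 0 (1 : Om) /\ pow (0 + D) (ring_comm rho (1 : Om)).
  by split=> //; rewrite ring_comm1; exact: (pow0 idO).
apply: (big_rec2 (fun n x => pow n x /\ pow (n + D) (ring_comm rho x))) => // i n x _ hx.
apply: (M _ _ _ _ _ hx).
rewrite -(divnK (he i)); elim: (e i %/ p)%N => [|q IHq]; first by rewrite mul0n expr0.
rewrite mulSn exprD; apply: (M) => //; split; first by apply: (powX1 idO); exact: bO_in.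
rewrite -{2}[p]expn1 -iw_elt_pow expn1 ring_comm_subr1 ring_comm_sub1 ring_comm_iw_elt.
apply: (powMl idO); rewrite addnC Dp; have [c _ <-] := comm_ap (g i).
exact: (pow_powers p_char (@iw_elt1 K G) (@iw_eltM K G) idO (@iw_elt_aug K G)).
Qed.

(** An element of [K[[G^p]]] is approximated by evaluations of forms in the [p]-th
powers, to which [ring_comm_pth] applies; for a sufficiently small error [ring_comm_pow]
is enough. *)
Lemma ring_comm_sub k (x : Om) : A1 x -> pow k x -> pow (k + (p ^ s.+1 - p)) (ring_comm rho x).
Proof.
move=> Ax hx; have [S1 SD SZ SM] := iw_sub_subalgebra K (H1_subgroup fr).
(* the error is again in [K[[G^p]]], so its symbol is a form in the [p]-th powers *)
have approx j : exists y, [/\ A1 (x - y), pow (k + j) (x - y) & pow (k + (p ^ s.+1 - p)) (ring_comm rho y)].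
  elim: j => [|j [y [Axy hxy hy]]].
    by exists 0; rewrite subr0 addn0 ring_comm0; split=> //; exact: (pow0 idO).
  have [P pP [hP sP]] := sub_sym p_char p_gt2 fr Axy hxy.
  exists (y + ev P); rewrite opprD addrA addnS; split=> //.
    apply: (SD) => //; rewrite -scaleN1r; apply: (SZ); rewrite -(pihomog_dE hP).
    exact: (A1_pi p_char fr).
  rewrite ring_commD; apply: (powD idO) => //.
  by apply: (pow_le idO) (ring_comm_pth hP pP); rewrite leq_add2r leq_addr.
have [y [_ hxy hy]] := approx (p ^ s.+1 - p)%N.
rewrite -(subrK y x) ring_commD; apply: (powD idO) => //.
by apply: (pow_le idO) (ring_comm_pow hxy); rewrite leq_addr.
Qed.

Lemma filtration_bracket_sub (k : int) (x : Om) : F k x -> A1 x ->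
  F (k - (p ^ s.+1 - p)%N%:Z) (ring_comm rho x).
Proof.
have [k0|k0] := ltP 0 k.
  move=> _ Ax; apply: (@fil_incr _ _ F (-: (p ^ s.+1 - p))); first by rewrite lerBrDr addNr ltW.
  by apply/filE; have := @ring_comm_sub 0 x; rewrite add0n; apply.
have kE : k = -: `|k|%N by lia.
by rewrite kE => /filE hx Ax; rewrite -opprD -PoszD; apply/filE; exact: ring_comm_sub.
Qed.

End OnPowers.

Section Symbol.
Context (ka : 'I_d -> 'I_d -> K).
Hypothesis comm_ag : forall i, exists2 c, [~ a, g i]%g = (c ^+ (p ^ s))%g & kap c =1 ka i.

(** The derivation of the polynomial ring with [X_j |-> lin (ka j)^(p^s)]. *)
Definition twist (P : MP) : MP := \sum_j lin (ka j) ^+ (p ^ s) * mderiv j P.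

Lemma twistM P Q : twist (P * Q) = twist P * Q + P * twist Q.
Proof.
rewrite /twist mulr_suml mulr_sumr -big_split; apply: eq_bigr => j _.
by rewrite mderivM mulrDr !mulrA [P * _]mulrC.
Qed.

Lemma twistD P Q : twist (P + Q) = twist P + twist Q.
Proof. by rewrite /twist -big_split; apply: eq_bigr => j _; rewrite mderivD mulrDr. Qed.

Lemma twist0 : twist 0 = 0.
Proof. by rewrite /twist big1 // => j _; rewrite mderiv0 mulr0. Qed.

Lemma twistZ c P : twist (c *: P) = c *: twist P.
Proof. by rewrite /twist scaler_sumr; apply: eq_bigr => j _; rewrite mderivZ scalerAr. Qed.

Lemma twist1 : twist 1 = 0.
Proof. by rewrite /twist big1 // => j _; rewrite -mpolyC1 mderivC mulr0. Qed.

Lemma mderiv_var i j : mderiv j (X_ i) = (i == j)%:R :> MP.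
Proof.
rewrite mderivX mnm1E; case: eqP => [->|_]; last by rewrite scale0r.
rewrite scale1r (_ : mnm_sub _ _ = mnm0) ?mpolyX0 //; apply/mnmP => k; by rewrite mnmBE subnn mnm0E.
Qed.

Lemma twist_var i : twist (X_ i) = lin (ka i) ^+ (p ^ s).
Proof.
rewrite /twist (bigD1 i) //= mderiv_var eqxx mulr1 big1 ?addr0 // => j.
by rewrite mderiv_var eq_sym => /negPf ->; rewrite mulr0.
Qed.

(** A relation which is stable under products by the Leibniz rule. *)
Definition dsym k (x : Om) (P : MP) :=
  sym k x P /\ sym (k + (p ^ s).-1) (ring_comm rho x) (twist P).

Lemma dsymM k l x y P Q : dsym k x P -> dsym l y Q -> dsym (k + l) (x * y) (P * Q).
Proof.
move=> [x1 x2] [y1 y2]; split; first exact: (symOM p_char p_gt2 fr).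
rewrite ring_commM twistM; apply: (symD idO).
  by rewrite addnAC; exact: (symOM p_char p_gt2 fr).
by rewrite -addnA; exact: (symOM p_char p_gt2 fr).
Qed.

Lemma dsym1 : dsym 0 1 1.
Proof.
by split; [exact: (sym1 idO)|rewrite ring_comm1 twist1; exact: (sym0 idO)].
Qed.

(** [[a, g_i] = c^(p^s)] and [c^(p^s) - 1 = (c - 1)^(p^s)], whose symbol is the
[p^s]-th power of a linear form. *)
Lemma dsym_b i : dsym 1 (bO i) (X_ i).
Proof.
have s0 : (0 < p ^ s)%N by rewrite expn_gt0; apply/orP; left; exact: leq_trans p_gt2.
split; first exact: (sym_b idO).
have [c cE ck] := comm_ag i; rewrite add1n prednK // ring_comm_subr1 ring_comm_sub1 ring_comm_iw_elt.
rewrite twist_var cE iw_elt_pow -[(p ^ s)%N]add0n -[X in sym _ _ X]mul1r.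
apply: (symOM p_char p_gt2 fr); first exact: sym_iw_elt0.
rewrite -{1}[(p ^ s)%N]mul1n; apply: (symX idO bO_in (@aug_O K G) (comm_O p_char p_gt2 fr)).
have -> : lin (ka i) = lin (kap c) by rewrite /lin; apply: eq_bigr => k _; rewrite ck.
exact: sym_iw_elt.
Qed.

Lemma dsym_mon (e : multinom d) : dsym (mdeg e) (mmap1 bO e) (mpolyX K e).
Proof.
rewrite mpolyXE_id mdegE /mmap1.
apply: (big_rec3 dsym) => [|i n x P _ hx]; first exact: dsym1.
apply: dsymM => //; elim: (e i) => [|q IHq]; first by rewrite !expr0; exact: dsym1.
by rewrite !exprS -add1n; apply: dsymM => //; exact: dsym_b.
Qed.

Lemma sym_ring_comm k P : P \is homog k -> sym (k + (p ^ s).-1) (ring_comm rho (ev P)) (twist P).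
Proof.
move=> /dhomogP hP; rewrite [X in twist X]mpolyE evE.
rewrite (big_morph twist twistD twist0) ring_comm_sum !big_seq; apply: (sym_sum idO) => e eP.
rewrite ring_commZ twistZ; apply: (symZ idO); have <- : mdeg e = k by exact: hP.
by have [] := dsym_mon e.
Qed.

Lemma gr_bracket_gr_poly k P : P \is homog k ->
  gr_bracket rho (p ^ s).-1 (gr_poly P) = gr_poly (twist P).
Proof.
move=> hP; rewrite (gr_poly_homog g hP) gr_bracket_symb.
- by rewrite (gr_poly_sym (sym_ring_comm hP)) PoszD opprD.
- by move=> j y; exact: filtration_bracket.
- by apply/filE; exact: (pow_ev idO bO_in).
Qed.

End Symbol.
End Bracket.

(** * Sources of derivations and the derivation hypothesis *)

Section Derivations.
Context (K : fieldType) (p d : nat) (G : topGroupType) (kap : G -> 'I_d -> K) (g : 'I_d -> G).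
Hypotheses (p_char : p \in [pchar K]) (p_gt2 : (2 < p)%N) (fr : power_frame p kap g).
Local Notation H n := (powers G (p ^ n)).
Local Notation Om := (iwasawa K G).
Local Notation mO := (@aug_ideal K G).
Local Notation idO := (aug_ideal_ideal K G).
Local Notation pow k := (ideal_pow mO k).
Local Notation MP := (mpoly d K).
Local Notation bO := (fun i => iw_elt K (g i) - 1).
Local Notation F := (iw_filtration K G).
Local Notation sym := (sym mO bO).
Local Notation gr_poly := (@gr_poly K d G g).
Local Notation A1 := (iw_sub (K := K) (powers G p)).
Local Notation X_ j := (mpolyX K (mnm1 j)).

(** The chain rule; the constants are in the subring over which [D] is linear. *)
Lemma derivation_gr_poly D P : derivation_over (gr_sub F A1) D ->
  D (gr_poly P) = \sum_j gr_poly (mderiv j P) * D (gr_poly (X_ j)).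
Proof.
move=> [DD DM DB]; pose ok Q := D (gr_poly Q) = \sum_j gr_poly (mderiv j Q) * D (gr_poly (X_ j)).
have B1c c : gr_sub F A1 (gr_poly (mpolyC d c)).
  apply/(gr_sub_pth p_char p_gt2 fr); exists (mpolyC d c) => //.
  by rewrite -[mpolyC d c]mulr1 mul_mpolyC -(mpolyX0 d K); apply: pthX => i; rewrite mnm0E dvdn0.
have D0 : D 0 = 0 by apply: (addrI (D 0)); rewrite -DD !addr0.
have D1 : D 1 = 0.
  by apply: (addrI (D 1)); have := DM 1 1; rewrite !mulr1 mul1r addr0 => <-.
have okc c : ok (mpolyC d c).
  rewrite /ok big1 => [|j _]; last by rewrite mderivC gr_poly0 mul0r.
  by rewrite -[gr_poly _]mulr1 DB // D1 mulr0.
have okX i : ok (X_ i).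
  rewrite /ok (bigD1 i) //= mderiv_var eqxx gr_poly1 mul1r big1 ?addr0 // => j.
  by rewrite mderiv_var eq_sym => /negPf ->; rewrite gr_poly0 mul0r.
have okD Q R : ok Q -> ok R -> ok (Q + R).
  move=> hQ hR; rewrite /ok gr_polyD DD hQ hR -big_split; apply: eq_bigr => j _.
  by rewrite mderivD gr_polyD mulrDl.
have [grC _ _ _] := gr_domain p_char p_gt2 fr.
have okM Q R : ok Q -> ok R -> ok (Q * R).
  move=> hQ hR; rewrite /ok (gr_polyM p_char p_gt2 fr) DM hQ hR mulr_suml mulr_sumr -big_split.
  apply: eq_bigr => j _; rewrite mderivM gr_polyD !(gr_polyM p_char p_gt2 fr) mulrDl.
  by rewrite -!mulrA [D _ * _]grC.
rewrite -/(ok P) [P]mpolyE; elim/big_ind: _ => [|//|e _]; first exact: (okc 0).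
rewrite -mul_mpolyC; apply: (okM) => //; rewrite mpolyXE_id.
elim/big_ind: _ => [|//|i _]; first exact: (okc 1).
by elim: (e i) => [|q IHq]; [exact: (okc 1)|rewrite exprS; apply: (okM)].
Qed.

Lemma principal_gr_poly X P : principal (gr_poly X) (gr_poly P) <-> mdvd X P.
Proof.
split=> [[b _ ]|[y ->]]; last by exists (gr_poly y) => //; rewrite -(gr_polyM p_char p_gt2 fr).
have [y ->] := gr_poly_surj p_char p_gt2 fr b.
by rewrite -(gr_polyM p_char p_gt2 fr) => /(gr_poly_inj p_char p_gt2 fr) <-; exists y.
Qed.

Hypotheses (frobK : forall c : K, c ^+ p = c)
  (comm_all : forall a s, (forall i, H s [~ a, g i]%g) -> forall y, H s [~ a, y]%g)
  (comm_expg : forall s a y, H s [~ a, y]%g -> H s.+1 [~ a, y ^+ p]%g).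
Context (C : 'I_d -> 'I_d -> 'I_d -> K) (t : nat).
Hypothesis comm_lim : forall i j, exists n0, forall n, (n0 <= n)%N ->
  exists2 c, [~ g i ^+ (p ^ n), g j]%g = (c ^+ (p ^ (n + t)))%g & kap c =1 C i j.
Hypothesis nondeg : forall z l : 'I_d -> K,
  (forall i, exists a, forall k, \sum_j C i j k * z j = a * l k) -> forall j, z j = 0.

Lemma comm_lim_uniform i : exists n0, forall n j, (n0 <= n)%N ->
  exists2 c, [~ g i ^+ (p ^ n), g j]%g = (c ^+ (p ^ (n + t)))%g & kap c =1 C i j.
Proof.
have [n0 n0P] := choice (comm_lim i); exists (\max_j n0 j)%N => n j hn.
by apply: n0P; apply: leq_trans hn; exact: leq_bigmax.
Qed.

(** The elements have symbols [X_i^(p^n)] of different degrees. *)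
Lemma iw_elt_pow_inj i : injective (fun n => iw_elt K (g i ^+ (p ^ n))%g - 1).
Proof.
have p1 : (1 < p)%N by exact: ltnW.
have lt m n : (m < n)%N -> iw_elt K (g i ^+ (p ^ m))%g - 1 <> iw_elt K (g i ^+ (p ^ n))%g - 1.
  move=> mn e; have X0 : X_ i ^+ (p ^ m) = 0 :> MP.
    have s : sym (p ^ m) (iw_elt K (g i ^+ (p ^ m))%g - 1) (X_ i ^+ (p ^ m)).
      rewrite (iw_elt_pow p_char) -[X in sym X]mul1n.
      apply: (symX idO (@bO_in K d G g) (@aug_O K G) (comm_O p_char p_gt2 fr)).
      exact: (sym_b idO).
    case: s => hX hs; apply: (indep_O p_char p_gt2 fr hX).
    have h : pow (p ^ m).+1 (iw_elt K (g i ^+ (p ^ m))%g - 1).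
      rewrite e (iw_elt_pow p_char); apply: (pow_le idO (l := p ^ n)); first by rewrite ltn_exp2l.
      by apply: (powX1 idO); exact: iw_elt_aug.
    by have := powB idO h hs; rewrite opprB addrC subrK.
  have : mcoeff (mnm_muln (mnm1 i) (p ^ m)) (X_ i ^+ (p ^ m) : MP) = 1.
    by rewrite mpolyXn mcoeffX eqxx.
  by rewrite X0 mcoeff0 => /esym/eqP; rewrite oner_eq0.
move=> m n /= e; case: (ltngtP m n) => // mn; first by have := lt _ _ mn.
by have := lt _ _ mn; rewrite e.
Qed.

(** For [a_r = g_i^(p^(r + n0)) - 1] and [s = r + n0 + t], the commutator with [a_r]
raises degrees by [p^s - 1] on [K[[G]]] and by [p^(s+1) - p] on [K[[G^p]]]; the difference
is [(p - 1) (p^s - 1)]. The functions [theta] and [theta1] live on the algebra, so the index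
[r] has to be recovered from [a_r]. *)
Lemma source_of_powers i n0 :
  (forall n j, (n0 <= n)%N ->
    exists2 c, [~ g i ^+ (p ^ n), g j]%g = (c ^+ (p ^ (n + t)))%g & kap c =1 C i j) ->
  exists theta theta1 : Om -> nat,
    source_of_derivations F A1 (fun r => iw_elt K (g i ^+ (p ^ (r + n0)))%g - 1) theta theta1 /\
    forall r, theta (iw_elt K (g i ^+ (p ^ (r + n0)))%g - 1) = (p ^ (r + n0 + t)).-1.
Proof.
move=> hn0; pose a r := iw_elt K (g i ^+ (p ^ (r + n0)))%g - 1.
have a_inj : injective a by move=> r r' /iw_elt_pow_inj; lia.
have comm_y r y : H (r + n0 + t) [~ g i ^+ (p ^ (r + n0)), y]%g.
  apply: comm_all => j; have [c -> _] := hn0 (r + n0)%N j (leq_addl _ _).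
  by exists c.
have idx : exists idx : Om -> nat, forall r, idx (a r) = r.
  have /choice[idx idxP] : forall x, exists r, (exists r', a r' = x) -> a r = x.
    move=> x; case: (pselect (exists r', a r' = x)) => [[r ar]|no]; first by exists r.
    by exists 0%N.
  by exists idx => r; apply: a_inj; apply: idxP; exists r.
have [{}idx idxP] := idx.
exists (fun x => (p ^ (idx x + n0 + t)).-1), (fun x => (p ^ (idx x + n0 + t).+1 - p)%N).
split=> [|r]; last by rewrite -/(a r) idxP.
split=> [r k x Fx|r k x Fx Ax|M]; rewrite -?/(a r) ?idxP.
- exact: (filtration_bracket p_char p_gt2 fr (comm_y r) Fx).
- apply: (filtration_bracket_sub p_char p_gt2 fr (comm_y r) _ Fx Ax) => y.
  exact: comm_expg.
exists M => r Mr; rewrite -/(a r) idxP; set s := (r + n0 + t)%N.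
have p1 : (1 < p)%N by exact: ltnW.
have sp : (s < p ^ s)%N by exact: ltn_expl.
have Ms : (M <= s)%N by rewrite /s -addnA; apply: leq_trans (leq_addr _ _).
rewrite expnS.
have e : (p * p ^ s = (p - 2) * p ^ s + 2 * p ^ s)%N by rewrite -mulnDl subnK.
have h : (p - 2 <= (p - 2) * p ^ s)%N by rewrite leq_pmulr // (leq_trans _ sp).
rewrite e; move: ((p - 2) * p ^ s)%N (p ^ s)%N h sp {e} => y x; lia.
Qed.

(** The sources of [source_of_powers] act on the graded ring by
[Y |-> \sum_j lin (C i j)^(p^s) dY/dX_j]. If [Y] is in the closure of [(X)] for all of
them, [twist_closed_dvd] shows that [X] divides the partial derivatives of [Y]. *)
Theorem derivation_hypothesis_of_frame : derivation_hypothesis F A1.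
Proof.
move=> X Y hX hY hcl D hD.
have [kX [X0 [XE _]]] := homogeneous_gr_poly p_char p_gt2 fr hX.
have [k [P [YE hP]]] := homogeneous_gr_poly p_char p_gt2 fr hY.
have /choice[R hR] : forall i, exists R, forall r, (R <= r)%N ->
    mdvd X0 (\sum_j lin (C i j) ^+ (p ^ r) * mderiv j P).
  move=> i; have [n0 n0P] := comm_lim_uniform i.
  have [theta [theta1 [src thetaE]]] := source_of_powers n0P.
  have [R hR] := hcl _ _ _ src; exists (R + n0 + t)%N => r Rr.
  have [r' rE] : exists r', r = (r' + n0 + t)%N by exists (r - n0 - t)%N; lia.
  have := hR r' _; rewrite XE YE thetaE.
  rewrite (gr_bracket_gr_poly p_char p_gt2 fr (ka := C i) _ _ hP).
  - by move=> h; rewrite rE; apply/principal_gr_poly/h; lia.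
  - apply: comm_all => j; have [c -> _] := n0P (r' + n0)%N j (leq_addl _ _).
    by exists c.
  - by move=> j; apply: n0P; exact: leq_addl.
have cl : twist_closed p C X0 (\max_i R i) (fun j => mderiv j P).
  move=> i r hr; apply: hR; apply: leq_trans hr; exact: leq_bigmax.
have dP := twist_closed_dvd p_char frobK nondeg cl.
rewrite YE (derivation_gr_poly _ hD) XE.
have [y yE] := choice dP; exists (\sum_j gr_poly (y j) * D (gr_poly (X_ j))) => //.
by rewrite mulr_sumr; apply: eq_bigr => j _; rewrite (yE j) (gr_polyM p_char p_gt2 fr) mulrA.
Qed.

End Derivations.

(** * Uniform groups of Chevalley type *)

Theorem theoremA (p : nat) (p_pr : prime p) (Phi : rootSystem)
    (G : topGroupType) (G_unif : uniform_pro_p p G) (G_type : of_type p G Phi)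
    (p_nice : nice_prime p Phi) :
  frobenius_pair p (iw_filtration 'F_p G) (iw_sub (powers G p)) /\
  derivation_hypothesis (iw_filtration 'F_p G) (iw_sub (powers G p)).
Proof.
have [proG _ powG _] := G_unif; have [p5 _] := p_nice.
have p_gt2 : (2 < p)%N by lia.
have p_odd : odd p by case: (even_prime p_pr) => // p2; rewrite p2 in p_gt2.
have p_char := pchar_Fp p_pr.
have [L [br [D [h [e [t [lg [baseD chev _ LG]]]]]]]] := G_type.
pose I := ('I_(rs_rank Phi) + rs_roots Phi)%type.
pose basP := chev_vecP chev; pose bas := chev_vec h e.
pose co (x : L) (i : 'I_#|{: I}|) := mco basP x (enum_val i).
have coD x y i : co (x + y) i = co x i + co y i by exact: mcoD.
have coS v : exists x, forall i, co x i = v i.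
  have [x xv] := mco_surj p_pr basP (fun k => v (enum_rank k)).
  by exists x => i; rewrite /co xv enum_valK.
have cop x i : co (p%:R *: x) i = 0 by exact: mco_mulp.
have co0 x : (forall i, co x i = 0) -> exists y, x = p%:R *: y.
  by move=> hx; apply: (mco_eq0 p_pr (basP := basP)) => k; rewrite -(enum_rankK k); exact: hx.
have tfree := lmod_tfree p_pr basP.
have /choice[g gl] : forall i : 'I_#|{: I}|, exists x, lam LG x = bas (enum_val i).
  by move=> i; exact: lam_surj.
pose kap' := kap LG co.
have gP i j : kap' (g i) j = (i == j)%:R.
  by rewrite /kap' /kap gl /co mco_bas // (inj_eq enum_val_inj).
have H_mul := H_mul LG tfree.
have fr : power_frame p kap' g.
  split.
  - by move=> n; exact: (H_sub LG tfree).
  - by move=> n; exact: (open_H p_pr p_odd proG powG LG tfree coD cop co0).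
  - by move=> n x y; exact: (comm_H p_pr p_odd proG H_mul powG).
  - by move=> n x y; exact: (expg_morph_H p_pr p_odd proG H_mul powG).
  - by move=> x y i; exact: (kapM p_pr p_odd proG powG LG tfree coD cop co0).
  - exact: gP.
  - by move=> x hx; apply/(kap_H1 p_pr proG LG tfree cop co0); rewrite expn1.
  - move=> P Pg PM; have -> : powers G p = powers G (p ^ 1) by rewrite expn1.
    exact: (gen_ind p_pr p_odd proG powG tfree coD cop co0 gP Pg PM).
  - exact: (H_many_cosets p_pr p_odd proG powG LG tfree coD coS cop co0).
  - exact: (H_cofinal p_pr proG).
split; first exact: (iw_frobenius p_char p_gt2 fr).
(* the structure constants of [L / p L] *)
pose C (i j k : 'I_#|{: I}|) := co (br (bas (enum_val i)) (bas (enum_val j))) k.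
apply: (@derivation_hypothesis_of_frame 'F_p p _ G _ _ p_char p_gt2 fr _ _ _ C t).
(* the little theorem of Fermat *)
- by move=> c; have := expf_card c; rewrite card_Fp.
- move=> a s; exact: (comm_all p_pr p_odd proG powG tfree coD cop co0 gP).
- move=> s a y hs; have h2 := comm_expg_H p_pr p_odd proG H_mul powG hs.
  have [_ HM HV] := H_sub LG tfree s.+1.
  have h3 : powers G (p ^ s.+1) ([~ a, y]%g ^+ p)%g.
    by have [c _ <-] := hs; exists c => //; rewrite -expgM expnSr.
  by have := HM _ _ h3 (powers_le (leqnSn s.+1) h2); rewrite mulKVg.
- move=> i j; have [n0 hn0] := comm_limit p_pr p_odd proG powG LG tfree coD cop co0 (g i) (g j).
  exists n0 => n /hn0[c -> kc]; exists c => // k.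
  by have := kc k; rewrite !gl.
- move=> z l hz; have [Z Zz] := coS z.
  have Z0 : forall k, mco basP Z k = 0.
    apply: (chevalley_nondegenerate p_pr p_nice baseD (chev := chev) (ell := fun k => l (enum_rank k))).
    move=> u; have [a ha] := hz (enum_rank u); exists a => k.
    rewrite -ha mco_lie // (reindex_onto enum_val enum_rank) /=; last by move=> i _; exact: enum_rankK.
    apply: eq_big => i; first by rewrite enum_valK eqxx.
    by rewrite enum_valK -Zz /C /co !enum_rankK mulrC.
  by move=> j; rewrite -Zz; exact: Z0.
Qed.
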